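(* Let $m\in A^+$ be irreducible of degree $d$, let $f(u)\in\mathbb{F}_p[u]$ be a monic irreducible polynomial, and let $\alpha$ be a root of $f$ (in an algebraic closure of $\mathbb{F}_p$). Then: (1) $f(u)$ divides $\bar Z_m^{(-)}(u)$ in $\mathbb{F}_p[u]$ if and only if $m\mid B_n^{\alpha}$ in $A$ for some integer $n$ with $1\le n\le q^d-2$ and $n\not\equiv 0 \pmod{q-1}$. (2) $f(u)$ divides $\bar Z_m^{(+)}(u)$ in $\mathbb{F}_p[u]$ if and only if $m\mid B_n^{\alpha}$ in $A$ for some integer $n$ with $1\le n\le q^d-2$ and $n\equiv 0 \pmod{q-1}$.
   Context: Let $q$ be a power of a prime $p$, $A=\mathbb{F}_q[T]$, $k=\mathbb{F}_q(T)$, and $A^+$ the set of monic polynomials in $A$. For integers $n\ge1$, $i\ge0$, set $s_i(n)=\sum_{a\in A^+,\ \deg a=i} a^n\in A$. Writing $n=\sum_j a_jq^j$ with $0\le a_j\le q-1$, let $l(n)=\sum_j a_j$; it is known that $s_i(n)=0$ whenever $i>l(n)/(q-1)$, so $C_n(u)=\sum_{i\ge0}s_i(n)u^i\in A[u]$. Define $B_n(u)=C_n(u)$ if $n\not\equiv 0\pmod{q-1}$, and $B_n(u)=C_n(u)/(1-u)=\sum_{i\ge0}\big(\sum_{j=0}^i s_j(n)\big)u^i$ if $n\equiv0\pmod{q-1}$ (this lies in $A[u]$ since $C_n(1)=0$ in that case). For $\alpha$ algebraic over $\mathbb{F}_p$, let $s=[\mathbb{F}_q(\alpha):\mathbb{F}_q]$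 and let $\alpha_1,\dots,\alpha_s$ be the conjugates of $\alpha$ over $\mathbb{F}_q$; define $B_n^{\alpha}=N_{\mathbb{F}_{q^s}(T)/\mathbb{F}_q(T)}(B_n(\alpha))=\prod_{i=1}^s B_n(\alpha_i)\in A$. Carlitz module: for $x\in\bar k$ and $m\in A$, $m*x=m(\varphi+\mu)(x)$ where $\varphi(x)=x^q$, $\mu(x)=Tx$. For $m\in A^+$, $K_m=k(\Lambda_m)$ with $\Lambda_m=\{x\in\bar k: m*x=0\}$ is the $m$-th cyclotomic function field; $\mathrm{Gal}(K_m/k)\cong(A/mA)^\times$, and $K_m^+$ is the subfield fixed by $\mathbb{F}_q^\times\subseteq (A/mA)^\times$ (the maximal real subfield). For a global function field $K$ over $\mathbb{F}_q$ there is $Z_K(u)\in\mathbb{Z}[u]$ with $\zeta(s,K)=Z_K(q^{-s})/((1-q^{-s})(1-q^{1-s}))$. Let $Z_m(u)=Z_{K_m}(u)$, $Z_m^{(+)}(u)=Z_{K_m^+}(u)$, and $Z_m^{(-)}(u)=Z_m(u)/Z_m^{(+)}(u)\in\mathbb{Z}[u]$. Let $\bar Z_m^{(\pm)}(u)\in\mathbb{F}_p[u]$ denote the reductions of $Z_m^{(\pm)}(u)$ modulo $p$. *)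

(* Defs.v *)
From HB Require Import structures.
From mathcomp Require Import all_boot all_order all_algebra all_field.
Set Implicit Arguments. Unset Strict Implicit. Unset Printing Implicit Defensive.
Import Order.TTheory GRing.Theory Num.Theory.
Local Open Scope ring_scope.

Section Carlitz.
Variables (F : finFieldType) (L : fieldType) (iota : {fraction {poly F}} -> L).

Definition embA (a : {poly F}) : L := iota (@FracField.tofrac _ a).

Definition carlitz_T (x : L) : L := x ^+ #|F| + embA 'X * x.
Definition carlitz (m : {poly F}) (x : L) : L :=
  \sum_(i < size m) embA (m`_i)%:P * iter i carlitz_T x.

Definition field_closed (S : L -> Prop) : Prop :=
  [/\ S 0, S 1, (forall x y, S x -> S y -> S (x - y)),
      (forall x y, S x -> S y -> S (x * y)) & (forall x, S x -> S x^-1)].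

Definition cyclo_field (m : {poly F}) (x : L) : Prop :=
  forall S : L -> Prop, field_closed S ->
    (forall c, S (iota c)) -> (forall y, carlitz m y = 0 -> S y) -> S x.
End Carlitz.

(* K_m^+ : fixed field in K_m of F_q^* <= (A/mA)^* = Gal(K_m/k); the element
   c in F_q^* acts as the k-automorphism sending lambda |-> c * lambda = c*lambda
   on Lambda_m (every automorphism of K_m extends to the algebraic closure L). *)
Definition cyclo_field_plus (F : finFieldType) (L : fieldType)
    (iota : {rmorphism {fraction {poly F}} -> L}) (m : {poly F}) (x : L) : Prop :=
  cyclo_field iota m x /\
  forall (c : F) (sigma : {rmorphism L -> L}), c != 0 ->
    (forall a, sigma (iota a) = iota a) ->
    (forall y, carlitz iota m y = 0 -> sigma y = embA iota c%:P * y) ->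
    sigma x = x.

Section Places.
Variables (F : finFieldType) (L : fieldType) (iota : {fraction {poly F}} -> L).
Variable K : L -> Prop.

(* O is a valuation ring of K/F_q (= a place of K): a proper subring of K
   containing F_q such that x or x^-1 lies in O for every nonzero x in K. *)
Definition is_place (O : L -> Prop) : Prop :=
  [/\ (forall x, O x -> K x),
      O 0, O 1, (forall x y, O x -> O y -> O (x - y)) &
      (forall x y, O x -> O y -> O (x * y))] /\
  [/\ (forall c : F, O (embA iota c%:P)),
      (exists x, K x /\ ~ O x) &
      (forall x, K x -> x != 0 -> O x \/ O x^-1)].

Definition place_ideal (O : L -> Prop) (x : L) : Prop :=
  O x /\ (x = 0 \/ ~ O x^-1).

(* the residue field O/P has exactly q^e elements, i.e. deg P = e *)
Definition place_deg (O : L -> Prop) (e : nat) : Prop :=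
  exists r : 'I_(#|F| ^ e) -> L,
    (forall i, O (r i)) /\
    (forall x, O x -> exists i, place_ideal O (x - r i) /\
                     forall i', place_ideal O (x - r i') -> i' = i).

Definition nplaces (e N : nat) : Prop :=
  exists P : 'I_N -> (L -> Prop),
    [/\ (forall i, is_place (P i) /\ place_deg (P i) e),
        (forall i j, (forall x, P i x <-> P j x) -> i = j) &
        (forall O, is_place O -> place_deg O e ->
           exists i, forall x, O x <-> P i x)].

(* Z is the polynomial Z_K(u) with
   zeta(s,K) = Z_K(q^-s)/((1-q^-s)(1-q^(1-s))), where (Euler product)
   zeta(s,K) = prod_P (1 - u^deg P)^-1, u = q^-s.  Equivalently, as power
   series, Z(u) * prod_e (1-u^e)^(B_e) = (1-u)(1-qu), B_e = #places of deg e;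
   we state it modulo u^(N+1) for every N. *)
Definition is_zeta_poly (Z : {poly int}) : Prop :=
  exists B : nat -> nat,
    (forall e, (0 < e)%N -> nplaces e (B e)) /\
    forall N i, (i <= N)%N ->
      (Z * \prod_(1 <= e < N.+1) (1 - 'X^e) ^+ B e)`_i =
      ((1 - 'X) * (1 - (#|F|%:R : int) *: 'X))`_i.
End Places.

Section Bn.
Variable F : finFieldType.

Definition power_sum (i n : nat) : {poly F} :=
  \sum_(c : {ffun 'I_i -> F}) ('X^i + \sum_(k < i) c k *: 'X^k) ^+ n.

(* C_n(u) = sum_i s_i(n) u^i; s_i(n) = 0 for i > l(n)/(q-1), and
   l(n)/(q-1) <= n, so summing over i <= n gives the whole sum. *)
Definition Cn (n : nat) : {poly {poly F}} := \poly_(i < n.+1) power_sum i n.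

(* B_n(u) = C_n(u) if (q-1) does not divide n, else
   C_n(u)/(1-u) = sum_i (sum_{j<=i} s_j(n)) u^i  (of degree < n). *)
Definition Bn (n : nat) : {poly {poly F}} :=
  if (#|F|.-1 %| n)%N
  then \poly_(i < n.+1) \sum_(j < i.+1) power_sum j n
  else Cn n.

Definition Bn_eval (Omega : fieldType) (j : F -> Omega) (n : nat) (beta : Omega)
  : {poly Omega} :=
  \sum_(i < size (Bn n)) map_poly j ((Bn n)`_i) * (beta ^+ i)%:P.

(* B_n^alpha = prod over the conjugates alpha^(q^i), i < s, of alpha over F_q
   (s = [F_q(alpha):F_q]) of B_n(alpha^(q^i)). *)
Definition Bn_norm (Omega : fieldType) (j : F -> Omega) (n : nat) (alpha : Omega)
  (s : nat) : {poly Omega} :=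
  \prod_(i < s) Bn_eval j n (alpha ^+ (#|F| ^ i)).

Definition deg_over_Fq (Omega : fieldType) (alpha : Omega) (s : nat) : Prop :=
  [/\ (0 < s)%N, alpha ^+ (#|F| ^ s) = alpha &
      forall t, (0 < t < s)%N -> alpha ^+ (#|F| ^ t) != alpha].

Definition divA (Omega : fieldType) (j : F -> Omega) (m : {poly F})
  (B : {poly Omega}) : Prop :=
  exists g : {poly F}, B = map_poly j (m * g).
End Bn.

(* Main.v *)
(** Fix a root theta of m, let h be 1 or q - 1, let lambda be a nonzero m-torsion
    point and nu = lambda^h, so that k(nu) is K_m or K_m^+.  The polynomial Psi_h
    over A with root nu has degree N_h = (q^d - 1) / h, reduces to X^N_h modulo m
    and is separable modulo every other prime P.  Hence the places of k(nu) above P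
    are the Frobenius orbits of the roots of Psi_h modulo P: there are N_h / f_P of
    them, of degree f_P deg P, where f_P is the order of P(theta)^h; m is totally
    ramified, and infinity lies below N_(q-1) rational places.  By
    1 - Y^f = prod_(k < f) (1 - w^k Y), for w a primitive f-th root of unity, the
    Euler product of Z modulo p is then the product over k < N_h of the L-series
    prod_P (1 - P(theta)^(h k) u^(deg P))^-1, which is C_(h k)(u) at T = theta.  The
    places at infinity contribute exactly the factors 1 - u by which C_n and B_n
    differ, so Z modulo p is the product of the B_(h k)(u) at T = theta, for
    1 <= k < N_h.  Finally m divides B_n^alpha iff B_n(u) at T = theta vanishes at
    some conjugate alpha^(q^i), and Z modulo p, which has coefficients in F_p,
    vanishes at alpha as soon as it vanishes at one of these. *)

Require Import Defs.
From HB Require Import structures.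
From mathcomp Require Import all_boot all_order all_algebra all_field.
From mathcomp Require Import zify ring.
From mathcomp Require boolp classical_sets.
Import Order.TTheory GRing.Theory Num.Theory.
Local Open Scope ring_scope.
Set Implicit Arguments. Unset Strict Implicit. Unset Printing Implicit Defensive.

(** * Frobenius and evaluation *)

(** No character of characteristic 0 occurs. Since Z matters only modulo p, Teichmueller lifts are
    replaced by the characters a |-> a(theta)^n with values in [Omega] itself, whose L-series are
    visibly the C_n, and 1 - q u becomes 1. The obstacle is that a place is an arbitrary valuation
    ring inside a subset of [L], so all places must be found and counted by hand. Each one is
    presented as the localisation of a ring F[s, x] at the kernel of a homomorphism into [Omega]. It
    suffices that one element generates this kernel locally and that every nonzero element has a
    multiple which, up to local units, is a power of that generator. Over the finite primes s = T
    and x = nu; at infinity the generators are new coordinates z and y, with residues 0 and -1. At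
    infinity the equations do not show that the residue homomorphism is well defined. It is obtained
    from an extension of the infinite place of k to all of [L], by Zorn's lemma, and carried to the
    other torsion points by endomorphisms of [L] over k. Euler products are compared modulo u^(K+1)
    only, so that all of them are finite. *)

Section Frobenius.
Variables (F : finFieldType) (E : comNzRingType) (j : {rmorphism F -> E}).

Lemma card_pchar_pnat : [pchar E].-nat #|F|.
Proof.
have [p p_pr pF] := finPcharP F.
have pE : p \in [pchar E] by apply: (rmorph_pchar j).
rewrite (eq_pnat _ (pcharf_eq pE)).
by rewrite (card_pprimeChar pF) pnatX pnat_id.
Qed.

Lemma frobD e (x y : E) : (x + y) ^+ (#|F| ^ e) = x ^+ (#|F| ^ e) + y ^+ (#|F| ^ e).
Proof. by apply: exprDn_pchar; rewrite pnatX card_pchar_pnat. Qed.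

Lemma frob_const e c : j c ^+ (#|F| ^ e) = j c.
Proof.
elim: e => [|e IHe]; first by rewrite expn0 expr1.
by rewrite expnS exprM -rmorphXn expf_card.
Qed.

Lemma frob0 e : (0 : E) ^+ (#|F| ^ e) = 0.
Proof. by rewrite expr0n expn_eq0 -[_ == 0%N]negbK -lt0n ltnW ?finNzRing_gt1. Qed.

Lemma frob_sum e I (r : seq I) (P : pred I) (G : I -> E) :
  (\sum_(i <- r | P i) G i) ^+ (#|F| ^ e) = \sum_(i <- r | P i) G i ^+ (#|F| ^ e).
Proof. by apply: (big_morph (fun x : E => x ^+ (#|F| ^ e)) (frobD e) (frob0 e)). Qed.

Lemma frobN e (x : E) : (- x) ^+ (#|F| ^ e) = - x ^+ (#|F| ^ e).
Proof. by apply/eqP; rewrite -addr_eq0 -frobD addNr frob0. Qed.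
End Frobenius.

Section Eval.
Variables (F : finFieldType) (E : comNzRingType) (j : {rmorphism F -> E}).

Definition ev1 (s : E) (p : {poly F}) : E := (map_poly j p).[s].

HB.instance Definition _ s :=
  GRing.RMorphism.copy (ev1 s) (horner_eval s \o map_poly j).

(** An element of A[X] is a common name for a field element and for its residue: the same polynomial
    is evaluated at generators in [L] and at their residues in [Om]. The inner variable stands for
    T, or for z at infinity. *)
Definition ev2 (s x : E) (a : {poly {poly F}}) : E := (map_poly (ev1 s) a).[x].

HB.instance Definition _ s x :=
  GRing.RMorphism.copy (ev2 s x) (horner_eval x \o map_poly (ev1 s)).

Lemma ev1C s c : ev1 s c%:P = j c.
Proof. by rewrite /ev1 map_polyC hornerC. Qed.

Lemma ev1X s : ev1 s 'X = s.
Proof. by rewrite /ev1 map_polyX hornerX. Qed.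

Lemma ev1E s p : ev1 s p = \sum_(i < size p) j p`_i * s ^+ i.
Proof.
rewrite /ev1 (horner_coef_wide (n := size p)) ?size_map_poly ?size_poly //.
by apply: eq_bigr => i _; rewrite coef_map.
Qed.

Lemma ev2C s x p : ev2 s x p%:P = ev1 s p.
Proof. by rewrite /ev2 map_polyC hornerC. Qed.

Lemma ev2X s x : ev2 s x 'X = x.
Proof. by rewrite /ev2 map_polyX hornerX. Qed.

Lemma ev2E s x a : ev2 s x a = \sum_(i < size a) ev1 s a`_i * x ^+ i.
Proof.
rewrite /ev2 (horner_coef_wide (n := size a)) ?size_poly //.
by apply: eq_bigr => i _; rewrite coef_map.
Qed.

Lemma ev1_frob e s p : ev1 s p ^+ (#|F| ^ e) = ev1 (s ^+ (#|F| ^ e)) p.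
Proof.
rewrite !ev1E (frob_sum j); apply: eq_bigr => i _.
by rewrite exprMn frob_const exprAC.
Qed.

(* Explicit copies of the morphism laws: unifying with the generic [rmorphB] on
   [{poly {poly F}}] is prohibitively slow. *)
Lemma ev1_0 s : ev1 s 0 = 0. Proof. exact: rmorph0. Qed.
Lemma ev1_1 s : ev1 s 1 = 1. Proof. exact: rmorph1. Qed.
Lemma ev1D s (a b : {poly F}) : ev1 s (a + b) = ev1 s a + ev1 s b.
Proof. exact: rmorphD. Qed.
Lemma ev1M s (a b : {poly F}) : ev1 s (a * b) = ev1 s a * ev1 s b.
Proof. exact: rmorphM. Qed.
Lemma ev1N s (a : {poly F}) : ev1 s (- a) = - ev1 s a.
Proof. by apply/eqP; rewrite -addr_eq0 -ev1D addNr ev1_0. Qed.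
Lemma ev1B s (a b : {poly F}) : ev1 s (a - b) = ev1 s a - ev1 s b.
Proof. by rewrite ev1D ev1N. Qed.
Lemma ev1Xn s (a : {poly F}) n : ev1 s (a ^+ n) = ev1 s a ^+ n.
Proof. by elim: n => [|n IHn]; rewrite ?ev1_1 // !exprS ev1M IHn. Qed.
Lemma ev2_0 s x : ev2 s x 0 = 0. Proof. exact: rmorph0. Qed.
Lemma ev2_1 s x : ev2 s x 1 = 1. Proof. exact: rmorph1. Qed.
Lemma ev2D s x (a b : {poly {poly F}}) : ev2 s x (a + b) = ev2 s x a + ev2 s x b.
Proof. exact: rmorphD. Qed.
Lemma ev2M s x (a b : {poly {poly F}}) : ev2 s x (a * b) = ev2 s x a * ev2 s x b.
Proof. exact: rmorphM. Qed.
Lemma ev2N s x (a : {poly {poly F}}) : ev2 s x (- a) = - ev2 s x a.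
Proof. by apply/eqP; rewrite -addr_eq0 -ev2D addNr ev2_0. Qed.
Lemma ev2B s x (a b : {poly {poly F}}) : ev2 s x (a - b) = ev2 s x a - ev2 s x b.
Proof. by rewrite ev2D ev2N. Qed.
Lemma ev2Xn s x (a : {poly {poly F}}) n : ev2 s x (a ^+ n) = ev2 s x a ^+ n.
Proof. by elim: n => [|n IHn]; rewrite ?ev2_1 // !exprS ev2M IHn. Qed.

Lemma ev2_frob e s x a :
  ev2 s x a ^+ (#|F| ^ e) = ev2 (s ^+ (#|F| ^ e)) (x ^+ (#|F| ^ e)) a.
Proof.
rewrite !ev2E (frob_sum j); apply: eq_bigr => i _.
by rewrite exprMn ev1_frob exprAC.
Qed.
End Eval.

Lemma ev1_morph (F : finFieldType) (E E' : comNzRingType) (j : {rmorphism F -> E})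
    (j' : {rmorphism F -> E'}) (g : {rmorphism E -> E'}) s p :
  (forall c, g (j c) = j' c) -> g (ev1 j s p) = ev1 j' (g s) p.
Proof.
by move=> gj; rewrite !ev1E rmorph_sum; apply: eq_bigr => i _; rewrite rmorphM rmorphXn gj.
Qed.

Lemma ev2_morph (F : finFieldType) (E E' : comNzRingType) (j : {rmorphism F -> E})
    (j' : {rmorphism F -> E'}) (g : {rmorphism E -> E'}) s x a :
  (forall c, g (j c) = j' c) -> g (ev2 j s x a) = ev2 j' (g s) (g x) a.
Proof.
move=> gj; rewrite !ev2E rmorph_sum; apply: eq_bigr => i _.
by rewrite rmorphM rmorphXn (ev1_morph _ _ gj).
Qed.

(** * Carlitz polynomials *)

Section CarlitzRing.
Variables (F : finFieldType) (E : comNzRingType) (rho : {rmorphism {poly F} -> E}).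
Let q := #|F|.

Definition cst (c : F) : E := rho c%:P.
HB.instance Definition _ := GRing.RMorphism.copy cst (rho \o polyC).

(** The Carlitz action over an arbitrary A-algebra. For [rho = embA iota], [carl] is convertible to
    [carlitz iota]; it is also used in [Om], with T sent to a root of a prime, and in polynomial
    rings, where its value at X is the Carlitz polynomial. *)
Definition tau (x : E) : E := x ^+ q + rho 'X * x.
Definition carl (a : {poly F}) (x : E) : E :=
  \sum_(i < size a) rho (a`_i)%:P * iter i tau x.

Lemma q_gt1 : (1 < q)%N. Proof. exact: finNzRing_gt1. Qed.
Lemma q1_gt0 : (0 < q.-1)%N. Proof. by rewrite -subn1 subn_gt0 q_gt1. Qed.
Lemma q1K : q.-1.+1 = q. Proof. by rewrite prednK // ltnW ?q_gt1. Qed.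

Lemma tauD x y : tau (x + y) = tau x + tau y.
Proof. by rewrite /tau -[q]expn1 (frobD cst) mulrDr addrACA. Qed.

Lemma tauZ c x : tau (cst c * x) = cst c * tau x.
Proof.
by rewrite /tau exprMn -{1}[q]expn1 (frob_const cst) mulrDr mulrCA.
Qed.

Lemma tau0 : tau 0 = 0.
Proof. by rewrite /tau -[q]expn1 (frob0 F E) mulr0 addr0. Qed.

Lemma iter_tauZ i c x : iter i tau (cst c * x) = cst c * iter i tau x.
Proof. by elim: i => //= i ->; rewrite tauZ. Qed.

Lemma carlE n (a : {poly F}) x : (size a <= n)%N ->
  carl a x = \sum_(i < n) cst a`_i * iter i tau x.
Proof.
move=> le; rewrite /carl (big_ord_widen _ (fun i => cst a`_i * iter i tau x) le).
rewrite big_mkcond /=; apply: eq_bigr => i _.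
by case: ltnP => // h; rewrite nth_default // rmorph0 mul0r.
Qed.

Lemma carlD a b x : carl (a + b) x = carl a x + carl b x.
Proof.
rewrite !(@carlE (maxn (size a) (size b))) ?leq_maxl ?leq_maxr ?size_polyD //.
by rewrite -big_split /=; apply: eq_bigr => i _; rewrite coefD rmorphD mulrDl.
Qed.

Lemma carlC c x : carl c%:P x = cst c * x.
Proof. by rewrite (@carlE 1) ?size_polyC_leq1 // big_ord1 coefC. Qed.

Lemma carlZ c a x : carl (c *: a) x = cst c * carl a x.
Proof.
rewrite (@carlE (size a)) ?size_scale_leq // mulr_sumr.
by apply: eq_bigr => i _; rewrite coefZ rmorphM mulrA.
Qed.

Lemma carl0l x : carl 0 x = 0.
Proof. by rewrite -polyC0 carlC rmorph0 mul0r. Qed.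

Lemma carlB a b x : carl (a - b) x = carl a x - carl b x.
Proof. by rewrite carlD -scaleN1r carlZ rmorphN1 mulN1r. Qed.

Lemma carl1 x : carl 1 x = x.
Proof. by rewrite -polyC1 carlC rmorph1 mul1r. Qed.

Lemma carlZr a c x : carl a (cst c * x) = cst c * carl a x.
Proof. by rewrite mulr_sumr; apply: eq_bigr => i _; rewrite iter_tauZ mulrCA. Qed.

Lemma carl0 a : carl a 0 = 0.
Proof. by have := carlZr a 0 0; rewrite rmorph0 !mul0r. Qed.

Lemma carlXr a x : carl (a * 'X) x = carl a (tau x).
Proof.
have le : (size (a * 'X)%R <= (size a).+1)%N.
  by rewrite (leq_trans (size_polyMleq _ _)) // size_polyX addn2.
rewrite (carlE _ le) big_ord_recl coefMX /= rmorph0 mul0r add0r.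
by apply: eq_bigr => i _; rewrite coefMX /= -iterS iterSr.
Qed.

Lemma carlXl a x : carl ('X * a) x = tau (carl a x).
Proof.
rewrite mulrC carlXr /carl.
elim/big_rec2: _ => [|i y1 y2 _ ->]; first by rewrite tau0.
by rewrite tauD -/(cst _) tauZ -iterS iterSr.
Qed.

(** Constants commute with [tau] because the q-power map fixes F, so induction on a reduces
    everything to the factor T. *)
Lemma carlM a b x : carl (a * b) x = carl a (carl b x).
Proof.
elim/poly_ind: a b => [|a c IHa] b; first by rewrite mul0r !carl0l.
by rewrite mulrDl !carlD -mulrA IHa carlXl -carlXr mul_polyC carlZ carlC.
Qed.

Lemma carlXn i x : carl 'X^i x = iter i tau x.
Proof. by elim: i => [|i IHi]; rewrite ?carl1 // exprS carlXl IHi. Qed.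
End CarlitzRing.

Lemma carl_morph (F : finFieldType) (E E' : comNzRingType)
    (rho : {rmorphism {poly F} -> E}) (rho' : {rmorphism {poly F} -> E'})
    (g : {rmorphism E -> E'}) a x :
  (forall p, g (rho p) = rho' p) -> g (carl rho a x) = carl rho' a (g x).
Proof.
move=> gr; rewrite rmorph_sum; apply: eq_bigr => i _; rewrite rmorphM gr.
by congr (_ * _); elim: (i : nat) => //= k <-; rewrite rmorphD rmorphM rmorphXn gr.
Qed.

Section CarlitzQuotient.
Variables (F : finFieldType).
Let q := #|F|.

(* [brk j = (q^j - 1) / (q - 1)], the degree of [ec j]; the Carlitz polynomial
   of T^j is X * (ec j)(X^(q-1)). *)
Fixpoint brk (j : nat) : nat := if j is k.+1 then (q * brk k).+1 else 0.
Fixpoint ec (j : nat) : {poly {poly F}} :=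
  if j is k.+1 then 'X * ec k ^+ q + 'X%:P * ec k else 1.
Definition Ec (a : {poly F}) : {poly {poly F}} :=
  \sum_(i < size a) (a`_i)%:P *: ec i.

Lemma brkE j : (q.-1 * brk j)%N = (q ^ j).-1.
Proof.
elim: j => [|j IHj] /=; first by rewrite muln0.
have := q_gt1 F; have : (0 < q ^ j)%N by rewrite expn_gt0 ltnW ?q_gt1.
rewrite mulnS mulnCA IHj expnS -/q => h1 h2.
by rewrite -!subn1 mulnBr muln1 addnBA ?leq_pmulr // addnC; nia.
Qed.
End CarlitzQuotient.

Section CarlitzQuotientTheory.
Variables (F : finFieldType).
Let q := #|F|.
Implicit Types (a : {poly F}) (h : nat).

Lemma brk_mono i j : (i < j)%N -> (brk F i < brk F j)%N.
Proof.
elim: j => // j IHj; rewrite ltnS leq_eqVlt => /orP[/eqP -> | /IHj lt] /=.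
  by rewrite ltnS leq_pmull // ltnW ?q_gt1.
by rewrite ltnS (leq_trans (ltnW lt)) // leq_pmull // ltnW ?q_gt1.
Qed.

Lemma ec_spec j : ec F j \is monic /\ size (ec F j) = (brk F j).+1.
Proof.
elim: j => [|j [mo sz]] /=; first by rewrite monic1 size_poly1.
have mq : ec F j ^+ q \is monic by rewrite monic_exp.
have sq : size ('X * ec F j ^+ q) = (q * brk F j).+2.
  rewrite size_monicM ?monicX ?monic_neq0 // size_polyX /=.
  by rewrite -[size _]prednK ?size_poly_gt0 ?monic_neq0 // size_exp sz mulnC.
have lt : (size (('X%:P : {poly {poly F}}) * ec F j)%R < size ('X * ec F j ^+ q)%R)%N.
  rewrite sq (leq_ltn_trans (size_polyMleq _ _)) // sz size_polyC polyX_eq0 /=.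
  by rewrite !ltnS leq_pmull // ltnW ?q_gt1.
split; last by rewrite size_polyDl.
by rewrite monicE lead_coefDl // -monicE monicMl ?monicX.
Qed.

Lemma ec_at0 j : (ec F j).[0] = 'X^j.
Proof.
elim: j => [|j IHj] /=; first by rewrite hornerC.
by rewrite hornerD !hornerM hornerX hornerC mul0r add0r IHj exprS.
Qed.

Lemma Ec_spec a : a \is monic ->
  Ec a \is monic /\ size (Ec a) = (brk F (size a).-1).+1.
Proof.
move=> ma; have [d sa] : exists d, size a = d.+1.
  by exists (size a).-1; rewrite prednK // size_poly_gt0 monic_neq0.
have [md sd] := ec_spec d.
rewrite /Ec sa big_ord_recr /= -[d]/(d.+1.-1) -sa.
rewrite [a`__](monicP ma) sa /= polyC1 scale1r.
have lt : (size (\sum_(i < d) (a`_i)%:P *: ec F i)%R < size (ec F d))%N.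
  rewrite sd ltnS; apply: (leq_trans (size_sum _ _ _)).
  apply/bigmax_leqP => i _; apply: (leq_trans (size_scale_leq _ _)).
  by have [_ ->] := ec_spec i; apply: brk_mono.
rewrite addrC; split; last by rewrite size_polyDl.
by rewrite monicE lead_coefDl // -monicE.
Qed.

Lemma Ec_at0 a : (Ec a).[0] = a.
Proof.
rewrite /Ec horner_sum -[RHS]coefK poly_def; apply: eq_bigr => i _.
by rewrite hornerZ ec_at0 mul_polyC.
Qed.

(** C_a(X) = X Psi_h(X^h), so over [L] the roots of Psi_h for monic a are the h-th powers of the
    nonzero a-torsion points. For h = 1 this is C_a(X) / X, and for h = q - 1 it is [Ec a]. *)
Definition Psi h a : {poly {poly F}} := Ec a \Po 'X^(q.-1 %/ h).
Definition Nh h d : nat := (brk F d * (q.-1 %/ h))%N.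

Lemma Psi_spec h a : (h %| q.-1)%N -> (0 < h)%N -> a \is monic ->
  Psi h a \is monic /\ size (Psi h a) = (Nh h (size a).-1).+1.
Proof.
move=> hq h0 ma; have [mE sE] := Ec_spec ma.
have k0 : (0 < q.-1 %/ h)%N by rewrite divn_gt0 // dvdn_leq // q1_gt0.
have mP : Psi h a \is monic.
  by rewrite monicE lead_coef_comp ?size_polyXn ?ltnS // lead_coefXn expr1n mulr1.
split=> //; rewrite -[size _]prednK ?size_poly_gt0 ?monic_neq0 //.
by rewrite size_comp_poly sE size_polyXn.
Qed.

Lemma Nh_mul h d : (h %| q.-1)%N -> (Nh h d * h)%N = (q ^ d).-1.
Proof. by move=> hq; rewrite /Nh -mulnA divnK // mulnC brkE. Qed.

Lemma Psi_at0 h a : (h %| q.-1)%N -> (0 < h)%N -> (Psi h a).[0] = a.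
Proof.
move=> hq h0; have k0 : (0 < q.-1 %/ h)%N by rewrite divn_gt0 // dvdn_leq // q1_gt0.
by rewrite horner_comp hornerXn expr0n eqn0Ngt k0 Ec_at0.
Qed.

Section Horner.
Variables (E : comNzRingType) (rho : {rmorphism {poly F} -> E}).

Lemma iter_tau_ec j x :
  iter j (tau rho) x = x * (map_poly rho (ec F j)).[x ^+ q.-1].
Proof.
elim: j => [|j IHj] /=; first by rewrite rmorph1 hornerC mulr1.
rewrite IHj rmorphD !rmorphM rmorphXn /= map_polyX map_polyC /=.
rewrite hornerD !hornerM horner_exp hornerX hornerC /tau exprMn.
by rewrite -{1}(q1K F) exprS mulrDr -!mulrA; congr (_ + _); rewrite mulrCA.
Qed.

Lemma carl_Ec a x : carl rho a x = x * (map_poly rho (Ec a)).[x ^+ q.-1].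
Proof.
rewrite /carl /Ec rmorph_sum horner_sum mulr_sumr; apply: eq_bigr => i _.
by rewrite iter_tau_ec -mul_polyC rmorphM /= map_polyC hornerM hornerC mulrCA.
Qed.

Lemma Psi_Ec h a x : (h %| q.-1)%N ->
  (map_poly rho (Psi h a)).[x ^+ h] = (map_poly rho (Ec a)).[x ^+ q.-1].
Proof.
move=> hq; rewrite map_comp_poly rmorphXn /= map_polyX horner_comp hornerXn.
by rewrite -exprM mulnC divnK.
Qed.

Lemma carl_Psi h a x : (h %| q.-1)%N ->
  carl rho a x = x * (map_poly rho (Psi h a)).[x ^+ h].
Proof. by move=> hq; rewrite Psi_Ec // carl_Ec. Qed.
End Horner.
End CarlitzQuotientTheory.

(** * Roots of Carlitz polynomials over an algebraically closed field *)

Section CarlitzRoots.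
Variables (F : finFieldType) (E : closedFieldType) (rho : {rmorphism {poly F} -> E}).
Let q := #|F|.
Let crho := (polyC \o rho : {rmorphism {poly F} -> {poly E}}).

Definition Cpol (a : {poly F}) : {poly E} := carl crho a 'X.

Lemma horner_Cpol a x : (Cpol a).[x] = carl rho a x.
Proof.
have h p : horner_eval x (crho p) = rho p by rewrite /= horner_evalE hornerC.
by rewrite /Cpol -horner_evalE (carl_morph _ _ h) /= horner_evalE hornerX.
Qed.

Lemma root_Cpol a x : root (Cpol a) x = (carl rho a x == 0).
Proof. by rewrite rootE horner_Cpol. Qed.

Lemma Cpol_Psi h a : (h %| q.-1)%N ->
  Cpol a = 'X * (map_poly rho (Psi h a) \Po 'X^h).
Proof.
by move=> hq; rewrite /Cpol (carl_Psi _ _ _ hq) /comp_poly -map_poly_comp.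
Qed.

Lemma Cpol_spec a : a \is monic ->
  Cpol a \is monic /\ size (Cpol a) = (q ^ (size a).-1).+1.
Proof.
move=> ma; have [|||mP sP] := @Psi_spec F 1 a; rewrite ?dvd1n //.
have q0 : (0 < q ^ (size a).-1)%N by rewrite expn_gt0 ltnW ?q_gt1.
have N1 : Nh F 1 (size a).-1 = (q ^ (size a).-1).-1.
  by rewrite -(@Nh_mul F 1) ?dvd1n // muln1.
rewrite (@Cpol_Psi 1) ?dvd1n // expr1 comp_polyXr.
rewrite monicMl ?monicX // monic_map //; split=> //.
rewrite size_monicM ?monicX ?monic_neq0 ?monic_map // size_polyX /=.
by rewrite size_map_poly_id0 ?(monicP mP) ?rmorph1 ?oner_neq0 // sP N1 prednK.
Qed.

(** As q = 0 in [E], the derivative of [tau p] is T p', so that differentiation keeps only the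
    linear term of C_a. This is the source of all separability statements. *)
Lemma deriv_Cpol a : (Cpol a)^`() = (rho a)%:P.
Proof.
have qX : (q%:R : {poly E}) = 0.
  have [p p_pr pF] := finPcharP F.
  have pE : p \in [pchar {poly E}] by apply: (rmorph_pchar (cst crho)).
  rewrite /q (card_pprimeChar pF) natrX (pcharf0 pE) expr0n.
  case: eqP => // n0; have := finNzRing_gt1 F.
  by rewrite (card_pprimeChar pF) n0.
have dt p : (tau crho p)^`() = (rho 'X)%:P * p^`().
  rewrite /tau derivD derivM derivC mul0r add0r deriv_exp -mulr_natr qX mulr0 add0r.
  by [].
have di i : (iter i (tau crho) 'X)^`() = (rho 'X^i)%:P.
  elim: i => [|i IHi]; first by rewrite /= derivX rmorph1.
  by rewrite iterS dt IHi exprS rmorphM polyCM.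
rewrite /Cpol /carl linear_sum /= -[X in rho X]coefK poly_def !rmorph_sum /=.
apply: eq_bigr => i _; rewrite derivM di derivC mul0r add0r /=.
by rewrite -mul_polyC rmorphM polyCM.
Qed.

Section Irreducible.
Variables (P : {poly F}) (P_monic : P \is monic) (P_irr : irreducible_poly P).
Let g := (size P).-1.

(** Otherwise a Bezout identity u P + v a = 1 gives x = C_1(x) = 0. *)
Lemma carl_annih x a : x != 0 -> carl rho P x = 0 -> carl rho a x = 0 -> P %| a.
Proof.
move=> x0 Px ax; apply: contraR x0 => nd; apply/eqP.
have /Bezout_eq1_coprimepP [[u v] /= uv] : coprimep P a.
  by rewrite (irreducible_poly_coprime _ P_irr).
by rewrite -(carl1 rho x) -uv carlD !carlM Px ax !carl0 addr0.
Qed.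

(** For a P-torsion point x this lists the A-module generated by x, through the residues of degree <
    g modulo P. Row vectors make the length q^g a cardinal of a finite type. *)
Definition carl_orbit x : seq E := [seq carl rho (rVpoly v) x | v : 'rV[F]_g].

Lemma size_carl_orbit x : size (carl_orbit x) = (q ^ g)%N.
Proof. by rewrite size_map -cardE card_mx mul1n. Qed.

Lemma carl_orbit_root x : carl rho P x = 0 -> all (root (Cpol P)) (carl_orbit x).
Proof.
move=> Px; apply/allP => y /mapP [v _ ->].
by rewrite root_Cpol -carlM mulrC carlM Px carl0.
Qed.

Lemma carl_orbit_uniq x : x != 0 -> carl rho P x = 0 -> uniq (carl_orbit x).
Proof.
move=> x0 Px; rewrite map_inj_uniq ?enum_uniq // => u v /eqP.
rewrite -subr_eq0 -carlB -linearB => /eqP /(carl_annih x0 Px) Puv.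
apply/eqP; rewrite -subr_eq0 -(can_eq rVpolyK) linear0.
apply: contraTT Puv => nz; rewrite gtNdvdp //.
by rewrite (leq_ltn_trans (size_poly _ _)) // /g prednK ?size_poly_gt0 ?monic_neq0.
Qed.

(** The q^g multiples of x are already as many roots as the degree of [Cpol P] allows. *)
Lemma carl_roots x y : x != 0 -> carl rho P x = 0 -> carl rho P y = 0 ->
  exists2 a : {poly F}, (size a <= g)%N & y = carl rho a x.
Proof.
move=> x0 Px Py; have [mC sC] := Cpol_spec P_monic.
have [/mapP [v _ ->]|yS] := boolP (y \in carl_orbit x).
  by exists (rVpoly v) => //; apply: size_poly.
have := @max_poly_roots _ (Cpol P) (y :: carl_orbit x).
rewrite /= carl_orbit_root // yS carl_orbit_uniq // root_Cpol Py eqxx monic_neq0 //.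
by rewrite sC size_carl_orbit ltnn => /(_ isT isT isT).
Qed.

(* A nonzero root of [Cpol P] would give [q ^ g] distinct roots, so [Cpol P]
   would be separable although its derivative is the constant [rho P = 0]. *)
Lemma Cpol_kernel : rho P = 0 -> Cpol P = 'X^(q ^ g).
Proof.
move=> rP; have [mC sC] := Cpol_spec P_monic.
have all0 x : root (Cpol P) x -> x = 0.
  rewrite root_Cpol => /eqP Px; apply/eqP; apply: contraT => x0.
  have U := carl_orbit_uniq x0 Px.
  have := @all_roots_prod_XsubC _ (Cpol P) (carl_orbit x).
  rewrite carl_orbit_root // uniq_rootsE U sC size_carl_orbit (monicP mC) scale1r.
  move=> /(_ erefl isT isT) C.
  have S0 : 0 \in carl_orbit x.
    by apply/mapP; exists 0; rewrite ?mem_enum // linear0 carl0l.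
  have := deriv_Cpol P; rewrite C (perm_big _ (perm_to_rem S0)) /= big_cons rP polyC0.
  move=> /(congr1 (horner^~ 0)); rewrite subr0 derivM derivX mul1r.
  rewrite hornerD hornerM hornerX mul0r addr0 hornerC => /eqP.
  by rewrite -[_ == 0]rootE root_prod_XsubC mem_rem_uniq // !inE eqxx.
have [r] := closed_field_poly_normal (Cpol P); rewrite (monicP mC) scale1r => Cr.
have r0 z : z \in r -> z = 0 by move=> zr; apply: all0; rewrite Cr root_prod_XsubC.
have CX : Cpol P = 'X^(size r).
  rewrite Cr big_seq (eq_bigr (fun=> 'X)); last by move=> z /r0 ->; rewrite subr0.
  by rewrite -big_seq big_const_seq count_predT iter_mulr_1.
by move: sC; rewrite CX size_polyXn => -[->].
Qed.

Lemma carl_kernel x : rho P = 0 -> carl rho P x = x ^+ (q ^ g).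
Proof. by move=> rP; rewrite -horner_Cpol Cpol_kernel // hornerXn. Qed.

Lemma Psi_kernel h : (h %| q.-1)%N -> (0 < h)%N -> rho P = 0 ->
  map_poly rho (Psi h P) = 'X^(Nh F h g).
Proof.
move=> hq h0 rP; have := Cpol_kernel rP; rewrite (Cpol_Psi _ hq).
have q0 : (0 < q ^ g)%N by rewrite expn_gt0 ltnW ?q_gt1.
have X0 : 'X != 0 :> {poly E} by rewrite polyX_eq0.
rewrite -(prednK q0) exprS -(Nh_mul g hq) => /(mulfI X0).
(* Now Psi(X^h) = X^(N h): the coefficient of Psi in degree i is read off in degree i h. *)
move=> e; apply/polyP => i; move/(congr1 (fun p : {poly E} => p`_(i * h))) : e.
rewrite coef_comp_poly_Xn // dvdn_mull // mulnK // coefXn => ->.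
by rewrite coefXn eqn_pmul2r.
Qed.

(** A double root r = x^h of Psi would make both terms of the derivative of X Psi(X^h) vanish at x,
    whereas this derivative is the nonzero constant [rho P]. *)
Lemma Psi_separable h : (h %| q.-1)%N -> (0 < h)%N -> rho P != 0 ->
  exists rs : seq E, [/\ map_poly rho (Psi h P) = \prod_(r <- rs) ('X - r%:P),
    uniq rs & size rs = Nh F h g].
Proof.
move=> hq h0 rP; have [mP sP] := Psi_spec hq h0 P_monic.
set psi := map_poly rho _.
have mpsi : psi \is monic by apply: monic_map.
have [rs] := closed_field_poly_normal psi; rewrite (monicP mpsi) scale1r => psiE.
exists rs; split=> //; last first.
  have : size psi = (Nh F h g).+1.
    by rewrite size_map_poly_id0 ?(monicP mP) ?rmorph1 ?oner_neq0 // sP.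
  by rewrite psiE size_prod_XsubC => -[].
rewrite -separable_prod_XsubC -psiE unlock; apply: Pdiv.ClosedField.root_coprimep => r pr.
apply/negP => dr; have [x xr] : exists x : E, x ^+ h = r.
  have /closed_rootP [x] : size ('X^h - r%:P) != 1 by rewrite size_XnsubC // eqSS -lt0n.
  rewrite rootE hornerD hornerN hornerXn hornerC subr_eq0 => /eqP xr.
  by exists x.
have := congr1 (horner^~ x) (deriv_Cpol P).
rewrite (Cpol_Psi _ hq) -/psi derivM derivX mul1r deriv_comp hornerD !hornerM.
rewrite !horner_comp !hornerXn xr (eqP pr) (eqP dr) !(mul0r, mulr0) addr0 hornerC.
by move/esym/eqP; rewrite (negbTE rP).
Qed.
End Irreducible.
End CarlitzRoots.

(** * An Eisenstein criterion *)

Section MinimalRelation.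
Variables (F : finFieldType) (L : fieldType) (rhoL : {rmorphism {poly F} -> L}).
Hypothesis rhoL_inj : forall a, rhoL a = 0 -> a = 0.
Variables (Om : closedFieldType) (rho0 : {rmorphism {poly F} -> Om}) (m : {poly F}).
Hypothesis m_monic : m \is monic.
Hypothesis rho0P : forall a, (rho0 a == 0) = (m %| a).

Lemma map_poly_ker (a : {poly {poly F}}) :
  map_poly rho0 a = 0 -> exists a', a = m *: a'.
Proof.
move=> a0; exists (\poly_(i < size a) (a`_i %/ m)); apply/polyP => i.
rewrite coefZ coef_poly; case: ltnP => [_|/(nth_default 0) ->]; last by rewrite mulr0.
rewrite mulrC divpK // -rho0P; move/(congr1 (fun p : {poly Om} => p`_i)): a0.
by rewrite coef_map coef0 => ->.
Qed.

Section Gauss.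
Variables (psi : {poly {poly F}}) (N : nat).
Hypothesis psi0 : psi.[0] = m.
Hypothesis psi_bar : map_poly rho0 psi = 'X^N.
Hypothesis psi_size : size psi = N.+1.

(** Gauss's lemma and Eisenstein's criterion in one induction on the size of the denominator c. If m
    divides c, then it divides b or a and can be cancelled. If not, m divides both a(0) and b(0), so
    m^2 divides c psi(0) = c m, a contradiction. *)
Lemma eisenstein_step n (c : {poly F}) (a b : {poly {poly F}}) :
  (size c <= n)%N -> c != 0 -> c *: psi = b * a -> (1 < size a <= N)%N -> False.
Proof.
have m0 : m != 0 by apply: monic_neq0.
have rm : rho0 m = 0 by apply/eqP; rewrite rho0P.
have m1 : (1 < size m)%N.
  rewrite ltnNge; apply/negP => /size1_polyC mc.
  have m1 : m = 1 by move/monicP: m_monic; rewrite mc lead_coefC => ->.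
  have /eqP := rho0P 1; rewrite m1 dvdpp rmorph1 => /eqP.
  by rewrite oner_eq0.
elim: n c a b => [|n IHn] c a b.
  by rewrite leqn0 size_poly_eq0 => /eqP ->; rewrite eqxx.
move=> sc c0 cE sa.
have [/eqP|c_unit] := eqVneq (rho0 c) 0.
  rewrite rho0P => /dvdpP [c' c'E].
  have c'0 : c' != 0 by apply: contraNneq c0 => c'0; rewrite c'E c'0 mul0r.
  have sc' : (size c' <= n)%N.
    rewrite -ltnS; apply: leq_trans sc; rewrite c'E size_Mmonic //.
    by rewrite -subn1 -addnBA ?(ltnW m1) // -addn1 leq_add2l subn1 -ltnS prednK // ltnW.
  have ker (u v : {poly {poly F}}) : m *: (c' *: psi) = m *: u -> c' *: psi = u.
    by rewrite -!mul_polyC => /mulfI -> //; rewrite polyC_eq0.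
  have : map_poly rho0 b * map_poly rho0 a = 0.
    by rewrite -rmorphM -cE -mul_polyC rmorphM /= map_polyC /= c'E rmorphM
      rm mulr0 polyC0 mul0r.
  move/eqP; rewrite mulf_eq0 => /orP[] /eqP /map_poly_ker [d dE].
    apply: (IHn c' a d) => //; apply: (ker (d * a) 0).
    by rewrite scalerA mulrC -c'E cE dE scalerAl.
  apply: (IHn c' d b) => //; last by move: sa; rewrite dE -mul_polyC mul_polyC size_scale.
  by apply: (ker (b * d) 0); rewrite scalerA mulrC -c'E cE dE scalerAr.
have cX : rho0 c *: 'X^N = map_poly rho0 b * map_poly rho0 a.
  by rewrite -rmorphM -cE -[in RHS]mul_polyC rmorphM /= map_polyC /= psi_bar mul_polyC.
have nz : map_poly rho0 b * map_poly rho0 a != 0.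
  by rewrite -cX scaler_eq0 negb_or c_unit monic_neq0 ?monicXn.
(* If v(0) were nonzero modulo m, X^N would be prime to v and would divide u modulo m, whose degree
   is too small. This is applied to the two factors in both orders. *)
have key (u v : {poly {poly F}}) : rho0 c *: 'X^N = map_poly rho0 u * map_poly rho0 v ->
    map_poly rho0 u * map_poly rho0 v != 0 -> (size u <= N)%N -> m %| v.[0].
  move=> uv nzu su; apply: contraLR nzu => nv; apply/negP => nzu.
  have cop : coprimep 'X^N (map_poly rho0 v).
    rewrite coprimep_expl // coprimep_sym -['X]subr0 -polyC0 coprimep_XsubC rootE.
    have -> : (map_poly rho0 v).[0] = rho0 v.[0] by rewrite -{1}(rmorph0 rho0) horner_map.
    by rewrite rho0P.
  have : 'X^N %| map_poly rho0 u.
    by rewrite -(Gauss_dvdpl _ cop) -uv dvdpZr.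
  move: nzu; rewrite mulf_eq0 negb_or => /andP[u0 _] /dvdp_leq -/(_ u0).
  by rewrite size_polyXn leqNgt ltnS (leq_trans (size_poly _ _)).
case/andP: sa => sa1 saN.
have a0 : a != 0 by rewrite -size_poly_gt0 ltnW.
have b0 : b != 0 by apply: contraNneq nz => ->; rewrite rmorph0 mul0r.
have sb : (size b <= N)%N.
  have := size_mul b0 a0; rewrite -cE size_scale // psi_size.
  by move: sa1; case: (size a) => [|[|k]] // _; rewrite !addnS /= => -[->]; rewrite leq_addr.
have /dvdpP [a1 a1E] := key _ _ cX nz sb.
have /dvdpP [b1 b1E] : m %| b.[0].
  by apply: (key a b) => //; rewrite mulrC.
have := congr1 (horner^~ 0) cE; rewrite hornerM hornerZ psi0 a1E b1E mulrA => /(mulIf m0) cm.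
by case/negP: c_unit; rewrite rho0P cm dvdp_mulr // dvdp_mull.
Qed.

(** Pseudo-division of psi by a relation a leaves a shorter relation, which is 0 by induction; then
    c psi = u a contradicts the Eisenstein step. In effect psi is irreducible over k. *)
Lemma min_relation nu (a : {poly {poly F}}) :
  (map_poly rhoL psi).[nu] = 0 -> (map_poly rhoL a).[nu] = 0 -> (size a <= N)%N -> a = 0.
Proof.
move=> psinu; elim: {a}(size a) {-2}a (leqnn (size a)) => [|n IHn] a.
  by rewrite leqn0 size_poly_eq0 => /eqP.
move=> sa anu aN; apply/eqP; apply: contraT => a0.
have sa1 : (1 < size a)%N.
  rewrite ltnNge; apply/negP => /size1_polyC ac.
  by move: anu a0; rewrite ac map_polyC hornerC => /rhoL_inj ->; rewrite eqxx.
have E := Pdiv.Idomain.divp_eq psi a.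
set r := Pdiv.Idomain.modp psi a in E.
have r0 : r = 0.
  apply: IHn.
  - by rewrite -ltnS (leq_trans _ sa) // Pdiv.Idomain.ltn_modp.
  - have := congr1 (fun p => (map_poly rhoL p).[nu]) E.
    rewrite -mul_polyC !rmorphD !rmorphM /= hornerD !hornerM psinu anu !mulr0 add0r.
    by [].
  - by rewrite ltnW // (leq_trans _ aN) // Pdiv.Idomain.ltn_modp.
rewrite r0 addr0 in E; apply: False_ind.
by apply: (eisenstein_step (leqnn _) _ E); rewrite ?sa1 ?aN // expf_neq0 // lead_coef_eq0.
Qed.
End Gauss.
End MinimalRelation.

(** * Extension of places *)

Section PlaceExtension.
Variables (E : fieldType) (Om : closedFieldType).
Notation R := (E * Om)%type.
Implicit Types (G : R -> Prop) (p s : {poly R}) (u v : R).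

(* [G] is the graph of a ring homomorphism from a subring of [E] to [Om]. *)
Definition hom_graph G :=
  [/\ G 1, forall u v, G u -> G v -> G (u - v), forall u v, G u -> G v -> G (u * v)
    & forall b, G (0, b) -> b = 0].

Lemma hom_graph_maximal G0 : hom_graph G0 ->
  exists G, [/\ forall u, G0 u -> G u, hom_graph G &
    forall G', hom_graph G' -> (forall u, G u -> G' u) -> forall u, G' u -> G u].
Proof.
(* Adding [G0] to every set makes the empty chain harmless and forces the maximal graph to contain
   [G0]. *)
move=> g0; pose U (A : R -> Prop) u := A u \/ G0 u.
have [|A [PA maxA]] := @classical_sets.Zorn_bigcup R (fun A => hom_graph (U A)).
  move=> C CP Ctot; set B := classical_sets.bigcup _ _.
  have UC A : C A -> forall u, U A u -> U B u.
    by move=> CA u [Au|Gu]; [left; exists A|right].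
  have pair u v : U B u -> U B v ->
      (G0 u /\ G0 v) \/ exists2 A, C A & U A u /\ U A v.
    case=> [[A1 C1 A1u]|G0u] [[A2 C2 A2v]|G0v]; last by left.
    - right; have [le|le] := Ctot _ _ C1 C2.
        by exists A2 => //; split; left=> //; apply: le.
      by exists A1 => //; split; left=> //; apply: le.
    - by right; exists A1 => //; split; [left|right].
    - by right; exists A2 => //; split; [right|left].
  have [G1 GB GM Gf] := g0; split; first by right.
  - move=> u v Bu Bv; have [[Gu Gv]|[A CA [Au Av]]] := pair u v Bu Bv.
      by right; apply: GB.
    by have [_ AB _ _] := CP _ CA; apply: (UC A CA); apply: AB.
  - move=> u v Bu Bv; have [[Gu Gv]|[A CA [Au Av]]] := pair u v Bu Bv.
      by right; apply: GM.
    by have [_ _ AM _] := CP _ CA; apply: (UC A CA); apply: AM.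
  - move=> b Bb; have [[Gu Gv]|[A CA [Au Av]]] := pair _ _ Bb Bb; first exact: Gf.
    by have [_ _ _ Af] := CP _ CA; apply: Af.
exists (U A); split=> //; first by move=> u; right.
move=> G' g' AG' u G'u; apply: boolp.contrapT => nAu.
have UG' : U G' = G'.
  apply: boolp.funext => v; apply: boolp.propext; split; last by left.
  by case=> // G0v; apply: AG'; right.
apply: (maxA G'); rewrite ?UG' //; split.
  by move=> v Av; apply: AG'; left.
by move=> G'A; apply: nAu; left; apply: G'A.
Qed.

Section Maximal.
Variable G : R -> Prop.
Hypothesis gG : hom_graph G.
Hypothesis maxG :
  forall G', hom_graph G' -> (forall u, G u -> G' u) -> forall u, G' u -> G u.

Let G1 : G 1. Proof. by case: gG. Qed.
Let GB u v : G u -> G v -> G (u - v). Proof. by case: gG => _ h _ _; apply: h. Qed.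
Let GM u v : G u -> G v -> G (u * v). Proof. by case: gG => _ _ h _; apply: h. Qed.
Let Gf b : G (0, b) -> b = 0. Proof. by case: gG => _ _ _ h; apply: h. Qed.
Let G0 : G 0. Proof. by rewrite -(subrr 1); apply: GB. Qed.
Let GD u v : G u -> G v -> G (u + v).
Proof. by move=> Gu Gv; rewrite -[v]opprK -[- v]sub0r; apply: (GB Gu); apply: GB. Qed.
Let Gsum n (f : 'I_n -> R) : (forall i, G (f i)) -> G (\sum_i f i).
Proof. by move=> Gf'; elim/big_ind: _ => //; apply: GD. Qed.
Let GX u n : G u -> G (u ^+ n).
Proof. by move=> Gu; elim: n => // n IHn; rewrite exprS; apply: GM. Qed.

Let over p := forall i, G p`_i.
Let overB p s : over p -> over s -> over (p - s).
Proof. by move=> Gp Gs i; rewrite coefB; apply: GB. Qed.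
Let overM p s : over p -> over s -> over (p * s).
Proof. by move=> Gp Gs i; rewrite coefM; apply: Gsum => k; apply: GM. Qed.
Let overC u : G u -> over u%:P.
Proof. by move=> Gu i; rewrite coefC; case: eqP. Qed.
Let overX : over 'X.
Proof. by move=> i; rewrite coefX; case: eqP. Qed.
Let overXn n : over 'X^n.
Proof. by move=> i; rewrite coefXn; case: eqP. Qed.

(** Adjoining u to G gives the set of all p(u) with p over G. The hypothesis says that this is still
    the graph of a map, so u was already in G by maximality. *)
Lemma hom_graph_ext u :
  (forall p, over p -> p.[u].1 = 0 -> p.[u].2 = 0) -> G u.
Proof.
move=> ext; apply: (maxG (G' := fun v => exists2 p, over p & v = p.[u])); last first.
- by exists 'X; rewrite ?hornerX.
- by move=> v Gv; exists v%:P; rewrite ?hornerC //; apply: overC.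
split.
- by exists 1; rewrite ?hornerC // -polyC1; apply: overC.
- by move=> _ _ [p pG ->] [s sG ->]; exists (p - s); rewrite ?hornerD ?hornerN //; apply: overB.
- by move=> _ _ [p pG ->] [s sG ->]; exists (p * s); rewrite ?hornerM //; apply: overM.
- by move=> b [p pG pE]; have := ext p pG; rewrite -pE; apply.
Qed.

(** With z w = 1, multiplication by z^(size p) turns a polynomial p in w into one in z, whose value
    lies in G. Hence p(w).1 = 0 forces b^(size p) p(w).2 = 0. *)
Lemma hom_graph_inv a b : G (a, b) -> b != 0 -> a != 0 /\ G (a^-1, b^-1).
Proof.
move=> Gab b0; have a0 : a != 0.
  by apply: contraNneq b0 => a0; apply/eqP; apply: Gf; rewrite -a0.
split=> //; set w := (a^-1, b^-1); set z := (a, b) in Gab.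
have zw : z * w = 1 by apply/eqP; rewrite xpair_eqE /= !mulfV ?eqxx.
apply: hom_graph_ext => p pG pw.
have Gz : G (z ^+ size p * p.[w]).
  rewrite horner_coef mulr_sumr; apply: Gsum => i.
  rewrite mulrCA -[X in z ^+ X](subnK (ltnW (ltn_ord i))) exprD -mulrA -exprMn zw expr1n mulr1.
  by apply: GM => //; apply: GX.
have z2 n : (z ^+ n).2 = b ^+ n by elim: n => // n IHn; rewrite !exprS /= IHn.
have : (z ^+ size p * p.[w]).2 = 0.
  apply: Gf; move: Gz; rewrite [X in G X]surjective_pairing.
  by rewrite [X in G (X, _)]/= pw mulr0.
by move=> /eqP; rewrite /= z2 mulf_eq0 expf_eq0 (negbTE b0) andbF => /eqP.
Qed.

(** [M] is the kernel of the place. [D x n] is a relation of degree at most n that puts 1 into M[x],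
    the obstruction to extending the place to x. *)
Let M a := G (a, 0).
Let D x n := exists a : {poly E}, [/\ forall i, M a`_i, (size a <= n.+1)%N & a.[x] = 1].

Let nM1 : ~ M 1.
Proof.
move=> m1; have /Gf /eqP : G (0, 1); last by rewrite oner_eq0.
have -> : (0, 1) = 1 - (1, 0) :> R by apply/eqP; rewrite xpair_eqE /= subrr subr0 !eqxx.
exact: GB.
Qed.

Lemma hom_graph_unit a : M a -> G ((1 - a)^-1, 1).
Proof.
move=> Ma; have : G (1 - a, 1).
  by have := GB G1 Ma; congr G; apply/eqP; rewrite xpair_eqE /= subr0 !eqxx.
by move=> /hom_graph_inv; rewrite oner_eq0 invr1 => /(_ isT) [].
Qed.

(** Each y is excluded as a value at x by a relation of x whose residue does not vanish at y. The
    residues of the relations of x thus have no common root in [Om], and Euclidean division produces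
    a relation with nonzero constant residue; dividing by its constant term puts 1 into M[x]. *)
Lemma hom_graph_integral_aux x :
  (forall y, ~ G (x, y)) -> exists n, D x n.
Proof.
move=> nx; pose I p := over p /\ (map_poly fst p).[x] = 0.
have hs p y : p.[(x, y)] = ((map_poly fst p).[x], (map_poly snd p).[y]).
  rewrite [LHS]surjective_pairing; congr (_, _).
    by rewrite -(horner_map (fst : {rmorphism R -> E})).
  by rewrite -(horner_map (snd : {rmorphism R -> Om})).
have ex y : exists2 p, I p & (map_poly snd p).[y] != 0.
  apply: boolp.contrapT => nex; apply: (nx y); apply: hom_graph_ext => p pG.
  rewrite hs /= => p0; apply/eqP; apply: contraT => p1.
  by case: nex; exists p.
(* Cancelling leading terms against p lowers the degree of the residue of s and keeps its value at y
   nonzero, because the residue of p vanishes there. *)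
have reduce p y k s : I p -> root (map_poly snd p) y -> map_poly snd p != 0 ->
    I s -> (map_poly snd s).[y] != 0 -> (size (map_poly snd s) <= k)%N ->
    exists s', [/\ I s', map_poly snd s' != 0 &
       (size (map_poly snd s') < size (map_poly snd p))%N].
  move=> Ip py p0; elim: k s => [|k IHk] s Is sy.
    by rewrite leqn0 size_poly_eq0 => /eqP s0; move: sy; rewrite s0 horner0 eqxx.
  move=> sk; have [lt|le] := ltnP (size (map_poly snd s)) (size (map_poly snd p)).
    exists s; split=> //; by apply: contraNneq sy => ->; rewrite horner0.
  set sp := size _ in le; set ss := size _ in le sk.
  pose c := p`_sp.-1; pose e := s`_ss.-1.
  pose s' := c%:P * s - e%:P * 'X^(ss - sp) * p.
  have s2 : map_poly snd s' = c.2%:P * map_poly snd s - e.2%:P * 'X^(ss - sp) * map_poly snd p.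
    by rewrite rmorphB !rmorphM /= !map_polyC /= map_polyXn.
  have lc : c.2 = lead_coef (map_poly snd p) by rewrite lead_coefE coef_map.
  have le2 : e.2 = lead_coef (map_poly snd s) by rewrite lead_coefE coef_map.
  have c0 : c.2 != 0 by rewrite lc lead_coef_eq0.
  have sp0 : (0 < sp)%N by rewrite size_poly_gt0.
  apply: (IHk s').
  - case: Ip => pG p1; case: Is => sG s1; split.
      apply: overB; apply: overM => //; first exact: overC (pG _).
      by apply: overM; [apply: overC (sG _)|apply: overXn].
    by rewrite rmorphB !rmorphM /= hornerD hornerN !hornerM p1 s1 !mulr0 subr0.
  - by rewrite s2 hornerD hornerN !hornerM (eqP py) mulr0 subr0 hornerC mulf_neq0.
  - have ssk : (ss <= k.+1)%N by [].
    rewrite -ltnS; apply: leq_trans ssk; rewrite s2.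
    have ss0 : (0 < ss)%N by apply: leq_trans le.
    rewrite -[ss in X in (_ < X)%N](prednK ss0) ltnS; apply/leq_sizeP => i.
    rewrite leq_eqVlt coefB coefCM -mulrA coefCM coefXnM => /orP[/eqP <-|lt].
      have -> : (ss.-1 < ss - sp)%N = false by move: sp0 ss0 le; clear; lia.
      have -> : (ss.-1 - (ss - sp) = sp.-1)%N by move: sp0 ss0 le; clear; lia.
      by rewrite lc le2 !lead_coefE mulrC subrr.
    have lt' : (ss <= i)%N by rewrite -(prednK ss0).
    rewrite nth_default // mulr0; case: ltnP => _; first by rewrite mulr0 subr0.
    by rewrite nth_default ?mulr0 ?subr0 // -/sp; move: sp0 ss0 le lt'; clear; lia.
have const n p : I p -> map_poly snd p != 0 -> (size (map_poly snd p) <= n)%N ->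
    exists2 s, I s & size (map_poly snd s) == 1.
  elim: n p => [|n IHn] p Ip p0.
    by rewrite leqn0 size_poly_eq0 (negbTE p0).
  have [s1 _|s1] := boolP (size (map_poly snd p) == 1); first by exists p.
  move=> sp; have /closed_rootP [y py] := s1.
  have [s Is sy] := ex y.
  have [s' [Is' s'0 lt]] := reduce p y _ s Ip py p0 Is sy (leqnn _).
  by apply: (IHn s' Is' s'0); rewrite -ltnS (leq_trans lt).
have [p0 Ip0 p00] := ex 0.
have [|p [pG p1] /size_poly1P [c c0 pc]] := const _ p0 Ip0 _ (leqnn _).
  by apply: contraNneq p00 => ->; rewrite horner0.
have p2 i : (p`_i).2 = if i == 0%N then c else 0.
  by rewrite -(coef_map (snd : {rmorphism R -> Om})) pc coefC.
have Gp0 : G ((p`_0).1, c) by have := pG 0%N; rewrite [p`_0]surjective_pairing p2.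
have [a0 Ga0] := hom_graph_inv Gp0 c0.
exists (size p); exists (1 - (p`_0).1^-1 *: map_poly fst p); split.
- move=> i; rewrite coefB coefZ coef1 coef_map /=; case: eqP => [->|/eqP i0].
    by rewrite mulVf // subrr.
  have := GM Ga0 (pG i); rewrite [p`_i]surjective_pairing p2 (negbTE i0) => Gi.
  have := GB G0 Gi; congr G; apply/eqP.
  by rewrite xpair_eqE /= mulr0 subr0 !eqxx.
- rewrite (leq_trans (size_polyD _ _)) // size_polyN size_poly1 geq_max /=.
  rewrite (leq_trans (size_scale_leq _ _)) //.
  by rewrite (leq_trans (size_poly _ _)).
- by rewrite hornerD hornerN hornerZ p1 mulr0 subr0 hornerC.
Qed.

Lemma duel_step x n k : x != 0 -> (k <= n)%N -> D x n -> D x^-1 k -> (0 < n)%N /\ D x n.-1.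
Proof.
move=> x0 kn [a [aM sa ax]] [b [bM sb bx]].
have n0 : (0 < n)%N.
  case: n sa {kn} => // /size1_polyC aC; case: nM1.
  by move: ax; rewrite aC hornerC => <-.
split=> //; set u := 1 - b`_0.
have u0 : u != 0 by apply/eqP => /eqP; rewrite subr_eq0 => /eqP b1; apply: nM1; rewrite b1.
(* From b(1/x) = 1 one gets u x^n = sum over i < n of b_(n-i) x^i, with u = 1 - b_0 invertible in
   the domain of G. This replaces the term a_n x^n. *)
exists (\poly_(i < n) (a`_i + a`_n / u * b`_(n - i))); split.
- move=> i; rewrite coef_poly; case: ltnP => // _.
  have := GD (aM i) (GM (GM (aM n) (hom_graph_unit (bM 0%N))) (bM (n - i)%N)).
  by congr G; apply/eqP; rewrite xpair_eqE /= mulr0 addr0 !eqxx.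
- by rewrite prednK // size_poly.
rewrite horner_poly.
have sb' : (size b <= n.+1)%N by rewrite (leq_trans sb).
have := bx; rewrite (horner_coef_wide _ sb') big_ord_recl expr0 mulr1 => /eqP.
rewrite eq_sym addrC -subr_eq -/u => /eqP uE.
have -> : \sum_(i < n) (a`_i + a`_n / u * b`_(n - i)) * x ^+ i =
   \sum_(i < n) a`_i * x ^+ i + a`_n / u * (x ^+ n * u).
  rewrite uE !mulr_sumr (reindex_inj rev_ord_inj) /=.
  rewrite [in RHS](reindex_inj rev_ord_inj) /= -big_split /=; apply: eq_bigr => i _.
  rewrite mulrDl; congr (_ + _); rewrite -mulrA; congr (_ * _).
  rewrite subKn //= mulrCA; congr (_ * _).
  have -> : x ^+ n = x ^+ (n - i.+1) * x ^+ i.+1 by rewrite -exprD subnK.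
  by rewrite -mulrA -exprMn mulfV // expr1n mulr1.
have -> : a`_n / u * (x ^+ n * u) = a`_n * x ^+ n by rewrite mulrACA mulVf // mulr1.
by rewrite -ax (horner_coef_wide _ sa) big_ord_recr.
Qed.

(** The longer of the two relations can always be shortened with the help of the other, until degree
    0 is reached, where 1 would lie in [M]. *)
Lemma duel x n k : x != 0 -> D x n -> D x^-1 k -> False.
Proof.
move: {2}(n + k)%N (leqnn (n + k)) => N; elim: N n k x => [|N IHN] n k x nk x0 Dn Dk.
  move: nk; rewrite leqn0 addn_eq0 => /andP[/eqP n0 /eqP k0].
  by rewrite n0 k0 in Dn Dk; have [] := duel_step x0 (leqnn _) Dn Dk.
case: (leqP k n) => [kn|/ltnW nk'].
  have [n0 Dn'] := duel_step x0 kn Dn Dk.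
  by apply: (IHN n.-1 k x _ x0 Dn' Dk); rewrite -ltnS -addSn prednK.
have x0' : x^-1 != 0 by rewrite invr_eq0.
have Dn2 : D x^-1^-1 n by rewrite invrK.
have [k0 Dk'] := duel_step x0' nk' Dk Dn2.
by apply: (IHN n k.-1 x _ x0 Dn Dk'); rewrite -ltnS -addnS prednK.
Qed.

Lemma hom_graph_valuation x : (exists y, G (x, y)) \/ (x != 0 /\ G (x^-1, 0)).
Proof.
have [-> | x0] := eqVneq x 0; first by left; exists 0.
case: (boolp.pselect (exists y, G (x, y))) => [|nx]; first by left.
right; split=> //.
have [n Dn] : exists n, D x n by apply: hom_graph_integral_aux => y Gy; apply: nx; exists y.
case: (boolp.pselect (exists y, G (x^-1, y))) => [[y Gy]|ny]; last first.
  have [k Dk] : exists k, D x^-1 k.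
    by apply: hom_graph_integral_aux => y Gy; apply: ny; exists y.
  by case: (duel x0 Dn Dk).
have [<- // | y0] := eqVneq y 0.
have [_] := hom_graph_inv Gy y0; rewrite invrK => Gx.
by case: nx; exists y^-1.
Qed.
End Maximal.

(** Chevalley's extension theorem. Working with graphs lets the subring and its residue map grow
    together. *)
Theorem place_extension G0 : hom_graph G0 ->
  exists G, [/\ forall u, G0 u -> G u, hom_graph G,
    forall a b, G (a, b) -> b != 0 -> a != 0 /\ G (a^-1, b^-1) &
    forall x, (exists y, G (x, y)) \/ (x != 0 /\ G (x^-1, 0))].
Proof.
move=> /hom_graph_maximal [G [sub gG maxG]]; exists G; split=> //.
  by move=> a b; apply: hom_graph_inv.
by move=> x; apply: hom_graph_valuation.
Qed.
End PlaceExtension.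

HB.instance Definition _ (F : finFieldType) (L : fieldType)
    (iota : {rmorphism {fraction {poly F}} -> L}) :=
  GRing.RMorphism.copy (@embA F L iota) (iota \o @FracField.tofrac {poly F}).

(** * Generated fields and their places *)

Section FieldClosed.
Variables (L : fieldType) (S : L -> Prop).
Hypothesis cS : field_closed S.

Lemma fc0 : S 0. Proof. by case: cS. Qed.
Lemma fc1 : S 1. Proof. by case: cS. Qed.
Lemma fcB x y : S x -> S y -> S (x - y). Proof. by case: cS => _ _ h _ _; apply: h. Qed.
Lemma fcM x y : S x -> S y -> S (x * y). Proof. by case: cS => _ _ _ h _; apply: h. Qed.
Lemma fcV x : S x -> S x^-1. Proof. by case: cS => _ _ _ _ h; apply: h. Qed.
Lemma fcN x : S x -> S (- x). Proof. by rewrite -sub0r; apply: fcB fc0. Qed.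
Lemma fcD x y : S x -> S y -> S (x + y).
Proof. by move=> Sx Sy; rewrite -[y]opprK; apply: fcB => //; apply: fcN. Qed.
Lemma fc_div x y : S x -> S y -> S (x / y).
Proof. by move=> Sx Sy; apply: fcM => //; apply: fcV. Qed.
Lemma fcX x n : S x -> S (x ^+ n).
Proof. by move=> Sx; elim: n => [|n IHn]; rewrite ?expr0 ?exprS; [apply: fc1|apply: fcM]. Qed.
Lemma fc_sum I (r : seq I) (P : pred I) (f : I -> L) :
  (forall i, P i -> S (f i)) -> S (\sum_(i <- r | P i) f i).
Proof. by move=> h; elim/big_ind: _ => //; [apply: fc0|apply: fcD]. Qed.

Lemma fc_ev1 (F : finFieldType) (j : {rmorphism F -> L}) s p :
  (forall c, S (j c)) -> S s -> S (ev1 j s p).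
Proof.
by move=> Sj Ss; rewrite ev1E; apply: fc_sum => i _; apply: fcM => //; apply: fcX.
Qed.

Lemma fc_ev2 (F : finFieldType) (j : {rmorphism F -> L}) s x a :
  (forall c, S (j c)) -> S s -> S x -> S (ev2 j s x a).
Proof.
move=> Sj Ss Sx; rewrite ev2E; apply: fc_sum => i _.
by apply: fcM; [apply: fc_ev1|apply: fcX].
Qed.
End FieldClosed.

Section GeneratedField.
Variables (B : comNzRingType) (L : fieldType) (ev : {rmorphism B -> L}).

Definition fractions (u : L) : Prop := exists a b, ev b != 0 /\ u = ev a / ev b.

Lemma fractions_ev a : fractions (ev a).
Proof. by exists a, 1; rewrite rmorph1 oner_eq0 divr1. Qed.

Lemma fractions_closed : field_closed fractions.
Proof.
split; [by rewrite -(rmorph0 ev); apply: fractions_ev|by rewrite -(rmorph1 ev); apply: fractions_ev| | |].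
- move=> _ _ [a [b [b0 ->]]] [c [d [d0 ->]]]; exists (a * d - c * b), (b * d).
  by rewrite rmorphB !rmorphM mulf_neq0 //; split=> //; rewrite -[in LHS]mulNr addf_div // mulNr.
- move=> _ _ [a [b [b0 ->]]] [c [d [d0 ->]]]; exists (a * c), (b * d).
  by rewrite !rmorphM mulf_neq0 // mulf_div.
- move=> _ [a [b [b0 ->]]]; have [->|a0] := eqVneq (ev a) 0.
    by rewrite mul0r invr0 -(rmorph0 ev); apply: fractions_ev.
  by exists b, a; rewrite invf_div.
Qed.
End GeneratedField.

Section GeneratedField2.
Variables (F : finFieldType) (L : fieldType) (j : {rmorphism F -> L}) (s x : L).

Let AX : comNzRingType := {poly {poly F}}.
Definition Kgen : L -> Prop := @fractions AX L (ev2 j s x).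

Lemma Kgen_ev a : Kgen (ev2 j s x a). Proof. exact: (@fractions_ev AX L (ev2 j s x)). Qed.
Lemma Kgen_closed : field_closed Kgen.
Proof. exact: (@fractions_closed AX L (ev2 j s x)). Qed.
Lemma Kgen_const c : Kgen (j c).
Proof. by have := Kgen_ev (c%:P)%:P; rewrite ev2C ev1C. Qed.
Lemma Kgen_fst : Kgen s.
Proof. by have := Kgen_ev ('X)%:P; rewrite ev2C ev1X. Qed.
Lemma Kgen_snd : Kgen x.
Proof. by have := Kgen_ev 'X; rewrite ev2X. Qed.

Lemma Kgen_min (S : L -> Prop) u : field_closed S ->
  (forall c, S (j c)) -> S s -> S x -> Kgen u -> S u.
Proof.
by move=> cS Sj Ss Sx [a [b [_ ->]]]; apply: (fc_div cS); apply: (fc_ev2 cS).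
Qed.
End GeneratedField2.

Lemma Kgen_eq (F : finFieldType) (L : fieldType) (j : {rmorphism F -> L}) s x s' x' :
  Kgen j s x s' -> Kgen j s x x' -> Kgen j s' x' s -> Kgen j s' x' x ->
  Kgen j s x = Kgen j s' x'.
Proof.
move=> h1 h2 h3 h4; apply: boolp.funext => u; apply: boolp.propext.
by split; apply: Kgen_min => //; try exact: Kgen_closed; apply: Kgen_const.
Qed.

Section PlaceTheory.
Variables (F : finFieldType) (L : fieldType) (iota : {fraction {poly F}} -> L).
Variables (K : L -> Prop) (O : L -> Prop).
Hypotheses (cK : field_closed K) (pO : is_place iota K O).
Notation M := (place_ideal O).

Lemma placeK x : O x -> K x. Proof. by case: pO => -[h _ _ _ _] _; apply: h. Qed.
Lemma place0 : O 0. Proof. by case: pO => -[]. Qed.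
Lemma place1 : O 1. Proof. by case: pO => -[]. Qed.
Lemma placeB x y : O x -> O y -> O (x - y).
Proof. by case: pO => -[_ _ _ h _] _; apply: h. Qed.
Lemma placeM x y : O x -> O y -> O (x * y).
Proof. by case: pO => -[_ _ _ _ h] _; apply: h. Qed.
Lemma place_const c : O (embA iota c%:P). Proof. by case: pO => _ [h _ _]. Qed.
Lemma place_total x : K x -> O x \/ O x^-1.
Proof.
move=> Kx; have [->|x0] := eqVneq x 0; first by left; apply: place0.
by case: pO => _ [_ _]; apply.
Qed.
Lemma placeN x : O x -> O (- x). Proof. by rewrite -sub0r; apply: placeB place0. Qed.
Lemma placeD x y : O x -> O y -> O (x + y).
Proof. by move=> Ox Oy; rewrite -[y]opprK; apply: placeB => //; apply: placeN. Qed.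
Lemma placeX x n : O x -> O (x ^+ n).
Proof. by move=> Ox; elim: n => [|n IHn]; rewrite ?expr0 ?exprS; [apply: place1|apply: placeM]. Qed.
Lemma place_sum I (r : seq I) (P : pred I) (f : I -> L) :
  (forall i, P i -> O (f i)) -> O (\sum_(i <- r | P i) f i).
Proof. by move=> h; elim/big_ind: _ => //; [apply: place0|apply: placeD]. Qed.

Lemma ideal_place x : M x -> O x. Proof. by case. Qed.
Lemma pideal0 : M 0. Proof. by split; [apply: place0|left]. Qed.
Lemma ideal_neq1 : ~ M 1.
Proof. by case=> _ [/eqP|]; [rewrite oner_eq0|rewrite invr1; case; apply: place1]. Qed.

Lemma pidealMr x y : M x -> O y -> M (x * y).
Proof.
case=> Ox h Oy; split; first exact: placeM.
have [->|y0] := eqVneq y 0; first by left; rewrite mulr0.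
case: h => [->|nx]; first by left; rewrite mul0r.
right=> h; apply: nx; have := placeM Oy h.
by rewrite invfM mulrCA mulfV // mulr1.
Qed.

Lemma pidealMl x y : O x -> M y -> M (x * y).
Proof. by rewrite mulrC => Ox My; apply: pidealMr. Qed.

(** Of two nonzero elements one divides the other in O, so the sum is a multiple of one of them. *)
Lemma pidealD x y : M x -> M y -> M (x + y).
Proof.
move=> Mx My; have [->|x0] := eqVneq x 0; first by rewrite add0r.
have [->|y0] := eqVneq y 0; first by rewrite addr0.
have Kxy : K (x / y) by apply: (fc_div cK); apply: placeK; apply: ideal_place.
have [h|] := place_total Kxy.
  have -> : x + y = y * (x / y + 1) by rewrite mulrDr mulr1 mulrCA mulfV // mulr1.
  by apply: pidealMr => //; apply: placeD => //; apply: place1.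
rewrite invf_div => h.
have -> : x + y = x * (1 + y / x) by rewrite mulrDr mulr1 mulrCA mulfV // mulr1.
by apply: pidealMr => //; apply: placeD => //; apply: place1.
Qed.

Lemma pidealN x : M x -> M (- x).
Proof. by move=> Mx; rewrite -mulrN1; apply: pidealMr => //; apply: placeN; apply: place1. Qed.

Lemma pidealB x y : M x -> M y -> M (x - y).
Proof. by move=> Mx My; apply: pidealD => //; apply: pidealN. Qed.

Lemma pidealX x n : M x -> (0 < n)%N -> M (x ^+ n).
Proof.
move=> Mx; case: n => // n _; rewrite exprS.
by apply: pidealMr => //; apply: placeX; apply: ideal_place.
Qed.

Lemma place_unit x : O x -> ~ M x -> x != 0 /\ O x^-1.
Proof.
move=> Ox nM; have [x0|x0] := eqVneq x 0; first by case: nM; rewrite x0; apply: pideal0.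
by split=> //; apply: boolp.contrapT => nO; apply: nM; split=> //; right.
Qed.

Lemma place_inv_ideal x : K x -> ~ M x -> O x^-1.
Proof.
move=> Kx nM; have [Ox|//] := place_total Kx.
by have [] := place_unit Ox nM.
Qed.

Lemma nplace_ideal x : K x -> ~ O x -> M x^-1.
Proof.
move=> Kx nO; have [//|Ox] := place_total Kx; split=> //.
by right; rewrite invrK.
Qed.

Lemma ideal_unitF x : M x -> O x^-1 -> x = 0.
Proof. by case=> _ []. Qed.

Lemma pidealXn x n : K x -> (0 < n)%N -> M (x ^+ n) -> M x.
Proof.
move=> Kx n0 Mx; apply: boolp.contrapT => nM.
have Ov := placeX n (place_inv_ideal Kx nM).
have : M (x ^+ n * x^-1 ^+ n) by apply: pidealMr.
rewrite -exprMn mulfV ?expr1n; first exact: ideal_neq1.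
by apply/eqP => x0; apply: nM; rewrite x0; apply: pideal0.
Qed.

(** Primality of the ideal, for factors in K that may lie outside O: a factor not in the ideal has
    its inverse in O and can be divided out. *)
Lemma ideal_prod (I : Type) (r : seq I) (f : I -> L) : (forall i, K (f i)) ->
  M (\prod_(i <- r) f i) -> exists i, M (f i).
Proof.
move=> Kf; elim: r => [|i r IHr]; first by rewrite big_nil => /ideal_neq1.
rewrite big_cons => Mr; apply: boolp.contrapT => nM.
have nMi : ~ M (f i) by move=> h; apply: nM; exists i.
apply: nM; apply: IHr.
have f0 : f i != 0 by apply/eqP => f0; apply: nMi; rewrite f0; apply: pideal0.
by have := pidealMr Mr (place_inv_ideal (Kf i) nMi); rewrite mulrAC mulfV // mul1r.
Qed.

Lemma ideal_prod_in (I : eqType) (r : seq I) (f : I -> L) : (forall i, K (f i)) ->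
  M (\prod_(i <- r) f i) -> exists2 i, i \in r & M (f i).
Proof.
move=> Kf Mr; pose g i := if i \in r then f i else 1.
have gE : \prod_(i <- r) f i = \prod_(i <- r) g i.
  by rewrite big_seq [RHS]big_seq; apply: eq_bigr => i ir; rewrite /g ir.
have Kg i : K (g i) by rewrite /g; case: ifP => // _; apply: (fc1 cK).
rewrite gE in Mr; have [i] := ideal_prod Kg Mr; rewrite /g => Mi.
by case: ifP Mi => [ir Mi|_ /ideal_neq1 //]; exists i.
Qed.

Lemma place_ev1 (j : {rmorphism F -> L}) s p : (forall c, j c = embA iota c%:P) ->
  O s -> O (ev1 j s p).
Proof.
move=> ji Os; rewrite ev1E; apply: place_sum => i _; rewrite ji.
by apply: placeM; [apply: place_const|apply: placeX].
Qed.

Lemma place_ev2 (j : {rmorphism F -> L}) s x a : (forall c, j c = embA iota c%:P) ->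
  O s -> O x -> O (ev2 j s x a).
Proof.
move=> ji Os Ox; rewrite ev2E; apply: place_sum => i _.
by apply: placeM; [apply: place_ev1|apply: placeX].
Qed.

(** If x were not in O, then 1/x would lie in the ideal, and division of the equation by x^n would
    write 1 as a combination of positive powers of 1/x. *)
Lemma place_integral x n (c : 'I_n -> L) : K x -> (forall i, O (c i)) ->
  x ^+ n = \sum_(i < n) c i * x ^+ i -> O x.
Proof.
move=> Kx Oc xn; apply: boolp.contrapT => nO.
have Mv := nplace_ideal Kx nO.
have x0 : x != 0 by apply/eqP => x0; apply: nO; rewrite x0; apply: place0.
apply: ideal_neq1.
have -> : 1 = \sum_(i < n) c i * x^-1 ^+ (n - i).
  have := congr1 (fun u => u * x^-1 ^+ n) xn.
  rewrite -exprMn mulfV // expr1n => ->; rewrite mulr_suml; apply: eq_bigr => i _.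
  rewrite -mulrA; congr (_ * _).
  have -> : x^-1 ^+ n = x^-1 ^+ i * x^-1 ^+ (n - i) by rewrite -exprD subnKC // ltnW.
  by rewrite mulrA -exprMn mulfV // expr1n mul1r.
elim/big_ind: _; [exact: pideal0|exact: pidealD|move=> i _].
apply: pidealMl => //; rewrite -(prednK (n := n - i)) ?subn_gt0 // exprS.
by apply: pidealMr => //; apply: placeX; apply: ideal_place.
Qed.
End PlaceTheory.

(** * Frobenius orbits and finite residue fields *)

Section FrobeniusOrbits.
Variables (Om : fieldType) (Q f : nat) (x : Om).
Hypotheses (xf : x ^+ (Q ^ f) = x) (xi : forall i, (0 < i < f)%N -> x ^+ (Q ^ i) != x).

Lemma frob_orbit_uniq : uniq [seq x ^+ (Q ^ i) | i <- iota 0 f].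
Proof.
rewrite map_inj_in_uniq ?iota_uniq // => i k; rewrite !mem_iota /= !add0n => lti ltk.
wlog ik : i k lti ltk / (i < k)%N.
  move=> W E; case: (ltngtP i k) => [lt|gt|//]; first exact: W.
  by apply/esym/W.
(* Applying the Frobenius f - k more times brings the side with exponent k back to x, so i + (f - k)
   would be a smaller period. *)
move=> E; have lt : (0 < i + (f - k) < f)%N by apply/andP; split; lia.
by have /eqP [] := xi lt; rewrite expnD exprM E -exprM -expnD subnKC // ltnW.
Qed.

End FrobeniusOrbits.

Section ResidueField.
Variables (F : finFieldType) (Om : fieldType) (j : {rmorphism F -> Om}).
Variables (th r : Om) (g f : nat).
Let q := #|F|.
Hypotheses (g_gt0 : (0 < g)%N) (f_gt0 : (0 < f)%N).
Hypotheses (th_g : th ^+ (q ^ g) = th)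
           (th_i : forall i, (0 < i < g)%N -> th ^+ (q ^ i) != th).
Hypotheses (r_f : r ^+ ((q ^ g) ^ f) = r)
           (r_i : forall i, (0 < i < f)%N -> r ^+ ((q ^ g) ^ i) != r).

Lemma frob_root e (p : {poly Om}) y : (forall i, p`_i ^+ (q ^ e) = p`_i) ->
  root p y -> root p (y ^+ (q ^ e)).
Proof.
move=> pe; rewrite !rootE !horner_coef => /eqP py.
have := congr1 (fun u => u ^+ (q ^ e)) py.
rewrite (frob_sum j) (frob0 F) => E; apply/eqP; rewrite -[RHS]E.
by apply: eq_bigr => i _; rewrite exprMn pe exprAC.
Qed.

Lemma frob_root_iter e k (p : {poly Om}) y : (forall i, p`_i ^+ (q ^ e) = p`_i) ->
  root p y -> root p (y ^+ ((q ^ e) ^ k)).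
Proof.
move=> pe py; elim: k => [|k IHk]; first by rewrite expn0 expr1.
by rewrite expnSr exprM; apply: frob_root.
Qed.

Lemma ev1_small_eq0 (p : {poly F}) : (size p <= g)%N -> ev1 j th p = 0 -> p = 0.
Proof.
move=> sp p0; apply/eqP; rewrite -(map_poly_eq0 j); apply: contraT => nz.
have := max_poly_roots nz _ (frob_orbit_uniq th_g th_i).
rewrite size_map size_iota size_map_poly ltnNge sp /=; apply.
apply/allP => _ /mapP [i _ ->]; rewrite -[q]expn1; apply: frob_root_iter.
  by move=> k; rewrite coef_map /=; apply: frob_const.
by apply/eqP.
Qed.

Lemma ev2_small_eq0 (a : {poly {poly F}}) :
  (size a <= f)%N -> (forall i, size (a`_i)%R <= g)%N ->
  ev2 j th r a = 0 -> a = 0.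
Proof.
move=> sa sai a0; set p := map_poly (ev1 j th) a.
have p0 : p = 0.
  apply/eqP; apply: contraT => nz.
  have := max_poly_roots nz _ (frob_orbit_uniq r_f r_i).
  rewrite size_map size_iota ltnNge (leq_trans (size_poly _ _)) //=; apply.
  apply/allP => _ /mapP [i _ ->]; apply: frob_root_iter; last by apply/eqP.
  by move=> k; rewrite coef_map /= ev1_frob th_g.
apply/polyP => i; rewrite coef0; apply: ev1_small_eq0 => //.
by rewrite -(coef_map (ev1 j th)) -/p p0 coef0.
Qed.

(** These q^(g f) polynomials, of degree < g in T and < f in X, represent the residue field: no
    nonzero one vanishes at (th, r), since th has g conjugates over F and r has f conjugates over
    the field generated by th. *)
Definition mat2poly (A : 'M[F]_(f, g)) : {poly {poly F}} :=
  \poly_(i < f) (if insub i is Some k then rVpoly (row k A) else 0).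

Lemma mat2poly_inj : injective (fun A => ev2 j th r (mat2poly A)).
Proof.
move=> A B /eqP; rewrite -subr_eq0 -ev2B => /eqP AB.
have E : mat2poly A = mat2poly B.
  apply/eqP; rewrite -subr_eq0; apply/eqP/ev2_small_eq0 => //.
    by rewrite (leq_trans (size_polyD _ _)) // size_polyN geq_max !size_poly.
  have s1 C i : (size ((mat2poly C)`_i)%R <= g)%N.
    rewrite coef_poly; case: ltnP => _; last by rewrite size_poly0.
    by case: insubP => [k _ _|_]; rewrite ?size_poly0 // size_poly.
  by move=> i; rewrite coefB (leq_trans (size_polyD _ _)) // size_polyN geq_max !s1.
apply/row_matrixP => i; apply: (can_inj rVpolyK).
by move/(congr1 (fun p : {poly {poly F}} => p`_i)): E; rewrite !coef_poly ltn_ord valK.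
Qed.

Lemma ev2_fixed a : ev2 j th r a ^+ (q ^ (g * f)) = ev2 j th r a.
Proof.
rewrite ev2_frob; congr (ev2 j _ _ a); last by rewrite expnM.
rewrite expnM; elim: f => [|k IHk]; first by rewrite expn0 expr1.
by rewrite expnS exprM th_g.
Qed.

Lemma mat2poly_surj y : y ^+ (q ^ (g * f)) = y -> exists A, ev2 j th r (mat2poly A) = y.
Proof.
move=> yE; set s := [seq ev2 j th r (mat2poly A) | A : 'M[F]_(f, g)].
have [/mapP [A _ ->]|ys] := boolP (y \in s); first by exists A.
have q1 : (1 < q ^ (g * f))%N.
  by rewrite -(expn0 q) ltn_exp2l ?q_gt1 // muln_gt0 g_gt0.
pose P : {poly Om} := 'X^(q ^ (g * f)) - 'X.
have sP : size P = (q ^ (g * f)).+1.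
  by rewrite size_polyDl size_polyXn // size_polyN size_polyX.
have P0 : P != 0 by rewrite -size_poly_gt0 sP.
have rP z : root P z = (z ^+ (q ^ (g * f)) == z).
  by rewrite rootE hornerD hornerN hornerXn hornerX subr_eq0.
have := max_poly_roots P0 (rs := y :: s); rewrite sP /= ys size_map -cardE card_mx.
rewrite mulnC ltnn map_inj_uniq ?enum_uniq; last exact: mat2poly_inj.
rewrite rP yE eqxx /= => W.
suff aS : all (root P) s by have := W aS isT.
by apply/allP => _ /mapP [A _ ->]; rewrite rP ev2_fixed.
Qed.
End ResidueField.

(** * A criterion for a localisation to be a place *)

Section LocalRing.
Variables (F : finFieldType) (L : fieldType) (iota : {rmorphism {fraction {poly F}} -> L}).
Variables (Om : fieldType) (B : comNzRingType).
Variables (ev : {rmorphism B -> L}) (phi : {rmorphism B -> Om}) (pi : B).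
Hypothesis G1 : forall a, ev a = 0 -> phi a = 0.
Hypothesis H1 : forall a, phi a = 0 -> exists b a', phi b != 0 /\ ev (b * a) = ev (pi * a').
Hypothesis H2 : forall a, ev a != 0 -> exists c' b c n,
  [/\ phi b != 0, phi c != 0 & ev (a * c' * b) = ev (pi ^+ n * c)].
Hypothesis phi_pi : phi pi = 0.
Hypothesis ev_pi : ev pi != 0.
Hypothesis ev_const : forall c, exists b, ev b = embA iota c%:P.
Variables (e : nat) (res : 'I_(#|F| ^ e) -> B).
Hypothesis res_inj : forall i k, phi (res i) = phi (res k) -> i = k.
Hypothesis res_surj : forall y, y ^+ (#|F| ^ e) = y -> exists i, phi (res i) = y.
Hypothesis phi_fixed : forall a, phi a ^+ (#|F| ^ e) = phi a.
Hypothesis e_gt0 : (0 < e)%N.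

Lemma phi_ext a b : ev a = ev b -> phi a = phi b.
Proof.
by move/eqP; rewrite -subr_eq0 -rmorphB /= => /eqP/G1/eqP; rewrite rmorphB subr_eq0 => /eqP.
Qed.

Lemma ev_unit b : phi b != 0 -> ev b != 0.
Proof. by apply: contraNneq => /G1 ->. Qed.

(** The hypotheses describe a discrete valuation ring with uniformizer pi without naming its
    valuation. The exponent in [H2] bounds how often pi divides a: each use of [H1] lowers it by
    one, and at exponent 0 the element a divides a local unit. *)
Lemma local_uniformizer a : ev a != 0 -> exists n b c,
  [/\ phi b != 0, phi c != 0 & ev a * ev b = ev pi ^+ n * ev c].
Proof.
move=> a0; have [c' [b [c [n [b0 c0]]]]] := H2 a0; rewrite !rmorphM rmorphXn.
elim: n a a0 c' b c b0 c0 => [|n IHn] a a0 c' b c b0 c0 E.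
  have : ev (a * (c' * b)) = ev c by rewrite !rmorphM mulrA E expr0 mul1r.
  move=> /phi_ext E'; exists 0, (c' * b), c; rewrite expr0 mul1r; split=> //.
    by apply: contraNneq c0; rewrite -E' [phi (a * _)]rmorphM => ->; rewrite mulr0.
  by rewrite rmorphM mulrA E expr0 mul1r.
have [pa|pa] := eqVneq (phi a) 0; last first.
  by exists 0, 1, a; rewrite !rmorph1 oner_eq0 expr0 mul1r mulr1.
have [b1 [a' [b10]]] := H1 pa; rewrite !rmorphM => ba.
have a'0 : ev a' != 0.
  apply: contraTneq (mulf_neq0 (ev_unit b10) a0) => a'0.
  by rewrite ba a'0 mulr0 eqxx.
have b1c : phi (b1 * c) != 0 by rewrite rmorphM mulf_neq0.
have [|n' [b2 [c2 [b20 c20 E2]]]] := IHn a' a'0 c' b (b1 * c) b0 b1c.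
  apply: (mulfI ev_pi); rewrite rmorphM !mulrA -ba -exprS.
  have -> : ev b1 * ev a * ev c' * ev b = ev b1 * (ev a * ev c' * ev b) by rewrite !mulrA.
  by rewrite E mulrCA mulrA.
exists n'.+1, (b1 * b2), c2; split=> //; first by rewrite rmorphM mulf_neq0.
by rewrite rmorphM mulrA [ev a * _]mulrC ba -mulrA E2 mulrA exprS.
Qed.

Definition local_ring (u : L) : Prop := exists a b, phi b != 0 /\ u = ev a / ev b.

Lemma local_ringV a b : phi a != 0 -> phi b != 0 -> local_ring (ev a / ev b)^-1.
Proof. by move=> a0 b0; exists b, a; rewrite invf_div. Qed.

Lemma local_ring_ev a : local_ring (ev a).
Proof. by exists a, 1; rewrite !rmorph1 oner_eq0 divr1. Qed.

Lemma local_ideal a b : phi b != 0 -> place_ideal local_ring (ev a / ev b) <-> phi a = 0.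
Proof.
move=> b0; split=> [[_]|pa].
  have [// | pa] := eqVneq (phi a) 0; case=> [/eqP|]; last by case; apply: local_ringV.
  by rewrite mulf_eq0 invr_eq0 (negbTE (ev_unit pa)) (negbTE (ev_unit b0)).
split; first by exists a, b.
have [a0|a0] := eqVneq (ev a) 0; first by left; rewrite a0 mul0r.
right=> -[c [d [d0 /eqP]]]; rewrite invf_div eqr_div ?(ev_unit d0) // -!(rmorphM ev).
move=> /eqP/phi_ext/eqP; rewrite !rmorphM pa mulr0 mulf_eq0.
by rewrite (negbTE b0) (negbTE d0).
Qed.

Lemma local_ring_place : is_place iota (fractions ev) local_ring.
Proof.
split; split.
- by move=> _ [a [b [b0 ->]]]; exists a, b; rewrite ev_unit.
- by rewrite -(rmorph0 ev); apply: local_ring_ev.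
- by rewrite -(rmorph1 ev); apply: local_ring_ev.
- move=> _ _ [a [b [b0 ->]]] [c [d [d0 ->]]]; exists (a * d - c * b), (b * d).
  split; first by rewrite rmorphM mulf_neq0.
  by rewrite rmorphB !rmorphM -[in LHS]mulNr addf_div ?ev_unit // mulNr.
- move=> _ _ [a [b [b0 ->]]] [c [d [d0 ->]]]; exists (a * c), (b * d).
  by rewrite !rmorphM mulf_neq0 // mulf_div.
- by move=> c; have [b <-] := ev_const c; apply: local_ring_ev.
- exists (ev pi)^-1; split.
    by apply: (fcV (fractions_closed ev)); apply: fractions_ev.
  move=> h; have := proj2 (local_ideal pi (b := 1) _) phi_pi.
  rewrite !rmorph1 oner_eq0 divr1 => /(_ isT) [_ [/eqP|]]; last by case.
  by rewrite (negbTE ev_pi).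
- move=> _ [a [b [b0 ->]]]; rewrite mulf_eq0 negb_or => /andP[a0 _].
  have [n [b1 [c1 [b10 c10 E1]]]] := local_uniformizer a0.
  have [k [b2 [c2 [b20 c20 E2]]]] := local_uniformizer b0.
  (* A quotient of elements of orders n' >= k', stated for arbitrary arguments because it serves for
     the given element and for its inverse. *)
  have X (n' k' : nat) a' a1 a2 b' d1 d2 : phi a1 != 0 -> phi d1 != 0 -> phi a2 != 0 ->
      phi d2 != 0 -> ev a' * ev a1 = ev pi ^+ n' * ev d1 ->
      ev b' * ev a2 = ev pi ^+ k' * ev d2 -> (k' <= n')%N -> local_ring (ev a' / ev b').
    move=> A1 D1 A2 D2 Ea Eb le; exists (pi ^+ (n' - k') * d1 * a2), (d2 * a1).
    rewrite rmorphM mulf_neq0 //; split=> //; rewrite !rmorphM rmorphXn.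
    have b'0 : ev b' != 0.
      have : ev pi ^+ k' * ev d2 != 0 by rewrite mulf_neq0 ?(ev_unit D2) // expf_neq0.
      by rewrite -Eb; apply: contraNneq => ->; rewrite mul0r.
    have nz : ev d2 * ev a1 != 0 by rewrite mulf_neq0 ?(ev_unit A1) ?(ev_unit D2).
    apply/eqP; rewrite (eqr_div _ _ b'0 nz); apply/eqP.
    apply: (mulfI (expf_neq0 k' ev_pi)).
    have -> : ev pi ^+ k' * (ev a' * (ev d2 * ev a1)) = (ev a' * ev a1) * (ev pi ^+ k' * ev d2).
      by rewrite mulrCA -!mulrA; congr (_ * _); rewrite [RHS]mulrC -!mulrA.
    rewrite Ea -Eb -(subnK le) exprD addnK.
    by rewrite -!mulrA; ring.
  have [le|/ltnW le] := leqP k n; [left|right]; first exact: (X _ _ _ _ _ _ _ _ _ _ _ _ E1 E2).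
  by rewrite invf_div; apply: (X _ _ _ _ _ _ _ _ _ _ _ _ E2 E1).
Qed.

Lemma local_ring_deg : place_deg F local_ring e.
Proof.
exists (ev \o res); split=> [i|_ [a [b [b0 ->]]]]; first exact: local_ring_ev.
have [|i Ei] := res_surj (y := phi a / phi b); first by rewrite exprMn exprVn !phi_fixed.
have D k : ev a / ev b - ev (res k) = ev (a - b * res k) / ev b.
  by rewrite rmorphB rmorphM mulrBl [ev b * _]mulrC mulfK ?ev_unit.
exists i; split=> [|k /=]; rewrite D local_ideal // rmorphB rmorphM.
  by rewrite Ei mulrC divfK // subrr.
move=> /eqP; rewrite subr_eq0 => /eqP E; apply: res_inj.
by rewrite Ei E mulrC mulKf.
Qed.

(** If phi b is nonzero, b^(Q-1) - 1 is in the kernel of phi, hence in the ideal of O, so b is a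
    unit of O and O contains the local ring. An element of O outside this valuation ring would have
    its inverse in the ideal of O. *)
Lemma local_ring_uniq (O : L -> Prop) : is_place iota (fractions ev) O ->
  (forall a, O (ev a)) -> (forall a, phi a = 0 -> place_ideal O (ev a)) ->
  forall u, O u <-> local_ring u.
Proof.
move=> pO Oev Mev.
have cK := fractions_closed ev.
have Ov b : phi b != 0 -> O (ev b)^-1.
  move=> b0; apply: boolp.contrapT => nO.
  have Mb : place_ideal O (ev b) by split=> //; right.
  have Q1 : (1 < #|F| ^ e)%N by rewrite -(expn0 #|F|) ltn_exp2l ?q_gt1.
  have [Q0 Qe] : (0 < (#|F| ^ e).-1)%N /\ (#|F| ^ e).-1.+1 = (#|F| ^ e)%N by lia.
  have := Mev (b ^+ (#|F| ^ e).-1 - 1); rewrite rmorphB rmorphXn rmorph1.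
  have -> : phi b ^+ (#|F| ^ e).-1 = 1.
    by apply: (mulfI b0); rewrite -exprS Qe phi_fixed mulr1.
  rewrite subrr => /(_ erefl); rewrite rmorphB rmorphXn rmorph1 => M1.
  apply: (ideal_neq1 pO).
  have -> : 1 = ev b ^+ (#|F| ^ e).-1 - (ev b ^+ (#|F| ^ e).-1 - 1) by rewrite opprB addrC subrK.
  by apply: (pidealB cK pO) => //; apply: (pidealX pO).
move=> u; split=> [Ou|[a [b [b0 ->]]]]; last by apply: (placeM pO) => //; apply: Ov.
have [->|u0] := eqVneq u 0; first by rewrite -(rmorph0 ev); apply: local_ring_ev.
have [//|] := place_total local_ring_place (placeK pO Ou).
case=> a [b [b0 uE]]; have [pa|pa] := eqVneq (phi a) 0; last first.
  by rewrite -[u]invrK uE; apply: local_ringV.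
have Mq : place_ideal O (ev a / ev b).
  by apply: (pidealMr pO (Mev _ pa)); apply: Ov.
case: (ideal_neq1 pO); rewrite -[X in place_ideal O X](mulfV u0) uE.
exact: (pidealMl pO Ou Mq).
Qed.
End LocalRing.

Lemma monic_division (R : idomainType) (d a : {poly R}) : d \is monic ->
  exists c r, a = c * d + r /\ (size r < size d)%N.
Proof.
move=> md; exists (Pdiv.Idomain.divp a d), (Pdiv.Idomain.modp a d).
split; last by rewrite Pdiv.Idomain.ltn_modp monic_neq0.
by have := Pdiv.Idomain.divp_eq a d; rewrite (monicP md) expr1n scale1r.
Qed.

Lemma fraction_numden (R : idomainType) (x : {fraction R}) :
  exists n d, d != 0 /\ x = FracField.tofrac n / FracField.tofrac d.
Proof.
elim/quotW: x => r; exists (frac r).1, (frac r).2.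
have d0 : (frac r).2 != 0 by apply: denom_ratioP.
have d0' : FracField.tofrac (frac r).2 != 0 by rewrite tofrac_eq0.
split=> //; apply: (mulIf d0'); rewrite divfK // /FracField.tofrac; unlock.
rewrite -[LHS]FracField.pi_mul; apply/eqmodP.
rewrite /= FracField.equivfE /FracField.mulf !numden_Ratio ?oner_neq0 ?mulr1 //.
by rewrite mulrC.
Qed.

(** * Conjugation *)

Section Conjugation.
Variables (F : finFieldType) (L : closedFieldType).
Variable (iota : {rmorphism {fraction {poly F}} -> L}).
Hypothesis L_alg : forall x : L, exists P : {poly {fraction {poly F}}},
  P != 0 /\ root (map_poly iota P) x.

Lemma embA_inj a : embA iota a = 0 -> a = 0.
Proof. by move/eqP; rewrite fmorph_eq0 tofrac_eq0 => /eqP. Qed.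

Notation jL := (cst (embA iota) : {rmorphism F -> L}).
Notation T := (embA iota 'X).

Lemma ev1_embA a : ev1 jL T a = embA iota a.
Proof.
rewrite ev1E -[in RHS](coefK a) poly_def rmorph_sum; apply: eq_bigr => i _.
by rewrite -mul_polyC rmorphM rmorphXn.
Qed.

Lemma ev2_embA x a : ev2 jL T x a = (map_poly (embA iota) a).[x].
Proof. by rewrite /ev2 (eq_map_poly ev1_embA). Qed.

(* A k-homomorphism k(la) -> L, obtained by extending the graph of
   [a(la) |-> a(la')] to a valuation ring of L; this ring is L itself because L
   is algebraic over k. *)
Lemma conjugation (la la' : L) :
  (forall a, ev2 jL T la a = 0 -> ev2 jL T la' a = 0) ->
  exists sigma : {rmorphism L -> L},
    (forall c, sigma (iota c) = iota c) /\ sigma la = la'.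
Proof.
move=> sub; pose R := (L * L)%type.
pose G0 (u : R) := exists a, u = (ev2 jL T la a, ev2 jL T la' a).
have gG0 : hom_graph G0.
  split.
  - by exists 1; rewrite !ev2_1.
  - by move=> _ _ [a ->] [b ->]; exists (a - b); rewrite !ev2B.
  - by move=> _ _ [a ->] [b ->]; exists (a * b); rewrite !ev2M.
  - by move=> b [a [/esym/sub <- ->]].
have [G [subG [G1 GB GM Gf] Ginv Gval]] := place_extension gG0.
have GA a : G (embA iota a, embA iota a).
  by apply: subG; exists a%:P; rewrite !ev2C ev1_embA.
have Gk c : G (iota c, iota c).
  have [n [d [d0 ->]]] := fraction_numden c.
  have d0' : embA iota d != 0 by apply: contraNneq d0 => /embA_inj ->.
  by have [_ Gd] := Ginv _ _ (GA d) d0'; have := GM _ _ (GA n) Gd; rewrite fmorph_div.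
have G0' : G 0 by rewrite -(subrr 1); apply: GB.
have GD u v : G u -> G v -> G (u + v).
  by move=> Gu Gv; rewrite -[v]opprK -[- v]sub0r; apply: (GB _ _ Gu); apply: GB.
have GX u n : G u -> G (u ^+ n).
  by move=> Gu; elim: n => // n IHn; rewrite exprS; apply: GM.
have aux (u v w w' z z' : L) : z * z' = 1 -> w * w' = 1 ->
    - (u * v) = w * (v * z) * (- u * w' * z').
  move=> zz ww; transitivity (- (u * v) * (w * w') * (z * z')); last by ring.
  by rewrite zz ww !mulr1.
(* If x were outside the domain, 1/x would map to 0. Dividing an equation of x over k by its leading
   term gives 1 as a combination of positive powers of 1/x with coefficients in k, so 1 would map to
   0 as well. *)
have Gdom x : exists y, G (x, y).
  have [//|[x0 Gx]] := Gval x; case/eqP: (oner_neq0 L); apply: Gf.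
  have [P [P0 /rootP Px]] := L_alg x.
  set n := (size P).-1.
  have sP : size P = n.+1 by rewrite prednK // size_poly_gt0.
  have lP : P`_n != 0 by rewrite -[P`_n]/(lead_coef P) lead_coef_eq0.
  pose c i := - P`_i / P`_n.
  have xE : 1 = \sum_(i < n) iota (c i) * x^-1 ^+ (n - i).
    move: Px; rewrite (horner_coef_wide (n := n.+1)) ?size_map_poly ?sP // big_ord_recr /=.
    rewrite coef_map /= addrC => /eqP; rewrite addr_eq0 => /eqP E.
    have ln0 : iota P`_n * x ^+ n != 0 by rewrite mulf_neq0 ?fmorph_eq0 ?expf_neq0.
    apply: (mulfI ln0); rewrite mulr1 {1}E -sumrN mulr_sumr; apply: eq_bigr => i _.
    rewrite coef_map /c rmorphM rmorphN fmorphV.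
    have -> : x ^+ n = x ^+ i * x ^+ (n - i) by rewrite -exprD subnKC // ltnW.
    have xx : x ^+ (n - i) * x^-1 ^+ (n - i) = 1 by rewrite -exprMn mulfV // expr1n.
    have pp : iota P`_n * (iota P`_n)^-1 = 1 by rewrite mulfV // fmorph_eq0.
    exact: aux.
  have : G (1, 0).
    rewrite {1}xE.
    have -> : (\sum_(i < n) iota (c i) * x^-1 ^+ (n - i), 0) =
        \sum_(i < n) ((iota (c i), iota (c i)) * (x^-1, 0) ^+ (n - i) : R).
      rewrite [RHS]surjective_pairing; congr (_, _).
        rewrite (raddf_sum (fst : {additive R -> L})); apply: eq_bigr => i _.
        by rewrite /= (rmorphXn (fst : {rmorphism R -> L})).
      rewrite (raddf_sum (snd : {additive R -> L})) big1 // => i _ /=.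
      rewrite (rmorphXn (snd : {rmorphism R -> L})) /= expr0n.
      by rewrite subn_eq0 leqNgt ltn_ord mulr0.
    apply: (big_ind G) => // i _; apply: GM => //.
    exact: GX.
  by move=> /(GB _ _ G1); congr G; apply/eqP; rewrite xpair_eqE /= subrr subr0 !eqxx.
pose f x := projT1 (boolp.cid (Gdom x)).
have Gsf x : G (x, f x) by rewrite /f; case: boolp.cid.
have Guniq x y z : G (x, y) -> G (x, z) -> y = z.
  move=> Gy Gz; apply/eqP; rewrite -subr_eq0; apply/eqP/Gf.
  by have := GB _ _ Gy Gz; congr G; apply/eqP; rewrite xpair_eqE /= subrr !eqxx.
have fB : zmod_morphism f by move=> x y; apply: (Guniq (x - y)) => //; apply: (GB (_, _) (_, _)).
have fM : monoid_morphism f.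
  by split=> [|x y]; [apply: (Guniq 1)|apply: (Guniq (x * y)) => //; apply: (GM (_, _) (_, _))].
pose addf := GRing.isZmodMorphism.Build L L f fB.
pose mulf := GRing.isMonoidMorphism.Build L L f fM.
pose s : {rmorphism L -> L} := HB.pack f addf mulf.
exists s; split=> [c|]; first exact: (Guniq (iota c)).
apply: (Guniq la) => //; apply: subG.
by exists 'X; rewrite !ev2X.
Qed.
End Conjugation.

Section ResiduePolynomials.
Variables (F : finFieldType) (Om : closedFieldType) (jO : {rmorphism F -> Om}).
Let q := #|F|.

Lemma frob_fixed_const y : y ^+ q = y -> exists c, y = jO c.
Proof.
move=> yq; have [/mapP [c _ ->]|ys] := boolP (y \in [seq jO c | c : F]); first by exists c.
pose P : {poly Om} := 'X^q - 'X.
have sP : size P = q.+1 by rewrite size_polyDl size_polyXn // size_polyN size_polyX ltnS q_gt1.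
have P0 : P != 0 by rewrite -size_poly_gt0 sP.
have rP z : root P z = (z ^+ q == z).
  by rewrite rootE hornerD hornerN hornerXn hornerX subr_eq0.
have := max_poly_roots P0 (rs := y :: [seq jO c | c : F]).
rewrite sP /= ys size_map -cardE ltnn map_inj_uniq ?enum_uniq; last exact: fmorph_inj.
rewrite rP yq eqxx /= => W.
suff aS : all (root P) [seq jO c | c : F] by have := W aS isT.
by apply/allP => _ /mapP [c _ ->]; rewrite rP -rmorphXn expf_card.
Qed.

Section Irreducible.
Variables (P : {poly F}) (P_monic : P \is monic) (P_irr : irreducible_poly P).
Let g := (size P).-1.

Lemma irr_deg_gt0 : (0 < g)%N.
Proof. by case: P_irr => + _; rewrite /g; case: (size P) => [|[|]]. Qed.

Lemma irr_root_exists : exists th, ev1 jO th P = 0.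
Proof.
have /closed_rootP [th /eqP] : size (map_poly jO P) != 1.
  by rewrite size_map_poly neq_ltn; case: P_irr => ->; rewrite orbT.
by exists th.
Qed.

Variables (th : Om) (th_root : ev1 jO th P = 0).
Let rho : {rmorphism {poly F} -> Om} := ev1 jO th.

Lemma ev1_dvd a : (ev1 jO th a == 0) = (P %| a).
Proof.
apply/eqP/idP => [a0|/dvdpP [b ->]]; last by rewrite ev1M th_root mulr0.
apply: contraT => nd.
have /Bezout_eq1_coprimepP [[u v] /= uv] : coprimep P a.
  by rewrite (irreducible_poly_coprime _ P_irr).
have := congr1 (ev1 jO th) uv.
rewrite ev1D !ev1M th_root a0 !mulr0 addr0 ev1_1 => /eqP.
by rewrite eq_sym oner_eq0.
Qed.

(* Both [x |-> x^(q^g)] and [tau] are Carlitz actions, hence commute. *)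
Lemma th_frob : th ^+ (q ^ g) = th.
Proof.
have K x : carl rho P x = x ^+ (q ^ g) by apply: carl_kernel.
have := carlM rho P 'X 1; rewrite mulrC carlXl -[carl rho 'X 1]/(carl rho 'X^1 1) carlXn /=.
rewrite !K expr1n /tau expr1n !mulr1 (frobD jO) expr1n => /addrI.
by rewrite /rho /= ev1X.
Qed.

(** A smaller period would fix the values at th of all q^g polynomials of degree < g, which are
    distinct, but X^(q^i) - X has only q^i roots. *)
Lemma th_frob_min i : (0 < i < g)%N -> th ^+ (q ^ i) != th.
Proof.
case/andP=> i0 ig; apply/eqP => thi.
pose s := [seq ev1 jO th (rVpoly v) | v : 'rV[F]_g].
pose Q : {poly Om} := 'X^(q ^ i) - 'X.
have q1 : (1 < q ^ i)%N by rewrite -(expn0 q) ltn_exp2l ?q_gt1.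
have sQ : size Q = (q ^ i).+1.
  by rewrite size_polyDl size_polyXn // size_polyN size_polyX.
have Q0 : Q != 0 by rewrite -size_poly_gt0 sQ.
have := max_poly_roots Q0 (rs := s); rewrite sQ size_map -cardE card_mx mul1n.
have -> : uniq s.
  rewrite map_inj_uniq ?enum_uniq // => u v /eqP.
  rewrite -subr_eq0 -ev1B -linearB ev1_dvd => Puv.
  apply/eqP; rewrite -subr_eq0 -(can_eq rVpolyK) linear0.
  apply: contraTT Puv => nz; rewrite gtNdvdp //.
  by rewrite (leq_ltn_trans (size_poly _ _)) // /g prednK ?size_poly_gt0 ?monic_neq0.
have -> : all (root Q) s.
  apply/allP => _ /mapP [v _ ->].
  by rewrite rootE hornerD hornerN hornerXn hornerX ev1_frob thi subrr.
by rewrite ltnS leq_exp2l ?q_gt1 // leqNgt ig => /(_ isT isT).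
Qed.

Lemma prime_part D : D != 0 -> exists v D0, D = P ^+ v * D0 /\ ev1 jO th D0 != 0.
Proof.
move: {2}(size D) (leqnn (size D)) => n; elim: n D => [|n IHn] D.
  by rewrite leqn0 size_poly_eq0 => /eqP ->; rewrite eqxx.
move=> sD D0; have [/eqP|] := eqVneq (ev1 jO th D) 0; last first.
  by move=> nz; exists 0%N, D; rewrite expr0 mul1r.
rewrite ev1_dvd => /dvdpP [D1 DE].
have D10 : D1 != 0 by apply: contraNneq D0 => D10; rewrite DE D10 mul0r.
have [|v [D2 [E nz]]] := IHn D1 _ D10.
  rewrite -ltnS; apply: leq_trans sD; rewrite DE size_Mmonic //.
  by have := irr_deg_gt0; rewrite /g; case: (size P) => [|[|k]] // _; rewrite !addnS /= ltnS leq_addr.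
by exists v.+1, D2; rewrite DE E exprSr mulrAC.
Qed.
End Irreducible.
End ResiduePolynomials.

(** * Finite places of the cyclotomic fields *)

Section Point.
Variables (F : finFieldType) (L : closedFieldType).
Variable (iota : {rmorphism {fraction {poly F}} -> L}).
Variables (Om : closedFieldType) (jO : {rmorphism F -> Om}).
Notation jL := (cst (embA iota) : {rmorphism F -> L}).
Let q := #|F|.
Let AX : comNzRingType := {poly {poly F}}.

(* [th] and [r] are the residues of [s] and [x]. *)
Definition point (s x : L) (th r : Om) : L -> Prop :=
  @local_ring L Om AX (ev2 jL s x) (ev2 jO th r).

Variables (s x : L) (th r : Om) (pi : {poly {poly F}}) (g f : nat).
Hypotheses (g_gt0 : (0 < g)%N) (f_gt0 : (0 < f)%N).
Hypotheses (th_g : th ^+ (q ^ g) = th)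
           (th_i : forall i, (0 < i < g)%N -> th ^+ (q ^ i) != th).
Hypotheses (r_f : r ^+ ((q ^ g) ^ f) = r)
           (r_i : forall i, (0 < i < f)%N -> r ^+ ((q ^ g) ^ i) != r).
Hypothesis G1 : forall a, ev2 jL s x a = 0 -> ev2 jO th r a = 0.
Hypothesis H1 : forall a, ev2 jO th r a = 0 ->
  exists b a' : {poly {poly F}}, ev2 jO th r b != 0 /\ ev2 jL s x (b * a) = ev2 jL s x (pi * a').
Hypothesis H2 : forall a, ev2 jL s x a != 0 -> exists (c' b c : {poly {poly F}}) (n : nat),
  [/\ ev2 jO th r b != 0, ev2 jO th r c != 0 &
      ev2 jL s x (a * c' * b) = ev2 jL s x (pi ^+ n * c)].
Hypothesis phi_pi : ev2 jO th r pi = 0.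
Hypothesis ev_pi : ev2 jL s x pi != 0.

Lemma residue_system : exists res : 'I_(q ^ (g * f)) -> {poly {poly F}},
  (forall i k, ev2 jO th r (res i) = ev2 jO th r (res k) -> i = k) /\
  (forall y, y ^+ (q ^ (g * f)) = y -> exists i, ev2 jO th r (res i) = y).
Proof.
have cE : (q ^ (g * f))%N = #|'M[F]_(f, g)| by rewrite card_mx mulnC.
exists (fun i => mat2poly (enum_val (cast_ord cE i))); split.
  move=> i k /(mat2poly_inj th_g th_i r_f r_i) /enum_val_inj /(@cast_ord_inj _ _ cE).
  by [].
move=> y yE; have [A AE] := mat2poly_surj jO g_gt0 f_gt0 th_g th_i r_f r_i yE.
by exists (cast_ord (esym cE) (enum_rank A)); rewrite cast_ordKV enum_rankK.
Qed.

Let ev_const c : exists b, ev2 jL s x b = embA iota c%:P.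
Proof. by exists (c%:P)%:P; rewrite ev2C ev1C. Qed.

Lemma point_place : is_place iota (Kgen jL s x) (point s x th r).
Proof. exact: (@local_ring_place F L iota Om AX _ _ pi G1 H1 H2 phi_pi ev_pi ev_const). Qed.

Lemma point_ideal a : place_ideal (point s x th r) (ev2 jL s x a) <-> ev2 jO th r a = 0.
Proof.
have := @local_ideal L Om AX (ev2 jL s x) (ev2 jO th r) G1 a 1.
by rewrite !rmorph1 oner_neq0 divr1; apply.
Qed.

Lemma point_ev a : point s x th r (ev2 jL s x a).
Proof. exact: (@local_ring_ev L Om AX). Qed.

Lemma point_deg : place_deg F (point s x th r) (g * f).
Proof.
have [res [inj surj]] := residue_system.
apply: (@local_ring_deg F L Om AX _ _ G1 _ res inj surj) => a.
exact: ev2_fixed.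
Qed.

Lemma point_uniq (O : L -> Prop) : is_place iota (Kgen jL s x) O ->
  (forall a, O (ev2 jL s x a)) ->
  (forall a, ev2 jO th r a = 0 -> place_ideal O (ev2 jL s x a)) ->
  forall u, O u <-> point s x th r u.
Proof.
apply: (@local_ring_uniq F L iota Om AX _ _ pi G1 H1 H2 phi_pi ev_pi ev_const (g * f)).
  by move=> a; apply: ev2_fixed.
by rewrite muln_gt0 g_gt0.
Qed.

(** The common interface of unramified, ramified and infinite points. The last clause recognises a
    place from its residues alone, which reduces the classification of places to finding residues of
    the generators. *)
Definition good_point e : Prop :=
  [/\ is_place iota (Kgen jL s x) (point s x th r), place_deg F (point s x th r) e,
      (forall a, point s x th r (ev2 jL s x a)),
      (forall a, place_ideal (point s x th r) (ev2 jL s x a) <-> ev2 jO th r a = 0) &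
      forall O : L -> Prop, is_place iota (Kgen jL s x) O ->
        (forall a, O (ev2 jL s x a)) ->
        (forall a, ev2 jO th r a = 0 -> place_ideal O (ev2 jL s x a)) ->
        forall u, O u <-> point s x th r u].

Lemma good_pointP : good_point (g * f).
Proof.
split; [exact: point_place|exact: point_deg|exact: point_ev|exact: point_ideal|].
exact: point_uniq.
Qed.
End Point.

Section CyclotomicModel.
Variables (F : finFieldType) (L : closedFieldType).
Variable (iota : {rmorphism {fraction {poly F}} -> L}).
Variables (m : {poly F}) (m_monic : m \is monic) (m_irr : irreducible_poly m).
Variables (Om : closedFieldType) (jO : {rmorphism F -> Om}).
Variables (thm : Om) (thm_root : ev1 jO thm m = 0).
Variables (h : nat) (hq : (h %| #|F|.-1)%N) (h_gt0 : (0 < h)%N).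
Let q := #|F|.
Notation jL := (cst (embA iota) : {rmorphism F -> L}).
Notation T := (embA iota 'X).
Notation d := (size m).-1.
Notation N := (Nh F h d).
Notation psi := (Psi h m).

Lemma q_pow_gt1 k : (0 < k)%N -> (1 < q ^ k)%N.
Proof. by move=> k0; rewrite -(expn0 q) ltn_exp2l ?q_gt1. Qed.

Lemma N_gt0 : (0 < N)%N.
Proof.
rewrite lt0n; apply/eqP => N0; have := Nh_mul d hq; rewrite N0 mul0n.
by have := q_pow_gt1 (irr_deg_gt0 m_irr); rewrite /q; case: (_ ^ _)%N => [|[]].
Qed.

Lemma psi_monic : psi \is monic. Proof. by have [] := Psi_spec hq h_gt0 m_monic. Qed.
Lemma size_psi : size psi = N.+1. Proof. by have [] := Psi_spec hq h_gt0 m_monic. Qed.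
Lemma psi_bar : map_poly (ev1 jO thm) psi = 'X^N.
Proof. exact: (@Psi_kernel F Om (ev1 jO thm) m m_monic m_irr h hq h_gt0 thm_root). Qed.

Section Generator.
Variables (la : L) (la_neq0 : la != 0) (la_root : carl (embA iota) m la = 0).
Notation nu := (la ^+ h).
Notation evL := (ev2 jL T nu).
Notation K := (Kgen jL T nu).

Lemma psi_nu : evL psi = 0.
Proof.
rewrite ev2_embA; apply/eqP; move/eqP: la_root.
by rewrite (carl_Psi _ _ _ hq) mulf_eq0 (negbTE la_neq0).
Qed.

Lemma minrel (a : {poly {poly F}}) : (size a <= N)%N -> evL a = 0 -> a = 0.
Proof.
rewrite ev2_embA => sa a0.
apply: (min_relation (rhoL := embA iota) (@embA_inj F L iota) (rho0 := ev1 jO thm)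
  m_monic (ev1_dvd m_irr thm_root) (psi := psi) (N := N) _ psi_bar size_psi (nu := nu)) => //.
  exact: Psi_at0.
by rewrite -ev2_embA psi_nu.
Qed.

Lemma rel_dvd a : evL a = 0 -> exists c, a = c * psi.
Proof.
have [c [r [-> sr]]] := monic_division a psi_monic.
rewrite ev2D ev2M psi_nu mulr0 add0r => /minrel r0; exists c.
by rewrite r0 ?addr0 // -ltnS -size_psi.
Qed.

(** A substitute for the norm to A. In k psi = u b + r the value r(nu) is a multiple of b(nu) of
    smaller degree, and one continues down to a constant. If r(nu) were 0, then u would be a nonzero
    relation of size at most N. *)
Lemma multiple_in_A a : evL a != 0 ->
  exists c' D, D != 0 /\ evL (a * c') = embA iota D.
Proof.
have main n (b : {poly {poly F}}) : (size b <= n)%N -> (size b <= N)%N -> evL b != 0 ->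
    exists c' D, D != 0 /\ evL (b * c') = embA iota D.
  elim: n b => [|n IHn] b sn sN b0.
    by move: sn b0; rewrite leqn0 size_poly_eq0 => /eqP ->; rewrite ev2_0 eqxx.
  have [/size1_polyC bC|s1] := leqP (size b) 1.
    exists 1, b`_0; rewrite mulr1 {2}bC ev2C ev1_embA; split=> //.
    by apply: contraNneq b0 => b00; rewrite bC b00 ev2_0.
  have bn0 : b != 0 by rewrite -size_poly_gt0 ltnW.
  have := Pdiv.Idomain.divp_eq psi b.
  set u := Pdiv.Idomain.divp psi b; set r := Pdiv.Idomain.modp psi b; set k := _ ^+ _ => E.
  have sr : (size r < size b)%N by apply: Pdiv.Idomain.ltn_modpN0.
  have k0 : k != 0 by rewrite expf_neq0 // lead_coef_eq0.
  have er : evL r = - (evL b * evL u).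
    have := congr1 evL E; rewrite -mul_polyC ev2M psi_nu mulr0 ev2D ev2M mulrC => e0.
    by apply/eqP; rewrite -addr_eq0 addrC -e0.
  have [r0|rn0] := eqVneq (evL r) 0; last first.
    have [||c' [D [D0 cD]]] := IHn r _ _ rn0.
    - by rewrite -ltnS (leq_trans sr).
    - by rewrite (leq_trans (ltnW sr)).
    exists (- (u * c')), D; split=> //.
    by rewrite -cD !ev2M er ev2N ev2M mulrN mulNr mulrA.
  have rz : r = 0 by apply: minrel => //; rewrite (leq_trans (ltnW sr)).
  have eu : evL u = 0.
    by move/esym/eqP: er; rewrite r0 oppr_eq0 mulf_eq0 (negbTE b0) => /eqP.
  have un0 : u != 0.
    apply: contraTneq (monic_neq0 psi_monic) => u0; move/eqP: E.
    by rewrite u0 rz mul0r addr0 -mul_polyC mulf_eq0 polyC_eq0 (negbTE k0) /= => ->.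
  have su : (size u <= N)%N.
    have := size_mul un0 bn0; rewrite -[u * b]addr0 -rz -E size_scale // size_psi.
    by move: s1; case: (size b) => [|[|i]] // _; rewrite !addnS /= => -[->]; rewrite leq_addr.
  by case/eqP: un0; apply: minrel.
have [c [r [-> sr]]] := monic_division a psi_monic; rewrite ev2D ev2M psi_nu mulr0 add0r => rn0.
have [|c' [D [D0 cD]]] := main _ r (leqnn _) _ rn0.
  by rewrite -ltnS -size_psi.
exists c', D; split=> //; rewrite -cD !ev2M.
by rewrite ev2D ev2M psi_nu mulr0 add0r.
Qed.

(* The places of [Kgen jL T nu] above a prime [P] are the points [(th, r)] with
   [th] a root of [P] and [r] a root of the specialisation of [psi] at [th]. *)
Section AtPrime.
Variables (P : {poly F}) (P_monic : P \is monic) (P_irr : irreducible_poly P).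
Variables (th : Om) (th_root : ev1 jO th P = 0).
Notation psi_th := (map_poly (ev1 jO th) psi).
Let g := (size P).-1.
Let g_gt0 : (0 < g)%N := irr_deg_gt0 P_irr.

Lemma root_psi_phi r : root psi_th r = (ev2 jO th r psi == 0).
Proof. by []. Qed.

Lemma phi_vanish r a : root psi_th r -> evL a = 0 -> ev2 jO th r a = 0.
Proof.
rewrite root_psi_phi => /eqP pr /rel_dvd [c ->].
by rewrite ev2M pr mulr0.
Qed.

(** The remainder of a by the monic psi has degree < N and vanishes modulo P, so all its
    coefficients are divisible by P. *)
Lemma ker_multiple (a : {poly {poly F}}) : psi_th %| map_poly (ev1 jO th) a ->
  exists a', evL a = embA iota P * evL a'.
Proof.
move=> dv; have [c [r [aE sr]]] := monic_division a psi_monic.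
have r0 : map_poly (ev1 jO th) r = 0.
  apply/eqP; apply: contraTT dv => rn0; rewrite aE rmorphD rmorphM /= dvdp_addr ?dvdp_mull //.
  rewrite gtNdvdp // (leq_ltn_trans (size_poly _ _)) //.
  by rewrite size_map_poly_id0 // (monicP psi_monic) rmorph1 oner_neq0.
have [r' rE] := map_poly_ker (ev1_dvd P_irr th_root) r0; exists r'.
by rewrite aE ev2D ev2M psi_nu mulr0 add0r rE -mul_polyC ev2M ev2C ev1_embA.
Qed.

Section Unramified.
Hypothesis P_neq_m : P != m.
Let ze := ev1 jO thm P ^+ h.
Variable (f : nat).
Hypotheses (f_gt0 : (0 < f)%N) (ze_f : ze ^+ f = 1)
  (ze_min : forall i, (0 < i < f)%N -> ze ^+ i != 1).

Lemma m_th_neq0 : ev1 jO th m != 0.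
Proof.
rewrite (ev1_dvd P_irr th_root); apply: contra P_neq_m => Pm.
have := m_irr.2 _ _ Pm; rewrite neq_ltn; case: P_irr => -> _; rewrite orbT => /(_ isT).
by rewrite eqp_monic.
Qed.

(** The reciprocity law: modulo P the map x |-> x^(q^g) is C_P. With r = x^h, fixing r means
    C_(P^i)(x) = c x with c^h = 1. As h divides q - 1, c is a constant of F, and the condition
    becomes m | P^i - c, that is, P(thm)^i = c. *)
Lemma frob_r_fixed r i : root psi_th r ->
  (r ^+ ((q ^ g) ^ i) == r) = (ze ^+ i == 1).
Proof.
move=> pr; pose rho : {rmorphism {poly F} -> Om} := ev1 jO th.
have [x xr] : exists x, x ^+ h = r.
  have /closed_rootP [x] : size ('X^h - r%:P) != 1 by rewrite size_XnsubC // eqSS -lt0n.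
  rewrite rootE hornerD hornerN hornerXn hornerC subr_eq0 => /eqP xr.
  by exists x.
have mx : carl rho m x = 0 by rewrite (carl_Psi _ _ _ hq) xr (eqP pr) mulr0.
have x0 : x != 0.
  apply: contraTneq pr => x0; rewrite rootE -xr x0 expr0n eqn0Ngt h_gt0 /=.
  by rewrite horner_coef0 coef_map -horner_coef0 Psi_at0 // m_th_neq0.
have xP : x ^+ ((q ^ g) ^ i) = carl rho (P ^+ i) x.
  elim: i => [|i IHi]; first by rewrite expn0 expr1 expr0 carl1.
  rewrite expnSr exprM IHi exprS carlM.
  by rewrite (@carl_kernel F Om rho P P_monic P_irr _ th_root).
have cc c : cst rho c = jO c by apply: ev1C.
have const c : (c ^+ h = 1 :> Om) -> exists c', c = jO c'.
  move=> ch; apply: (@frob_fixed_const F).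
  by rewrite -(q1K F) exprS -(divnK hq) mulnC exprM ch expr1n mulr1.
rewrite -xr exprAC xP; apply/eqP/eqP => [yx|zi].
  have /const [c cE] : (carl rho (P ^+ i) x / x) ^+ h = 1.
    by rewrite expr_div_n yx divff // expf_neq0.
  have : carl rho (P ^+ i - c%:P) x = 0.
    by rewrite carlB carlC cc -cE divfK // subrr.
  move=> /(carl_annih m_irr x0 mx).
  rewrite -(ev1_dvd m_irr thm_root) ev1B ev1Xn ev1C subr_eq0 => /eqP zc.
  by rewrite /ze exprAC zc -cE expr_div_n yx divff // expf_neq0.
have /const [c cE] : (ev1 jO thm P ^+ i) ^+ h = 1 by rewrite exprAC.
have : m %| P ^+ i - c%:P by rewrite -(ev1_dvd m_irr thm_root) ev1B ev1Xn ev1C cE subrr.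
case/dvdpP => b bE.
have -> : carl rho (P ^+ i) x = jO c * x.
  apply/eqP; rewrite -subr_eq0 -cc -carlC -carlB bE carlM mx carl0 //.
by rewrite exprMn -cE exprAC -/ze zi mul1r.
Qed.

Let r_f r : root psi_th r -> r ^+ ((q ^ g) ^ f) = r.
Proof. by move=> pr; apply/eqP; rewrite frob_r_fixed // ze_f. Qed.
Let r_i r : root psi_th r -> forall i, (0 < i < f)%N -> r ^+ ((q ^ g) ^ i) != r.
Proof. by move=> pr i lt; rewrite frob_r_fixed // ze_min. Qed.

Let phiP r : ev2 jO th r P%:P = 0. Proof. by rewrite ev2C th_root. Qed.

Let evP : evL P%:P != 0.
Proof.
rewrite ev2C ev1_embA; apply: contraNneq (monic_neq0 P_monic) => e.
by rewrite (embA_inj e).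
Qed.

(* With Q = q^(gf), every root of [psi_th] is fixed by the Q-Frobenius, so that
   [a^Q - a] lies in the ideal of [P] for every [a]. *)
Lemma unramified_H1 r a : root psi_th r -> ev2 jO th r a = 0 ->
  exists b a' : {poly {poly F}}, ev2 jO th r b != 0 /\ evL (b * a) = evL (P%:P * a').
Proof.
move=> pr a0; set Q := (q ^ (g * f))%N.
have Q1 : (1 < Q)%N by rewrite q_pow_gt1 // muln_gt0 g_gt0.
have [|a' a'E] := @ker_multiple (a - a ^+ Q).
  have [rs [psiE urs _]] := @Psi_separable F Om (ev1 jO th) m m_monic h hq h_gt0 m_th_neq0.
  rewrite psiE; apply: uniq_roots_dvdp; last by rewrite uniq_rootsE.
  apply/allP => r' r'rs; rewrite rootE.
  have pr' : root psi_th r' by rewrite psiE root_prod_XsubC.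
  have fixed : ev2 jO th r' a ^+ Q = ev2 jO th r' a.
    rewrite ev2_frob /Q; congr (ev2 jO _ _ _); last by rewrite expnM r_f.
    rewrite expnM; elim: (f) => [|k IHk]; first by rewrite expn0 expr1.
    by rewrite expnS exprM (th_frob P_monic P_irr th_root).
  by apply/eqP; rewrite -[LHS]/(ev2 jO th r' _) ev2B ev2Xn fixed subrr.
have QE : Q = Q.-1.+1 by rewrite prednK // ltnW.
(* Here b a = a - a^Q, and b has residue 1 because a has residue 0 and Q > 1. *)
exists (1 - a ^+ Q.-1), a'; split.
  rewrite ev2B ev2_1 ev2Xn a0 expr0n; move: Q1; rewrite QE; case: (Q.-1) => //= _ _.
  by rewrite subr0 oner_neq0.
rewrite [RHS]ev2M ev2C ev1_embA -a'E; congr (ev2 _ _ _ _).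
by rewrite mulrBl mul1r -exprSr -QE.
Qed.

Lemma unramified_H2 r a : evL a != 0 -> exists (c' b c : {poly {poly F}}) (n : nat),
  [/\ ev2 jO th r b != 0, ev2 jO th r c != 0 & evL (a * c' * b) = evL (P%:P ^+ n * c)].
Proof.
move=> /multiple_in_A [c' [D [D0 cD]]].
have [v [D1 [DE D10]]] := prime_part P_monic P_irr th_root D0.
exists c', 1, D1%:P, v; rewrite ev2_1 oner_neq0 ev2C; split=> //.
by rewrite mulr1 cD ev2M ev2Xn !ev2C !ev1_embA DE rmorphM rmorphXn.
Qed.

Lemma unramified_point r : root psi_th r ->
  good_point iota jO T nu th r (g * f).
Proof.
move=> pr; apply: (@good_pointP F L iota Om jO T nu th r P%:P) => //.
- exact: (th_frob P_monic P_irr th_root).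
- exact: (th_frob_min P_monic P_irr th_root).
- exact: r_f.
- exact: r_i.
- by move=> a; apply: phi_vanish.
- by move=> a; apply: unramified_H1.
- by move=> a; apply: unramified_H2.
Qed.
End Unramified.

Section Classification.
Variables (O : L -> Prop) (pO : is_place iota K O).

Lemma place_nu : O T -> O nu.
Proof.
move=> OT; apply: (@place_integral F L iota K O (Kgen_closed _ _ _) pO nu N
  (fun i => - embA iota psi`_i)); first exact: Kgen_snd.
  by move=> i; apply: (placeN pO); rewrite -ev1_embA; apply: (place_ev1 pO).
have := psi_nu; rewrite ev2E size_psi big_ord_recr /=.
have -> : psi`_N = 1 by have := monicP psi_monic; rewrite lead_coefE size_psi.
rewrite ev1_1 mul1r addrC => /eqP; rewrite addr_eq0 => /eqP ->.
by rewrite -sumrN; apply: eq_bigr => i _; rewrite ev1_embA mulNr.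
Qed.

Lemma place_evL a : O T -> O (evL a).
Proof. by move=> OT; apply: (place_ev2 pO) => //; apply: place_nu. Qed.

(** If each root r had some A_r vanishing at (th, r) but outside the ideal, the product of the A_r
    would be divisible by [psi_th] modulo P, so it would lie in the ideal, which is prime. *)
Lemma ideal_root : O T -> place_ideal O (embA iota P) ->
  exists2 r, root psi_th r & forall a, ev2 jO th r a = 0 -> place_ideal O (evL a).
Proof.
move=> OT MP; have cK : field_closed K := Kgen_closed _ _ _.
have mth : psi_th \is monic by apply: monic_map; apply: psi_monic.
have [rs] := closed_field_poly_normal psi_th; rewrite (monicP mth) scale1r => thE.
apply: boolp.contrapT => nex.
have cex r : exists a, root psi_th r -> ev2 jO th r a = 0 /\ ~ place_ideal O (evL a).
  have [pr|] := boolP (root psi_th r); last by exists 0.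
  apply: boolp.contrapT => na; apply: nex; exists r => // a a0.
  by apply: boolp.contrapT => nM; apply: na; exists a.
pose A r := projT1 (boolp.cid (cex r)).
have AP r : r \in rs -> ev2 jO th r (A r) = 0 /\ ~ place_ideal O (evL (A r)).
  move=> rrs; rewrite /A; case: boolp.cid => a /=; apply.
  by rewrite thE root_prod_XsubC.
have [|a' a'E] := @ker_multiple (\prod_(r <- rs) A r).
  rewrite thE rmorph_prod /= big_seq [X in _ %| X]big_seq.
  elim/big_rec2: _ => [|r y1 y2 rrs IH]; first exact: dvdpp.
  by apply: dvdp_mul => //; rewrite dvdp_XsubCl; apply/eqP; have [] := AP r rrs.
have MA : place_ideal O (\prod_(r <- rs) evL (A r)).
  have -> : \prod_(r <- rs) evL (A r) = evL (\prod_(r <- rs) A r) by rewrite rmorph_prod.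
  by rewrite a'E; apply: (pidealMr pO) => //; apply: place_evL.
have [r rrs Mr] := ideal_prod_in cK pO (fun r => Kgen_ev _ _ _ _) MA.
by have [_] := AP r rrs.
Qed.
End Classification.
End AtPrime.

(** The ideal meets A nontrivially: otherwise all nonzero elements of A are units of O, and since
    every nonzero element of A[nu] divides one of them, O would be all of K. A nonzero element of
    least degree in this intersection, made monic, is irreducible. *)
Lemma place_prime (O : L -> Prop) : is_place iota K O -> O T ->
  exists P, [/\ P \is monic, irreducible_poly P & place_ideal O (embA iota P)].
Proof.
move=> pO OT; have cK : field_closed K := Kgen_closed _ _ _.
have OA D : O (embA iota D) by rewrite -ev1_embA; apply: (place_ev1 pO).
have [D [D0 MD]] : exists D, D != 0 /\ place_ideal O (embA iota D).
  apply: boolp.contrapT => nD; have [_ [_ [u [Ku nOu]] _]] := pO; apply: nOu.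
  case: Ku => a [b [b0 ->]]; have [c' [D [D0 cD]]] := multiple_in_A b0.
  have D0' : embA iota D != 0 by apply: contraNneq D0 => /embA_inj ->.
  have Oi : O (embA iota D)^-1.
    apply: boolp.contrapT => nO; apply: nD; exists D; split=> //; split=> //.
    by right.
  have -> : evL a / evL b = evL a * evL c' * (embA iota D)^-1.
    have c'0 : evL c' != 0.
      by apply: contraNneq D0' => c'0; rewrite -cD ev2M c'0 mulr0.
    by rewrite -cD ev2M -mulf_div divff // mulr1.
  by apply: (placeM pO) => //; apply: (placeM pO); apply: place_evL.
have [n] := ubnP (size D); elim: n D D0 MD => // n IHn D D0 MD sD.
have [[E [E0 ME sE]]|nE] := boolp.pselect
  (exists E, [/\ E != 0, place_ideal O (embA iota E) & (size E < size D)%N]).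
  by apply: (IHn E) => //; apply: leq_trans sE _.
have M0 (c : F) : c != 0 -> ~ place_ideal O (embA iota c%:P).
  move=> c0 /(ideal_unitF (O := O)) H; have /eqP : embA iota c%:P = 0.
    by apply: H; rewrite -[embA iota _]/(cst (embA iota) c) -fmorphV; apply: (place_const pO).
  by rewrite -/(cst _ _) fmorph_eq0 (negbTE c0).
have lc0 : (lead_coef D)^-1 != 0 by rewrite invr_eq0 lead_coef_eq0.
have sD1 : (1 < size D)%N.
  rewrite ltnNge; apply/negP => /size1_polyC DC.
  by apply: (M0 D`_0); [rewrite -polyC_eq0 -DC|rewrite -DC].
exists ((lead_coef D)^-1 *: D); split.
- by rewrite monicE lead_coefZ mulVf // lead_coef_eq0.
- split=> [|E sE1]; first by rewrite size_scale.
  rewrite dvdpZr // => ED.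
  suff ED' : E %= D by apply: (eqp_trans ED'); rewrite eqp_sym eqp_scale.
  have E0 : E != 0 by apply: contraNneq D0 => E0; move: ED; rewrite E0 dvd0p.
  case/dvdpP: (ED) => C CE; have C0 : C != 0 by apply: contraNneq D0 => C0; rewrite CE C0 mul0r.
  have minD X : X != 0 -> place_ideal O (embA iota X) -> (size D <= size X)%N.
    by move=> X0 MX; rewrite leqNgt; apply/negP => lt; apply: nE; exists X.
  have [ME|nME] := boolp.pselect (place_ideal O (embA iota E)).
    by rewrite -dvdp_size_eqp // eqn_leq dvdp_leq // minD.
  have [E0' OE] := place_unit pO (OA E) nME.
  have MC : place_ideal O (embA iota C).
    have -> : embA iota C = embA iota D * (embA iota E)^-1 by rewrite CE rmorphM mulfK.
    exact: (pidealMr pO).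
  have := minD C C0 MC; rewrite CE size_mul // => le; case/negP: sE1.
  have sE0 : (0 < size E)%N by rewrite size_poly_gt0.
  move: le sE0; case: (size E) => [|[|k]] //.
  by rewrite !addnS => lt; have := leq_trans lt (leq_addr k (size C)); rewrite ltnn.
- rewrite -mul_polyC (rmorphM (embA iota)); exact: (pidealMl pO (OA _) MD).
Qed.
End Generator.
End CyclotomicModel.

(* [j] only records that Om contains F, which makes this a ring morphism. *)
Definition frobq (F : finFieldType) (Om : fieldType) (j : {rmorphism F -> Om}) (e : nat)
  (x : Om) : Om := x ^+ (#|F| ^ e).

Section FrobeniusMorphism.
Variables (F : finFieldType) (Om : fieldType) (j : {rmorphism F -> Om}) (e : nat).
Notation fr := (frobq j e).

Fact frobq_zmod : zmod_morphism fr.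
Proof. by move=> x y; rewrite /frobq (frobD j) (frobN j). Qed.
Fact frobq_monoid : monoid_morphism fr.
Proof. by split=> [|x y]; rewrite /frobq ?expr1n // exprMn. Qed.

HB.instance Definition _ := GRing.isZmodMorphism.Build Om Om fr frobq_zmod.
HB.instance Definition _ := GRing.isMonoidMorphism.Build Om Om fr frobq_monoid.
End FrobeniusMorphism.

Section OrbitPolynomial.
Variables (F : finFieldType) (Om : closedFieldType) (jO : {rmorphism F -> Om}).
Let q := #|F|.
Variables (th r r' : Om) (g f : nat).
Hypotheses (g_gt0 : (0 < g)%N) (f_gt0 : (0 < f)%N).
Hypotheses (th_g : th ^+ (q ^ g) = th)
           (th_i : forall i, (0 < i < g)%N -> th ^+ (q ^ i) != th).
Hypotheses (r_f : r ^+ ((q ^ g) ^ f) = r).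

Lemma ev2_at0 z a : ev2 jO z 0 a = ev1 jO z a.[0].
Proof.
rewrite ev2E horner_coef0; case sa : (size a) => [|n].
  by rewrite big_ord0 nth_default ?sa // ev1_0.
rewrite big_ord_recl expr0 mulr1 big1 ?addr0 // => i _.
by rewrite expr0n mulr0.
Qed.

Lemma ev1_surj y : y ^+ (q ^ g) = y -> exists p, ev1 jO th p = y.
Proof.
move=> yg; have [|||A <-] := @mat2poly_surj F Om jO th 0 g 1 g_gt0 isT th_g th_i _ _ y.
- by rewrite expn1 (frob0 F).
- by move=> i; case: i => [|[]].
- by rewrite muln1.
by exists (mat2poly A).[0]; rewrite ev2_at0.
Qed.

(* The minimal polynomial of [r] over F(th) has coefficients of the form [ev1 jO th _],
   so it vanishes at [r'] as well. *)
Lemma orbit_separation :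
  (forall a, ev2 jO th r a = 0 -> ev2 jO th r' a = 0) ->
  exists2 i, (i < f)%N & r' = r ^+ ((q ^ g) ^ i).
Proof.
move=> sub; pose G i := 'X - (r ^+ ((q ^ g) ^ i))%:P.
pose p : {poly Om} := \prod_(i < f) G i.
have pE : map_poly (frobq jO g) p = p.
  have G0 : G 0%N != 0 by rewrite polyXsubC_eq0.
  have frG i : map_poly (frobq jO g) (G i) = G i.+1.
    by rewrite /G map_polyXsubC; congr ('X - _%:P); rewrite expnSr exprM.
  apply: (mulfI G0); rewrite rmorph_prod.
  rewrite (eq_bigr (fun i : 'I_f => G i.+1)) => [|i _]; last exact: frG.
  transitivity (\prod_(i < f.+1) G i); first by rewrite big_ord_recl.
  by rewrite big_ord_recr mulrC; congr (_ * _); rewrite /G r_f expn0 expr1.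
have cf i : exists c, ev1 jO th c = p`_i.
  by apply: ev1_surj; rewrite -{2}pE coef_map.
pose a : {poly {poly F}} := \poly_(i < size p) projT1 (boolp.cid (cf i)).
have aE : map_poly (ev1 jO th) a = p.
  apply/polyP => i; rewrite coef_map coef_poly; case: ltnP => [_|le].
    by case: boolp.cid.
  by rewrite raddf0 nth_default.
have rp s : root p s = has (fun i : 'I_f => s == r ^+ ((q ^ g) ^ i)) (index_enum 'I_f).
  rewrite /p /G -(big_map (fun i : 'I_f => r ^+ ((q ^ g) ^ i)) predT (fun z => 'X - z%:P)).
  rewrite root_prod_XsubC; apply/mapP/hasP => [[i ii ->]|[i ii /eqP ->]]; exists i => //.
have /sub/eqP : ev2 jO th r a = 0.
  apply/eqP; rewrite -[_ == 0]/(root _ r) aE rp; apply/hasP.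
  by exists (Ordinal f_gt0); rewrite ?mem_index_enum //= expn0 expr1.
rewrite -[_ == 0]/(root _ r') aE rp => /hasP [i _ /eqP ->].
by exists i.
Qed.
End OrbitPolynomial.

(** * The totally ramified place above m *)

Section RamifiedPoint.
Variables (F : finFieldType) (L : closedFieldType).
Variable (iota : {rmorphism {fraction {poly F}} -> L}).
Variables (m : {poly F}) (m_monic : m \is monic) (m_irr : irreducible_poly m).
Variables (Om : closedFieldType) (jO : {rmorphism F -> Om}).
Variables (thm : Om) (thm_root : ev1 jO thm m = 0).
Variables (h : nat) (hq : (h %| #|F|.-1)%N) (h_gt0 : (0 < h)%N).
Notation jL := (cst (embA iota) : {rmorphism F -> L}).
Notation T := (embA iota 'X).
Notation d := (size m).-1.
Notation N := (Nh F h d).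
Notation psi := (Psi h m).
Variables (la : L) (la_neq0 : la != 0) (la_root : carl (embA iota) m la = 0).
Notation nu := (la ^+ h).
Notation evL := (ev2 jL T nu).

Lemma split_at0 (a : {poly {poly F}}) : exists a1, a = a1 * 'X + a.[0]%:P.
Proof.
have /factor_theorem [a1 a1E] : root (a - a.[0]%:P) 0.
  by rewrite rootE hornerD hornerN hornerC subrr.
by exists a1; rewrite -[X in _ * X]subr0 -polyC0 -a1E subrK.
Qed.

(** At nu this reads nu^N = - m c1(nu) with c1(nu) a local unit: nu is a uniformizer and m is an
    N-th power of it up to a unit. *)
Lemma psi_ramified : exists c1, psi = 'X^N + m *: c1 /\ c1.[0] = 1.
Proof.
have psi0 : psi.[0] = m by apply: Psi_at0.
have [|c1 c1E] := @map_poly_ker F Om (ev1 jO thm) m (ev1_dvd m_irr thm_root) (psi - 'X^N).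
  by rewrite raddfB /= (psi_bar m_monic m_irr thm_root hq h_gt0) map_polyXn subrr.
exists c1; rewrite -c1E addrC subrK; split=> //.
have := congr1 (horner^~ 0) c1E.
rewrite hornerD hornerN hornerXn expr0n eqn0Ngt (N_gt0 m_irr hq) subr0 psi0 hornerZ.
by move=> E; apply: (mulfI (monic_neq0 m_monic)); rewrite -E mulr1.
Qed.

Lemma ramified_point : good_point iota jO T nu thm 0 d.
Proof.
have psi0 : psi.[0] = m by apply: Psi_at0.
have r0 : root (map_poly (ev1 jO thm) psi) 0.
  by rewrite (psi_bar m_monic m_irr thm_root hq h_gt0) rootE hornerXn expr0n eqn0Ngt N_gt0.
have psinu := psi_nu hq la_neq0 la_root.
rewrite -[d]muln1; apply: (@good_pointP F L iota Om jO T nu thm 0 'X) => //.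
- exact: irr_deg_gt0.
- exact: (th_frob m_monic m_irr thm_root).
- exact: (th_frob_min m_monic m_irr thm_root).
- by rewrite expn1 (frob0 F).
- by case=> [|[]].
- by move=> a; apply: (phi_vanish m_monic m_irr thm_root hq h_gt0 la_neq0 la_root).
- move=> a; rewrite ev2_at0 => /eqP; rewrite (ev1_dvd m_irr thm_root) => /dvdpP [a0 a0E].
  have [a1 aE] := split_at0 a; have [p1 pE] := split_at0 psi.
  (* a = a1 X + m a0, and psi = p1 X + m gives m = - p1(nu) nu. *)
  exists 1, (a1 - p1 * a0%:P); rewrite ev2_1 oner_neq0 mul1r; split=> //.
  have mE : ev2 jL T nu m%:P = - (evL p1 * nu).
    have := psinu; rewrite pE psi0 ev2D ev2M ev2X addrC => /eqP.
    by rewrite addr_eq0 => /eqP.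
  rewrite aE a0E polyCM ev2D !ev2M mE ev2B ev2X ev2M; ring.
- move=> a /(multiple_in_A m_monic m_irr thm_root hq h_gt0 la_neq0 la_root) [c' [D [D0 cD]]].
  have [v [D1 [DE D10]]] := prime_part m_monic m_irr thm_root D0.
  have [c1 [psiE c10]] := psi_ramified.
  (* For D = m^v D1, multiplication by c1(nu)^v gives (-1)^v nu^(N v) D1. *)
  exists c', (c1 ^+ v), ((-1) ^+ v * D1%:P), (N * v)%N; split.
  + by rewrite ev2Xn ev2_at0 c10 ev1_1 expr1n oner_neq0.
  + rewrite ev2M ev2Xn ev2N ev2_1 ev2C mulf_neq0 ?expf_neq0 ?oppr_eq0 ?oner_neq0 //.
  have mE : embA iota m * evL c1 = - nu ^+ N.
    have := psinu; rewrite psiE -mul_polyC ev2D ev2M ev2C ev1_embA ev2Xn ev2X addrC => /eqP.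
    by rewrite addr_eq0 => /eqP.
  rewrite ev2M cD !ev2M !ev2Xn ev2X ev2N ev2_1 ev2C ev1_embA DE rmorphM rmorphXn.
  by rewrite mulrAC -exprMn mE exprM -mulN1r exprMn mulrCA mulrA.
- by rewrite ev2X.
- by rewrite ev2X expf_neq0.
Qed.
End RamifiedPoint.

(** * Places at infinity *)

Section CongruenceModElement.
Variables (B : comNzRingType) (tt : B).

Definition cong_mod (a b : B) : Prop := exists c, a = b + tt * c.

Lemma cong_refl a : cong_mod a a. Proof. by exists 0; rewrite mulr0 addr0. Qed.
Lemma cong_add a b a' b' : cong_mod a b -> cong_mod a' b' -> cong_mod (a + a') (b + b').
Proof. by move=> [c ->] [c' ->]; exists (c + c'); rewrite mulrDr addrACA. Qed.
Lemma cong_mul a b a' b' : cong_mod a b -> cong_mod a' b' -> cong_mod (a * a') (b * b').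
Proof.
move=> [c ->] [c' ->]; exists (b * c' + c * (b' + tt * c')); ring.
Qed.
Lemma cong_exp a b n : cong_mod a b -> cong_mod (a ^+ n) (b ^+ n).
Proof.
move=> ab; elim: n => [|n IHn]; first exact: cong_refl.
by rewrite !exprS; apply: cong_mul.
Qed.
Lemma cong_sum0 n (f : 'I_n -> B) : (forall i, cong_mod (f i) 0) -> cong_mod (\sum_i f i) 0.
Proof.
move=> h; elim/big_ind: _ => [|a b Ha Hb|//]; first exact: cong_refl.
by rewrite -[0]addr0; apply: cong_add.
Qed.
End CongruenceModElement.

Section InfinityPolynomials.
Variables (F : finFieldType) (D : nat).
Let q := #|F|.
Local Notation B := {poly {poly F}}.
Local Notation tt := (('X : {poly F})%:P : B).
Local Notation cong := (@cong_mod ({poly {poly F}} : comNzRingType) tt).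

(* [eh j] is [T^-j ec j] rewritten in t = 1/T and y = w T^(D(q-1)-1), where
   [tt] stands for t and the outer variable for y. *)
Fixpoint eh (j : nat) : B :=
  if j is k.+1 then eh k + 'X * ('X^((D - k) * q.-1))%:P * eh k ^+ q else 1.

(** T^-k [Ec a] in the same coordinates, for a of degree at most k. *)
Definition Ginf (k : nat) (a : {poly F}) : B :=
  \sum_(j < k.+1) ((a`_j)%:P * 'X^(k - j))%:P * eh j.

Lemma cong_pow n (c : B) : (0 < n)%N -> cong (('X^n)%:P * c) 0.
Proof.
case: n => // n _; exists (('X^n)%:P * c).
by rewrite add0r mulrA -polyCM -exprS.
Qed.

(** In the recursion the exponent (D - k)(q - 1) of t is positive for k < D, so modulo t nothing
    changes up to index D. Only the next step has exponent 0 and brings in y; this is why y is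
    scaled with D = deg m - 1. *)
Lemma eh_cong j : (j <= D)%N -> cong (eh j) 1.
Proof.
elim: j => [_|j IHj lt] /=; first exact: cong_refl.
rewrite -[X in cong _ X]addr0; apply: cong_add; first exact: IHj (ltnW lt).
rewrite mulrAC mulrC; apply: cong_pow.
by rewrite muln_gt0 subn_gt0 lt q1_gt0.
Qed.

Lemma eh_last_cong : cong (eh D.+1) (1 + 'X).
Proof.
rewrite /= subnn mul0n expr0 polyC1 mulr1; apply: cong_add; first exact: eh_cong.
rewrite -[X in cong _ X]mulr1; apply: cong_mul; first exact: cong_refl.
by rewrite -[X in cong _ X](expr1n _ q); apply: cong_exp; apply: eh_cong.
Qed.

Lemma Ginf_low k (a : {poly F}) : cong (\sum_(j < k) ((a`_j)%:P * 'X^(k - j))%:P * eh j) 0.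
Proof.
apply: cong_sum0 => i; rewrite mulrC polyCM mulrCA mulrC -mulrA mulrC.
rewrite -mulrA; apply: cong_pow.
by rewrite subn_gt0.
Qed.

Lemma Ginf_cong k (a : {poly F}) : (k <= D)%N -> cong (Ginf k a) ((a`_k)%:P)%:P.
Proof.
move=> kD; rewrite /Ginf big_ord_recr /= -[X in cong _ X]add0r.
apply: cong_add; first exact: Ginf_low.
rewrite subnn expr0 mulr1 -[X in cong _ X]mulr1; apply: cong_mul; first exact: cong_refl.
exact: eh_cong.
Qed.

Lemma Ginf_last_cong (a : {poly F}) : a`_D.+1 = 1 -> cong (Ginf D.+1 a) (1 + 'X).
Proof.
move=> a1; rewrite /Ginf big_ord_recr -[X in cong _ X]add0r.
apply: cong_add; first exact: Ginf_low.
rewrite subnn expr0 mulr1 /= -[D.+1 in X in cong X _]/(D.+1) a1 polyC1 polyC1 mul1r.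
exact: eh_last_cong.
Qed.

Section Evaluation.
Variables (L : fieldType) (rho : {rmorphism {poly F} -> L}).
Hypothesis T0 : rho 'X != 0.
Notation T := (rho 'X).
Notation t := (T^-1).
Notation yw w := (w * T ^+ (D * q.-1) * t).
Let ev w := ev2 (cst rho) t (yw w).

Lemma eh_ev w j : (j <= D.+1)%N -> ev w (eh j) = t ^+ j * (map_poly rho (ec F j)).[w].
Proof.
have tT n : T ^+ n * t ^+ n = 1 by rewrite -exprMn mulfV // expr1n.
elim: j => [_|j IHj lt] /=; first by rewrite /ev ev2_1 rmorph1 hornerC mulr1.
rewrite /ev ev2D !ev2M ev2Xn ev2X ev2C ev1Xn ev1X -/(ev w _) IHj ?(ltnW lt) //.
rewrite rmorphD !rmorphM rmorphXn /= map_polyX map_polyC /=.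
rewrite hornerD !hornerM horner_exp hornerX hornerC addrC.
set e := (map_poly rho (ec F j)).[w]; set n := (D - j)%N.
rewrite mulrDr; congr (_ + _); last by rewrite exprSr -!mulrA mulKf.
have -> : T ^+ (D * q.-1) = T ^+ (n * q.-1) * T ^+ (j * q.-1).
  by rewrite -exprD -mulnDl subnK.
rewrite exprMn -exprM.
have -> : t ^+ (j * q) = t ^+ (j * q.-1) * t ^+ j.
  by rewrite -exprD -{3}[j]muln1 -mulnDr addn1 (q1K F).
transitivity (t ^+ j.+1 * (w * e ^+ q) * (T ^+ (n * q.-1) * t ^+ (n * q.-1)) *
   (T ^+ (j * q.-1) * t ^+ (j * q.-1))); last by rewrite !tT !mulr1.
rewrite exprS.
set x1 := T ^+ _; set x2 := t ^+ _; set x3 := T ^+ _; set x4 := t ^+ _; set x5 := t ^+ j.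
set x6 := e ^+ q; set x7 := t; ring.
Qed.

Lemma Ginf_ev w k (a : {poly F}) : (k <= D.+1)%N -> (size a <= k.+1)%N ->
  ev w (Ginf k a) = t ^+ k * (map_poly rho (Ec a)).[w].
Proof.
move=> kD sa; rewrite /ev /Ginf rmorph_sum /=.
have -> : Ec a = \sum_(j < k.+1) (a`_j)%:P *: ec F j.
  rewrite /Ec (big_ord_widen _ (fun j => (a`_j)%:P *: ec F j) sa) big_mkcond /=.
  apply: eq_bigr => i _; case: ltnP => // le.
  by rewrite nth_default // polyC0 scale0r.
rewrite rmorph_sum horner_sum mulr_sumr; apply: eq_bigr => j _ /=.
have jk : (j <= k)%N by rewrite -ltnS.
rewrite ev2M ev2C ev1M ev1C ev1Xn ev1X -/(ev w _) eh_ev ?(leq_trans jk) //.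
rewrite -mul_polyC rmorphM /= map_polyC hornerM hornerC.
have -> : t ^+ k = t ^+ (k - j) * t ^+ j by rewrite -exprD subnK.
by rewrite [cst rho _ * _]mulrC mulrACA.
Qed.
End Evaluation.
End InfinityPolynomials.

Section InfinityCoordinates.
Variables (F : finFieldType) (L : closedFieldType).
Variable (iota : {rmorphism {fraction {poly F}} -> L}).
Variables (m : {poly F}) (m_monic : m \is monic) (m_irr : irreducible_poly m).
Variables (h : nat) (hq : (h %| #|F|.-1)%N) (h_gt0 : (0 < h)%N).
Let q := #|F|.
Notation jL := (cst (embA iota) : {rmorphism F -> L}).
Notation T := (embA iota 'X).
Notation t := (T^-1).
Notation d := (size m).-1.
Notation D := ((size m).-1.-1).
Notation gp := (q.-1 %/ h)%N.

Definition yw (w : L) : L := w * T ^+ (D * q.-1) * t.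
Definition yinf (la : L) : L := yw (la ^+ q.-1).
(** At the place where y has residue -1 this is a uniformizer: y z^gp = t, so that gp = (q - 1) / h
    is the ramification index over infinity. *)
Definition zinf (la : L) : L := (t ^+ D / la) ^+ h.

Lemma dD : D.+1 = d. Proof. by rewrite prednK // irr_deg_gt0. Qed.
Lemma T_neq0 : T != 0.
Proof. by apply/eqP => /embA_inj /eqP; rewrite polyX_eq0. Qed.
Lemma t_neq0 : t != 0. Proof. by rewrite invr_eq0 T_neq0. Qed.
Lemma gp_gt0 : (0 < gp)%N.
Proof. by rewrite divn_gt0 // dvdn_leq // q1_gt0. Qed.

Section Root.
Variables (la : L) (la0 : la != 0).
Lemma yinf_neq0 : yinf la != 0.
Proof. by rewrite /yinf /yw !mulf_neq0 ?expf_neq0 ?T_neq0 ?t_neq0. Qed.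
Lemma zinf_neq0 : zinf la != 0.
Proof. by rewrite /zinf expf_neq0 // mulf_neq0 ?expf_neq0 ?t_neq0 // invr_eq0. Qed.
Lemma yz_t : yinf la * zinf la ^+ gp = t.
Proof.
have la0' : la ^+ q.-1 != 0 by rewrite expf_neq0.
have TT : T ^+ (D * q.-1) != 0 by rewrite expf_neq0 ?T_neq0.
have -> : zinf la ^+ gp = (T ^+ (D * q.-1))^-1 / la ^+ q.-1.
  by rewrite /zinf -exprM [(h * _)%N]mulnC divnK // expr_div_n -exprM exprVn.
rewrite /yinf /yw; set u := la ^+ _ in la0' *; set v := T ^+ _ in TT *.
by rewrite mulrAC [u * v * _]mulrC mulrA divfK // mulVf // mul1r.
Qed.
End Root.

(** For w = lambda^(q-1) with lambda a nonzero torsion point the left side is 0, so y is congruent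
    to -1 modulo t wherever t and y are integral. *)
Lemma Ginf_spec : exists G1, forall w,
  t ^+ d * (map_poly (embA iota) (Ec m)).[w] = 1 + yw w + t * ev2 jL t (yw w) G1.
Proof.
have [|G1 G1E] := @Ginf_last_cong F D m.
  by rewrite dD; have := monicP m_monic; rewrite lead_coefE.
exists G1 => w.
have := @Ginf_ev F D L (embA iota) T_neq0 w D.+1 m (leqnn _).
rewrite dD prednK ?size_poly_gt0 ?monic_neq0 // => /(_ (leqnn _)) <-.
rewrite -dD G1E -/(yw w) ev2D ev2M ev2D ev2_1 ev2X ev2C ev1X.
by [].
Qed.

(* [prod_w (1 + 1/y_w) = Ginf(t,-1) / Ginf(t,0)] lies in the ideal of t. *)
Lemma infinity_root (K O : L -> Prop) : field_closed K -> is_place iota K O ->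
  (forall la, la != 0 -> carl (embA iota) m la = 0 -> K (yinf la)) ->
  K T -> place_ideal O t ->
  exists la, [/\ la != 0, carl (embA iota) m la = 0 & place_ideal O (yinf la + 1)].
Proof.
move=> cK pO Ky KT Mt; have [G1 GE] := Ginf_spec.
have Ot : O t by apply: ideal_place Mt.
have OJ c : O (jL c) by apply: (place_const pO).
have cong1 y : O y -> place_ideal O (t * ev2 jL t y G1).
  by move=> Oy; apply: (pidealMr pO) => //; apply: (place_ev2 pO).
set E := map_poly (embA iota) (Ec m).
have mE : E \is monic by apply: monic_map; have [] := Ec_spec m_monic.
have [ws] := closed_field_poly_normal E; rewrite (monicP mE) scale1r => EE.
have E0 : E.[0] = embA iota m.
  by rewrite horner_coef0 coef_map -horner_coef0 Ec_at0.
have m0 : embA iota m != 0 by apply: contraNneq (monic_neq0 m_monic) => /embA_inj ->.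
have w0 w : w \in ws -> w != 0.
  move=> ww; have Ew : E.[w] = 0 by apply/rootP; rewrite EE root_prod_XsubC.
  by apply: contraNneq m0 => wz; rewrite -E0 -[X in E.[X]]wz Ew.
have wla w : w \in ws -> exists la, [/\ la != 0, carl (embA iota) m la = 0 & la ^+ q.-1 = w].
  move=> ww; have /closed_rootP [la] : size ('X^(q.-1) - w%:P) != 1.
    by rewrite size_XnsubC ?q1_gt0 // eqSS -lt0n q1_gt0.
  rewrite rootE hornerD hornerN hornerXn hornerC subr_eq0 => /eqP law; exists la; split=> //.
    by apply: contraNneq (w0 w ww) => la0; rewrite -law la0 expr0n eqn0Ngt q1_gt0.
  rewrite carl_Ec law; have : root E w by rewrite EE root_prod_XsubC.
  by rewrite rootE => /eqP ->; rewrite mulr0.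
have t0 := t_neq0; have T0 := T_neq0.
pose w1 := - (T / T ^+ (D * q.-1)).
have TT : T ^+ (D * q.-1) != 0 by rewrite expf_neq0.
have y1 : yw w1 = -1 by rewrite /yw /w1 mulNr divfK // mulNr mulfV.
have y0 : yw 0 = 0 by rewrite /yw !mul0r.
have prodE : \prod_(w <- ws) (1 + (yw w)^-1) = E.[w1] / E.[0].
  rewrite EE !horner_prod -prodf_div big_seq [RHS]big_seq; apply: eq_bigr => w ww.
  rewrite !hornerXsubC; have aux (u V X : L) : u != 0 -> V != 0 -> X != 0 ->
      1 + (u * V * X^-1)^-1 = (- (X / V) - u) / (0 - u).
    move=> u0 V0 X0; have u0' : 0 - u != 0 by rewrite sub0r oppr_eq0.
    have E1 : (u * V * X^-1)^-1 * u = X / V.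
      by rewrite !invfM invrK mulrC !mulrA mulfV // mul1r mulrC.
    by apply: (mulIf u0'); rewrite divfK // sub0r mulrN mulrDl mul1r E1 opprD addrC.
  exact: aux (w0 w ww) TT T0.
have Mprod : place_ideal O (\prod_(w <- ws) (1 + (yw w)^-1)).
  have e1 := GE w1; have e0 := GE 0; rewrite -/E y1 in e1; rewrite -/E y0 addr0 in e0.
  rewrite addrN add0r in e1.
  have Onum : place_ideal O (t ^+ d * E.[w1]).
    by rewrite e1; apply: cong1; rewrite -[-1](rmorphN1 jL).
  have nden : ~ place_ideal O (t ^+ d * E.[0]).
    rewrite e0 => M1; apply: (ideal_neq1 pO).
    have -> : 1 = 1 + t * ev2 jL t 0 G1 - t * ev2 jL t 0 G1 by rewrite addrK.
    by apply: (pidealB cK pO) => //; apply: cong1; apply: (place0 pO).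
  have Oden : O (t ^+ d * E.[0]).
    rewrite e0; apply: (placeD pO); first exact: (place1 pO).
    by apply: ideal_place; apply: cong1; apply: (place0 pO).
  have [_ Oinv] := place_unit pO Oden nden.
  have := pidealMr pO Onum Oinv.
  rewrite prodE invfM mulrACA divff ?mul1r //.
  by rewrite expf_neq0.
have Kyw w : w \in ws -> K (yw w).
  by move=> /wla [la [la0 cla <-]]; apply: Ky.
have [w ww Mw] : exists2 w, w \in ws & place_ideal O (1 + (yw w)^-1).
  pose f w := if w \in ws then 1 + (yw w)^-1 else 1.
  have fE : \prod_(w <- ws) (1 + (yw w)^-1) = \prod_(w <- ws) f w.
    by rewrite big_seq [RHS]big_seq; apply: eq_bigr => w ww; rewrite /f ww.
  have Kf w : K (f w).
    rewrite /f; case: ifP => [ww|_]; last exact: (fc1 cK).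
    by apply: (fcD cK); [apply: (fc1 cK)|apply: (fcV cK); apply: Kyw].
  rewrite fE in Mprod; have [w ww] := ideal_prod_in cK pO Kf Mprod.
  by rewrite /f ww; exists w.
have [la [la0 cla law]] := wla w ww; exists la; split=> //.
have yn0 : yw w != 0 by rewrite -law; apply: yinf_neq0.
rewrite /yinf law; set y := yw w in yn0 Mw *.
have Oyi : O y^-1.
  have -> : y^-1 = 1 + y^-1 - 1 by rewrite addrAC subrr add0r.
  by apply: (placeB pO); [apply: ideal_place|apply: (place1 pO)].
have [|_ Oy] := place_unit pO Oyi.
  move=> My; apply: (ideal_neq1 pO).
  have -> : 1 = 1 + y^-1 - y^-1 by rewrite addrK.
  exact: (pidealB cK pO).
rewrite invrK in Oy.
have -> : y + 1 = y * (1 + y^-1) by rewrite mulrDr mulr1 mulfV.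
exact: (pidealMl pO).
Qed.
End InfinityCoordinates.

Section InfinityPoints.
Variables (F : finFieldType) (L : closedFieldType).
Variable (iota : {rmorphism {fraction {poly F}} -> L}).
Hypothesis L_alg : forall x : L, exists P : {poly {fraction {poly F}}},
  P != 0 /\ root (map_poly iota P) x.
Variables (m : {poly F}) (m_monic : m \is monic) (m_irr : irreducible_poly m).
Variables (Om : closedFieldType) (jO : {rmorphism F -> Om}).
Variables (thm : Om) (thm_root : ev1 jO thm m = 0).
Variables (h : nat) (hq : (h %| #|F|.-1)%N) (h_gt0 : (0 < h)%N).
Let q := #|F|.
Notation jL := (cst (embA iota) : {rmorphism F -> L}).
Notation T := (embA iota 'X).
Notation t := (T^-1).
Notation d := (size m).-1.
Notation D := ((size m).-1.-1).
Notation gp := (q.-1 %/ h)%N.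
Notation croot la := (la != 0 /\ carl (embA iota) m la = 0).
Notation z la := (zinf iota m h la).
Notation y la := (yinf iota m la).
Notation Kh la := (Kgen jL T (la ^+ h)).
Let gp0 : (0 < gp)%N := gp_gt0 hq h_gt0.
Let T0 : T != 0 := T_neq0 iota.
Let t0 : t != 0 := t_neq0 iota.

Lemma Kgen_root la la' : croot la -> croot la' -> Kh la (la' ^+ h).
Proof.
move=> [la0 cla] [la'0 cla'].
have [a _ ->] := carl_roots m_monic m_irr la0 cla cla'.
rewrite (carl_Psi _ _ _ hq) exprMn; have cK := Kgen_closed jL T (la ^+ h).
apply: (fcM cK); first exact: Kgen_snd.
by apply: (fcX cK); rewrite -ev2_embA; apply: Kgen_ev.
Qed.

Lemma Kgen_root_eq la la' : croot la -> croot la' -> Kh la = Kh la'.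
Proof.
by move=> cl cl'; apply: Kgen_eq; rewrite ?Kgen_fst //;
  [apply: Kgen_fst|apply: Kgen_root|apply: Kgen_fst|apply: Kgen_root].
Qed.

Lemma nu_z la : la != 0 -> la ^+ h = (t ^+ D) ^+ h / z la.
Proof.
move=> la0; rewrite /zinf expr_div_n invfM invrK mulrA divff ?mul1r //.
by rewrite !expf_neq0.
Qed.

Lemma Kgen_inf la : la != 0 -> Kgen jL (z la) (y la) = Kh la.
Proof.
move=> la0; apply: Kgen_eq.
- have cK := Kgen_closed jL (z la) (y la).
  rewrite -[T]invrK -(yz_t iota m hq la0); apply: (fcV cK).
  by apply: (fcM cK); [apply: Kgen_snd|apply: (fcX cK); apply: Kgen_fst].
- have cK := Kgen_closed jL (z la) (y la).
  rewrite (nu_z la0) -(yz_t iota m hq la0); apply: (fc_div cK); last exact: Kgen_fst.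
  do 2 apply: (fcX cK).
  by apply: (fcM cK); [apply: Kgen_snd|apply: (fcX cK); apply: Kgen_fst].
- have cK := Kgen_closed jL T (la ^+ h).
  rewrite /zinf expr_div_n; apply: (fc_div cK); last exact: Kgen_snd.
  by do 2 apply: (fcX cK); apply: (fcV cK); apply: Kgen_fst.
- have cK := Kgen_closed jL T (la ^+ h).
  rewrite /yinf /yw -(divnK hq) mulnC exprM.
  apply: (fcM cK); last by apply: (fcV cK); apply: Kgen_fst.
  by apply: (fcM cK); apply: (fcX cK); [apply: Kgen_snd|apply: Kgen_fst].
Qed.

Lemma croot_sym la la' a : croot la -> croot la' ->
  ev2 jL T la a = 0 -> ev2 jL T la' a = 0.
Proof.
move=> [la0 cla] [la'0 cla']; have h1 : (1 %| #|F|.-1)%N by rewrite dvd1n.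
rewrite -{1}[la]expr1 -{1}[la']expr1.
move/(rel_dvd m_monic m_irr thm_root h1 isT la0 cla) => [c ->].
by rewrite ev2M (psi_nu h1 la'0 cla') mulr0.
Qed.

Section Substitution.
Let AX : comNzRingType := {poly {poly F}}.
Let jC : {rmorphism F -> AX} := (@polyC {poly F} \o @polyC F : {rmorphism F -> AX}).

(* Substitution t = y z^gp, with z the inner and y the outer variable. *)
Definition tsub (a : {poly {poly F}}) : {poly {poly F}} :=
  @ev2 F AX jC ('X * ('X^gp)%:P) 'X a.

Lemma tsub_ev (E : comNzRingType) (j : {rmorphism F -> E}) s x a :
  ev2 j s x (tsub a) = ev2 j (x * s ^+ gp) x a.
Proof.
have H c : ev2 j s x (jC c) = j c by rewrite /= ev2C ev1C.
rewrite /tsub (@ev2_morph F AX E jC j (ev2 j s x) _ _ a H) /=.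
by rewrite ev2M ev2X ev2C ev1Xn ev1X.
Qed.
End Substitution.

(** The elements with this property form a ring. It contains the constants, T = 1/t, and nu, which
    is a power of t divided by z, because 1/z = y z^(gp-1) / t. Allowing every large M lets the
    exponents be added. *)
Lemma clear_denominators la (be : {poly {poly F}}) : la != 0 ->
  exists M0, forall M, (M0 <= M)%N ->
    exists c, t ^+ M * ev2 jL T (la ^+ h) be = ev2 jL (z la) (y la) c.
Proof.
move=> la0; have yz := yz_t iota m hq la0.
pose S u := exists M0, forall M, (M0 <= M)%N ->
  exists c, t ^+ M * u = ev2 jL (z la) (y la) c.
have tE n : t ^+ n = ev2 jL (z la) (y la) (tsub ('X^n)%:P).
  by rewrite tsub_ev yz ev2C ev1Xn ev1X.
have SM u v : S u -> S v -> S (u * v).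
  move=> [M1 h1] [M2 h2]; exists (M1 + M2)%N => M le.
  have [c1 c1E] := h1 M1 (leqnn _).
  have [|c2 c2E] := h2 (M - M1)%N; first by rewrite leq_subRL ?(leq_trans _ le) ?leq_addr.
  exists (c1 * c2); rewrite ev2M -c1E -c2E mulrACA -exprD subnKC //.
  by rewrite (leq_trans _ le) ?leq_addr.
have SD u v : S u -> S v -> S (u + v).
  move=> [M1 h1] [M2 h2]; exists (M1 + M2)%N => M le.
  have [|c1 c1E] := h1 M; first by rewrite (leq_trans _ le) ?leq_addr.
  have [|c2 c2E] := h2 M; first by rewrite (leq_trans _ le) ?leq_addl.
  by exists (c1 + c2); rewrite mulrDr c1E c2E ev2D.
have Sc c : S (jL c).
  exists 0%N => M _; exists (tsub ('X^M)%:P * (c%:P)%:P).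
  by rewrite ev2M -tE ev2C ev1C.
have S0 : S 0 by rewrite -(rmorph0 jL).
have S1 : S 1 by rewrite -(rmorph1 jL).
have SX u n : S u -> S (u ^+ n).
  by move=> Su; elim: n => // n IHn; rewrite exprS; apply: SM.
have ST : S T.
  exists 1%N => -[//|M] _; exists (tsub ('X^M)%:P).
  by rewrite -tE exprSr mulfVK.
have Sz : S (z la)^-1.
  exists 1%N => -[//|M] _; exists (tsub ('X^M)%:P * ('X * ('X^(gp.-1))%:P)).
  rewrite ev2M -tE ev2M ev2X ev2C ev1Xn ev1X exprSr -mulrA; congr (_ * _).
  by rewrite -{1}yz -mulrA; congr (_ * _); rewrite -{1}(prednK gp0) exprSr mulfK ?zinf_neq0.
have St n : S (t ^+ n).
  by exists 0%N => M _; exists (tsub ('X^(M + n))%:P); rewrite -exprD tE.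
have Snu : S (la ^+ h) by rewrite (nu_z la0); apply: SM => //; apply: SX.
suff : S (ev2 jL T (la ^+ h) be) by [].
rewrite ev2E; apply: (big_ind S) => // i _; apply: (SM); last exact: SX.
by rewrite ev1E; apply: (big_ind S) => // k _; apply: (SM) => //; apply: SX.
Qed.

Lemma reciprocal (u v : L) (p : {poly F}) : u * v = 1 -> p != 0 ->
  exists p' : {poly F}, u ^+ (size p).-1 * ev1 jL v p = ev1 jL u p' /\ p'.[0] != 0.
Proof.
move=> uv p0; set k := (size p).-1.
have sp : size p = k.+1 by rewrite prednK // size_poly_gt0.
exists (\sum_(i < k.+1) p`_i *: 'X^(k - i)); split.
  rewrite ev1E sp mulr_sumr rmorph_sum; apply: eq_bigr => i _ /=.
  rewrite -mul_polyC ev1M ev1C ev1Xn ev1X mulrCA; congr (_ * _).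
  have ik : (i <= k)%N by rewrite -ltnS.
  by rewrite -{1}(subnK ik) exprD -mulrA -exprMn uv expr1n mulr1.
rewrite big_ord_recr /= subnn expr0 hornerD horner_sum big1 ?add0r => [|i _].
  by rewrite hornerZ hornerC mulr1 -[p`_k]/(lead_coef p) lead_coef_eq0.
by rewrite hornerZ hornerXn expr0n subn_eq0 leqNgt ltn_ord mulr0.
Qed.

Lemma t_transcendental p : ev1 jL t p = 0 -> p = 0.
Proof.
move=> pt; apply/eqP; apply: contraT => p0.
have [p' []] := reciprocal (mulfV T0) p0.
by rewrite pt mulr0 ev1_embA => /esym/embA_inj ->; rewrite horner0 eqxx.
Qed.

(** The place t |-> 0 of F[t] extends to all of [L]. Applied with K = L, [infinity_root] gives a
    torsion point with y |-> -1, and z^gp = t / y forces z |-> 0. *)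
Lemma infinity_hom_exists : exists2 la, croot la &
  forall a, ev2 jL (z la) (y la) a = 0 -> ev2 jO 0 (-1) a = 0.
Proof.
pose R := (L * Om)%type.
pose G0 (u : R) := exists p, u = (ev1 jL t p, ev1 jO 0 p).
have gG0 : hom_graph G0.
  split.
  - by exists 1; rewrite !ev1_1.
  - by move=> _ _ [a ->] [b ->]; exists (a - b); rewrite !ev1B.
  - by move=> _ _ [a ->] [b ->]; exists (a * b); rewrite !ev1M.
  - by move=> b [a [/esym/t_transcendental -> ->]]; rewrite ev1_0.
have [G [subG [G1 GB GM Gf] Ginv Gval]] := place_extension gG0.
have Gc c : G (jL c, jO c) by apply: subG; exists c%:P; rewrite !ev1C.
have Gt : G (t, 0) by apply: subG; exists 'X; rewrite !ev1X.
have G0' : G 0 by rewrite -(subrr 1); apply: GB.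
have GD u v : G u -> G v -> G (u + v).
  by move=> Gu Gv; rewrite -[v]opprK -[- v]sub0r; apply: (GB _ _ Gu); apply: GB.
have GX u n : G u -> G (u ^+ n).
  by move=> Gu; elim: n => // n IHn; rewrite exprS; apply: GM.
pose O u := exists v, G (u, v).
have nGT v : ~ G (T, v).
  move=> GT; have := GM _ _ GT Gt.
  have -> : (T, v) * (t, 0) = (1, 0) :> R by apply/eqP; rewrite xpair_eqE /= mulfV // mulr0 !eqxx.
  move=> /(GB _ _ G1); rewrite [X in G X](_ : _ = (0, 1)).
    by move/Gf/eqP; rewrite oner_eq0.
  by apply/eqP; rewrite xpair_eqE /= subrr subr0 !eqxx.
have pO : is_place iota (fun=> True) O.
  split; split=> //.
  - by exists 0.
  - by exists 1.
  - by move=> u v [u' Gu] [v' Gv]; exists (u' - v'); apply: (GB _ _ Gu Gv).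
  - by move=> u v [u' Gu] [v' Gv]; exists (u' * v'); apply: (GM _ _ Gu Gv).
  - by move=> c; exists (jO c); apply: Gc.
  - by exists T; split=> // -[v /nGT].
  - move=> u _ u0; have [Ou|[_ Gu]] := Gval u; first by left.
    by right; exists 0.
have ideal0 u : place_ideal O u -> G (u, 0).
  move=> [[v Gv]]; have [v0|v0] := eqVneq v 0; first by rewrite v0 in Gv.
  have [u0 Gi] := Ginv _ _ Gv v0.
  by case=> [/eqP|]; [rewrite (negbTE u0)|case; exists v^-1].
have Mt : place_ideal O t.
  split; first by exists 0.
  by right; rewrite invrK => -[v /nGT].
have [|la [la0 cla My]] := @infinity_root F L iota m m_monic m_irr (fun=> True) O _ pO
    (fun _ _ _ => I) I Mt; first by [].
exists la => // a az.
have Gy1 : G (y la, -1).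
  have := GB _ _ (ideal0 _ My) G1; rewrite [X in G X](_ : _ = (y la, -1)) //.
  by apply/eqP; rewrite xpair_eqE /= addrK sub0r !eqxx.
have Gz : G (z la, 0).
  apply: ideal0; apply: (@pidealXn F L iota _ O pO (z la) gp) => //.
  have yn0 := yinf_neq0 iota m la0.
  have -> : z la ^+ gp = t * (y la)^-1.
    by rewrite -(yz_t iota m hq la0) mulrC mulrA mulVf // mul1r.
  apply: (pidealMr pO) => //; have [|_ Gyi] := Ginv _ _ Gy1; last by exists (-1)^-1.
  by rewrite oppr_eq0 oner_eq0.
have key : G (ev2 jL (z la) (y la) a, ev2 jO 0 (-1) a).
  have GS n (f : 'I_n -> R) : (forall i, G (f i)) -> G (\sum_i f i).
    by move=> Gf'; elim/big_ind: _ => //; apply: GD.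
  have pr n (f : 'I_n -> L) (g : 'I_n -> Om) :
      (\sum_i f i, \sum_i g i) = \sum_i ((f i, g i) : R).
    rewrite [RHS]surjective_pairing (raddf_sum (fst : {additive R -> L})).
    by rewrite (raddf_sum (snd : {additive R -> Om})).
  have prX u v n : (u ^+ n, v ^+ n) = (u, v) ^+ n :> R.
    by elim: n => // n IHn; rewrite !exprS -IHn.
  rewrite !ev2E pr; apply: (GS) => i.
  apply: (GM (ev1 jL (z la) a`_i, ev1 jO 0 a`_i) (_, _)); last by rewrite prX; apply: GX.
  rewrite !ev1E pr; apply: GS => k.
  by have := GM _ _ (Gc (a`_i)`_k) (GX _ k Gz); rewrite -prX.
by apply: Gf; rewrite -az.
Qed.

Lemma split_infinity (a : {poly {poly F}}) : exists A2 A1 c,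
  a = A2 * ('X + 1) + (A1 * 'X + c%:P)%:P /\ ev2 jO 0 (-1) a = jO c.
Proof.
have /factor_theorem [A2 A2E] : root (a - a.[-1]%:P) (-1).
  by rewrite rootE hornerD hornerN hornerC subrr.
have /factor_theorem [A1 A1E] : root (a.[-1] - (a.[-1]).[0]%:P) 0.
  by rewrite rootE hornerD hornerN hornerC subrr.
set c := (a.[-1]).[0] in A1E.
have aE : a = A2 * ('X + 1) + (A1 * 'X + c%:P)%:P.
  have -> : A1 * 'X + c%:P = a.[-1] by rewrite -['X]subr0 -polyC0 -A1E subrK.
  have -> : 'X + 1 = 'X - (-1)%:P :> {poly {poly F}} by rewrite polyCN opprK.
  by rewrite -A2E subrK.
exists A2, A1, c; split=> //; rewrite [in LHS]aE ev2D ev2M ev2D ev2X ev2_1 addNr mulr0 add0r.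
by rewrite ev2C ev1D ev1M ev1X mulr0 add0r ev1C.
Qed.

Section AtRoot.
Variables (la : L) (cla : croot la).
Let la0 : la != 0 := proj1 cla.
Notation evi := (ev2 jL (z la) (y la)).
Notation phi := (ev2 jO 0 (-1)).

(** Consistency is known at one torsion point la1 only. An endomorphism of [L] over k that sends la
    to la1 carries every relation between z and y at la to the same relation at la1. *)
Lemma infinity_G1 a : evi a = 0 -> phi a = 0.
Proof.
move=> az; have [la1 cla1 H1] := infinity_hom_exists.
have [sigma [sk sla]] := conjugation L_alg (fun b => @croot_sym la la1 b cla cla1).
apply: H1; have sj c : sigma (jL c) = jL c by apply: sk.
have sT : sigma T = T by apply: sk.
have := congr1 sigma az; rewrite rmorph0 (ev2_morph _ _ _ sj) => <-; congr ev2.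
  by rewrite /zinf !(rmorphXn, rmorphM, fmorphV) sT sla.
by rewrite /yinf /yw !(rmorphXn, rmorphM, fmorphV) sT sla.
Qed.

Lemma infinity_H1 a : phi a = 0 ->
  exists b a' : {poly {poly F}}, phi b != 0 /\ evi (b * a) = evi (('X)%:P * a').
Proof.
have [G1 GE] := Ginf_spec iota m_monic m_irr.
have yE : y la + 1 = - (t * ev2 jL t (y la) G1).
  apply/eqP; rewrite -addr_eq0 [y la + 1]addrC /yinf.
  have := GE (la ^+ q.-1); have [_] := cla; rewrite carl_Ec.
  by move/eqP; rewrite mulf_eq0 (negbTE la0) => /eqP -> <-; rewrite mulr0.
have [A2 [A1 [c [aE ->]]]] := split_infinity a.
move/eqP; rewrite fmorph_eq0 => /eqP c0.
(* Since y + 1 = - t G1(t, y) and t = y z^gp, the part A2 (y + 1) is a multiple of z too. *)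
exists 1, (A1%:P - A2 * 'X * ('X^(gp.-1))%:P * tsub G1); rewrite ev2_1 oner_neq0 mul1r.
split=> //; rewrite aE c0 addr0 ev2D ev2M ev2D ev2X ev2_1 yE ev2C ev1M ev1X.
rewrite ev2M ev2C ev1X ev2B ev2C !ev2M ev2X ev2C ev1Xn ev1X tsub_ev yz_t //.
set g1 := ev2 _ t _ G1; set u1 := ev1 _ _ A1; set u2 := evi A2.
rewrite -{1}(yz_t iota m hq la0) -{1}(prednK gp0) exprS.
by set zz := z la; set yy := y la; set zp := zz ^+ _; ring.
Qed.

(** Write 1/a = be / al and let A = al al' be a multiple of al in F[T]. Then a times t^M be al' is
    t^M A = t^M0 A'(t), where A' is A with its coefficients reversed, so A'(0) is nonzero; and t = y
    z^gp. *)
Lemma infinity_H2 a : evi a != 0 -> exists (c' b c : {poly {poly F}}) (n : nat),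
  [/\ phi b != 0, phi c != 0 & evi (a * c' * b) = evi (('X)%:P ^+ n * c)].
Proof.
move=> a0; have [_ cl] := cla.
have : Kgen jL T (la ^+ h) (evi a)^-1.
  rewrite -Kgen_inf //; apply: (fcV (Kgen_closed _ _ _)); exact: Kgen_ev.
case=> be [al [al0 E0]].
have E : (evi a)^-1 = ev2 jL T (la ^+ h) be / ev2 jL T (la ^+ h) al := E0.
have [al' [A [A0 alE]]] := multiple_in_A m_monic m_irr thm_root hq h_gt0 la0 cl al0.
have [A' [A'E A'0]] := reciprocal (mulVf T0) A0; rewrite ev1_embA in A'E.
have [M0 MH] := clear_denominators (be * al') la0.
set k := (size A).-1 in A'E; pose M := (M0 + k)%N.
have [|c cE] := MH M; first exact: leq_addr.
exists c, 1, ('X ^+ M0 * tsub A'%:P), (gp * M0)%N; split.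
- by rewrite ev2_1 oner_neq0.
- rewrite ev2M ev2Xn ev2X tsub_ev ev2C expr0n eqn0Ngt gp0 mulr0 mulf_neq0 //.
    by rewrite expf_neq0 // oppr_eq0 oner_neq0.
  by rewrite /ev1 horner_coef0 coef_map fmorph_eq0 -horner_coef0.
rewrite mulr1 ev2M -cE !ev2M !ev2Xn ev2X ev2C ev1X tsub_ev ev2C yz_t // -A'E -alE ev2M.
have -> : evi a = ev2 jL T (la ^+ h) al / ev2 jL T (la ^+ h) be by rewrite -invf_div -E invrK.
have be0 : ev2 jL T (la ^+ h) be != 0.
  by apply: contraNneq a0 => be0; move/eqP: E; rewrite be0 mul0r invr_eq0.
have -> : z la ^+ (gp * M0) = (t / y la) ^+ M0.
  by rewrite exprM; congr (_ ^+ _); rewrite -(yz_t iota m hq la0) mulrC mulrA mulVf ?mul1r // yinf_neq0.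
have ty : (t / y la) ^+ M0 * y la ^+ M0 = t ^+ M0 by rewrite -exprMn divfK // yinf_neq0.
rewrite [RHS]mulrA ty /M exprD.
set x1 := ev2 _ _ _ al; set x2 := ev2 _ _ _ be in be0 *; set x3 := ev2 _ _ _ al'.
have -> : x1 / x2 * (t ^+ M0 * t ^+ k * (x2 * x3)) = x1 / x2 * x2 * (t ^+ M0 * t ^+ k * x3).
  by rewrite -!mulrA; congr (_ * (_ * _)); rewrite [RHS]mulrCA; congr (_ * _); rewrite mulrCA.
by rewrite divfK //; set x4 := t ^+ M0; set x5 := t ^+ k; ring.
Qed.

Lemma infinity_point : good_point iota jO (z la) (y la) 0 (-1) 1.
Proof.
rewrite -[1%N]/(1 * 1)%N.
apply: (@good_pointP F L iota Om jO (z la) (y la) 0 (-1) ('X)%:P) => //.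
- by rewrite (frob0 F).
- by case=> [|[]].
- by rewrite expn1 (frobN jO) expr1n.
- by case=> [|[]].
- exact: infinity_G1.
- exact: infinity_H1.
- exact: infinity_H2.
- by rewrite ev2C ev1X.
- by rewrite ev2C ev1X zinf_neq0.
Qed.
End AtRoot.
End InfinityPoints.

(** * Generators of the cyclotomic fields *)

Section CyclotomicFields.
Variables (F : finFieldType) (L : closedFieldType).
Variable (iota : {rmorphism {fraction {poly F}} -> L}).
Hypothesis L_alg : forall x : L, exists P : {poly {fraction {poly F}}},
  P != 0 /\ root (map_poly iota P) x.
Variables (m : {poly F}) (m_monic : m \is monic) (m_irr : irreducible_poly m).
Variables (Om : closedFieldType) (jO : {rmorphism F -> Om}).
Variables (thm : Om) (thm_root : ev1 jO thm m = 0).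
Let q := #|F|.
Notation jL := (cst (embA iota) : {rmorphism F -> L}).
Notation T := (embA iota 'X).
Notation t := (T^-1).
Notation d := (size m).-1.
Notation D := ((size m).-1.-1).
Notation croot la := (la != 0 /\ carl (embA iota) m la = 0).

Lemma fexp1 (c : F) : c != 0 -> c ^+ q.-1 = 1.
Proof. by move=> c0; apply: (mulfI c0); rewrite -exprS (q1K F) mulr1 expf_card. Qed.

Lemma croot_exists : exists la, croot la.
Proof.
have h1 : (1 %| #|F|.-1)%N by rewrite dvd1n.
have [mP sP] := Psi_spec h1 isT m_monic.
have /closed_rootP [la ra] : size (map_poly (embA iota) (Psi 1 m)) != 1.
  rewrite size_map_poly_id0 ?(monicP mP) ?rmorph1 ?oner_neq0 // sP eqSS -lt0n.
  exact: (N_gt0 m_irr h1).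
exists la; split; last by rewrite (carl_Psi _ _ _ h1) expr1 (eqP ra) mulr0.
apply: contraTneq ra => ->; rewrite rootE horner_coef0 coef_map -horner_coef0 Psi_at0 //.
by apply: contraNneq (monic_neq0 m_monic) => /embA_inj ->.
Qed.

Section Plus.
Variable (la : L).
Hypothesis cla : croot la.

Lemma carl_Kgen a : Kgen jL T la (carl (embA iota) a la).
Proof.
have cK := Kgen_closed jL T la.
rewrite (@carl_Psi F L (embA iota) 1) ?dvd1n // expr1; apply: (fcM cK); first exact: Kgen_snd.
by rewrite -ev2_embA; apply: Kgen_ev.
Qed.

Lemma cyclo_fieldE : cyclo_field iota m = Kgen jL T la.
Proof.
have [la0 ca] := cla.
apply: boolp.funext => x; apply: boolp.propext; split=> [h|Kx S cS Sk Sr].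
  apply: h; first exact: Kgen_closed.
    move=> c; have [n [e [e0 ->]]] := fraction_numden c; rewrite fmorph_div.
    have Ka a : Kgen jL T la (embA iota a) by have := Kgen_ev jL T la a%:P; rewrite ev2C ev1_embA.
    exact: (fc_div (Kgen_closed _ _ _) (Ka n) (Ka e)).
  move=> y cy; have [a _ ->] := carl_roots m_monic m_irr la0 ca cy.
  exact: carl_Kgen.
apply: Kgen_min Kx => //; [by move=> c; apply: Sk|exact: Sk|exact: Sr].
Qed.

Lemma conj_const c : c != 0 -> exists sigma : {rmorphism L -> L},
  (forall a, sigma (iota a) = iota a) /\ sigma la = jL c * la.
Proof.
move=> c0; have [la0 ca] := cla.
apply: (conjugation L_alg) => a; apply: (croot_sym m_monic m_irr thm_root) => //; split.
  by rewrite mulf_neq0 // fmorph_eq0.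
by rewrite carlZr ca mulr0.
Qed.

Lemma exists_power_neq1 i : ~~ (q.-1 %| i)%N -> exists2 c : F, c != 0 & c ^+ i != 1.
Proof.
move=> ndi; pose r := (i %% q.-1)%N.
have r0 : (0 < r)%N by rewrite lt0n.
have rq : (r < q.-1)%N by rewrite ltn_mod q1_gt0.
have [/existsP [c /andP[c0 ci]]|/existsPn H] := boolP [exists c : F, (c != 0) && (c ^+ i != 1)].
  by exists c.
have /(max_poly_roots (rs := enum (predC1 (0 : F)))) : ('X^r - 1 : {poly F}) != 0.
  by rewrite monic_neq0 // monic_Xn_sub_1.
rewrite enum_uniq size_XnsubC // -cardE cardC1 ltnS leqNgt rq => H2.
have : false; last by [].
apply: H2 => //; apply/allP => c; rewrite mem_enum => /= c0.
have := H c; rewrite negb_and negbK; have -> : (c == 0) = false by apply/negbTE.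
rewrite negbK /= => /eqP ci.
by rewrite rootE hornerD hornerN hornerXn hornerC subr_eq0 -ci [X in _ == _ ^+ X](divn_eq i q.-1) exprD
  mulnC exprM fexp1 // expr1n mul1r.
Qed.

(** Write x = r(la) / E with E in A and r of degree less than that of psi. Invariance under la |-> c
    la gives (c^i - 1) r_i = 0 by linear independence, and some c has c^i different from 1 unless q
    - 1 divides i. *)
Lemma cyclo_field_plusE : cyclo_field_plus iota m = Kgen jL T (la ^+ q.-1).
Proof.
have [la0 ca] := cla; have h1 : (1 %| #|F|.-1)%N by rewrite dvd1n.
apply: boolp.funext => x; apply: boolp.propext; split=> [[Kx fixed]|Kx]; last first.
  split.
    rewrite cyclo_fieldE; apply: Kgen_min Kx.
    - exact: Kgen_closed.
    - exact: Kgen_const.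
    - exact: Kgen_fst.
    - by apply: (fcX (Kgen_closed _ _ _)); apply: Kgen_snd.
  move=> c sigma c0 sk sr; have sj e : sigma (jL e) = jL e by apply: sk.
  case: Kx => a [b [_ ->]]; rewrite fmorph_div /=.
  rewrite !(ev2_morph _ _ _ sj) rmorphXn (sr la ca).
  have -> : sigma T = T by apply: sk.
  have cq : embA iota c%:P ^+ q.-1 = 1.
    by rewrite -[embA iota _]/(jL c) -(rmorphXn jL) fexp1 // rmorph1.
  by rewrite exprMn cq mul1r.
rewrite cyclo_fieldE in Kx; case: Kx => a [b [b0' xE']].
have b0 : ev2 jL T la b != 0 := b0'.
have xE : x = ev2 jL T la a / ev2 jL T la b := xE'.
rewrite -[la]expr1 in b0.
have [b' [E [E0 bE]]] := multiple_in_A m_monic m_irr thm_root h1 isT la0 ca b0.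
rewrite expr1 in bE b0.
have [e [r [aE sr]]] := monic_division (a * b') (psi_monic m_monic h1 isT).
have psi0 : ev2 jL T la (Psi 1 m) = 0 by rewrite -{1}[la]expr1 (psi_nu h1 la0 ca).
have E0' : embA iota E != 0 by apply: contraNneq E0 => /embA_inj ->.
have xr : x * embA iota E = ev2 jL T la r.
  rewrite xE -bE ev2M mulrA divfK // -ev2M aE ev2D ev2M psi0 mulr0 add0r //.
have r0 i : ~~ (q.-1 %| i)%N -> r`_i = 0.
  move=> ndi; have [c c0 ci] := exists_power_neq1 ndi.
  have [sigma [sk sla]] := conj_const c0.
  have sj e' : sigma (jL e') = jL e' by apply: sk.
  have sx : sigma x = x.
    apply: (fixed c) => // y cy.
    have [a' _ ->] := carl_roots m_monic m_irr la0 ca cy.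
    rewrite (@carl_morph F L L (embA iota) (embA iota) sigma) //; last by move=> p; apply: sk.
    by rewrite sla carlZr.
  pose s : {poly {poly F}} := \poly_(k < size r) ((c ^+ k - 1)%:P * r`_k).
  have s0 : ev2 jL T la s = 0.
    have := congr1 sigma xr; rewrite rmorphM sx (ev2_morph _ _ _ sj) sla.
    have -> : sigma (embA iota E) = embA iota E by apply: sk.
    have -> : sigma T = T by apply: sk.
    move=> xr'; apply/eqP.
    have -> : ev2 jL T la s = ev2 jL T (jL c * la) r - ev2 jL T la r.
      rewrite (ev2E _ _ _ r) (ev2E _ _ _ r) -sumrB.
      rewrite /ev2 (horner_coef_wide (n := size r)); last first.
        by rewrite (leq_trans (size_poly _ _)) // size_poly.
      apply: eq_bigr => k _; rewrite coef_map coef_poly ltn_ord /=.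
      rewrite ev1M ev1C rmorphB rmorph1 rmorphXn exprMn /=.
      by rewrite mulrBl mul1r mulrBl; congr (_ - _); rewrite -mulrA mulrCA.
    by rewrite -xr' -xr subrr.
  have ss : s = 0.
    apply: (minrel m_monic m_irr thm_root h1 isT la0 ca (a := s)); last by rewrite expr1.
    by rewrite (leq_trans (size_poly _ _)) // -ltnS -(size_psi m_monic h1 isT).
  have := congr1 (fun p : {poly {poly F}} => p`_i) ss; rewrite coef_poly coef0.
  case: ltnP => [_|le _]; last by rewrite nth_default.
  by move/eqP; rewrite mulf_eq0 polyC_eq0 subr_eq0 (negbTE ci) /= => /eqP.
have -> : x = ev2 jL T la r / embA iota E by rewrite -xr mulfK.
have cK := Kgen_closed jL T (la ^+ q.-1).
have KA p : Kgen jL T (la ^+ q.-1) (embA iota p).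
  by have := Kgen_ev jL T (la ^+ q.-1) p%:P; rewrite ev2C ev1_embA.
apply: (fc_div cK) => //; rewrite ev2E; apply: (fc_sum cK) => i _.
have [/dvdnP [k ->]|ndi] := boolP (q.-1 %| i)%N.
  apply: (fcM cK); first by rewrite ev1_embA.
  by rewrite mulnC exprM; apply: (fcX cK); apply: Kgen_snd.
by rewrite r0 // ev1_0 mul0r; apply: (fc0 cK).
Qed.
End Plus.
End CyclotomicFields.

Lemma pred_eq (X : Type) (A B : X -> Prop) : (forall x, A x <-> B x) -> A = B.
Proof. by move=> AB; apply: boolp.funext => x; apply: boolp.propext. Qed.

(** * Counting places *)

Section PlaceClassification.
Variables (F : finFieldType) (L : closedFieldType).
Variable (iota : {rmorphism {fraction {poly F}} -> L}).
Hypothesis L_alg : forall x : L, exists P : {poly {fraction {poly F}}},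
  P != 0 /\ root (map_poly iota P) x.
Variables (m : {poly F}) (m_monic : m \is monic) (m_irr : irreducible_poly m).
Variables (Om : closedFieldType) (jO : {rmorphism F -> Om}).
Variables (thm : Om) (thm_root : ev1 jO thm m = 0).
Variables (h : nat) (hq : (h %| #|F|.-1)%N) (h_gt0 : (0 < h)%N).
Let q := #|F|.
Notation jL := (cst (embA iota) : {rmorphism F -> L}).
Notation T := (embA iota 'X).
Notation t := (T^-1).
Notation d := (size m).-1.
Notation D := ((size m).-1.-1).
Notation gp := (q.-1 %/ h)%N.
Notation croot la := (la != 0 /\ carl (embA iota) m la = 0).
Notation z la := (zinf iota m h la).
Notation y la := (yinf iota m la).
Notation Kh la := (Kgen jL T (la ^+ h)).
Notation ptinf la := (point iota jO (z la) (y la) 0 (-1)).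
Let gp0 : (0 < gp)%N := gp_gt0 hq h_gt0.
Let T0 : T != 0 := T_neq0 iota.

Lemma const_not_ideal (K O : L -> Prop) c : is_place iota K O -> c != 0 ->
  ~ place_ideal O (jL c).
Proof.
move=> pO c0 /(ideal_unitF (O := O)) H; have /eqP : jL c = 0.
  by apply: H; rewrite -fmorphV; apply: (place_const pO).
by rewrite fmorph_eq0 (negbTE c0).
Qed.

Section AtRoot.
Variables (la : L) (cla : croot la).
Let la0 : la != 0 := proj1 cla.
Let gi := infinity_point L_alg m_monic m_irr thm_root hq h_gt0 cla.
Let pI : is_place iota (Kh la) (ptinf la).
Proof. by rewrite -(Kgen_inf iota m hq la0); case: gi. Qed.
Let cK : field_closed (Kh la) := Kgen_closed _ _ _.

Lemma ptinf_place : is_place iota (Kh la) (ptinf la). Proof. exact: pI. Qed.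
Lemma ptinf_deg : place_deg F (ptinf la) 1. Proof. by case: gi. Qed.

Lemma ptinf_z : place_ideal (ptinf la) (z la).
Proof.
have [_ _ _ H _] := gi; have := H ('X)%:P; rewrite !ev2C !ev1X.
by case=> _; apply.
Qed.

Lemma ptinf_y : place_ideal (ptinf la) (y la + 1) /\ ptinf la (y la).
Proof.
have [_ _ O H _] := gi; split; last by have := O 'X; rewrite ev2X.
have := H ('X + 1); rewrite !ev2D !ev2X !ev2_1 addNr.
by case=> _; apply.
Qed.

Lemma ptinf_t : place_ideal (ptinf la) t.
Proof.
rewrite -(yz_t iota m hq la0); apply: (pidealMl pI); first by case: ptinf_y.
exact: (pidealX pI ptinf_z).
Qed.

Lemma ptinf_T : ~ ptinf la T.
Proof.
move=> OT; have := ideal_unitF ptinf_t; rewrite invrK => /(_ OT) /eqP.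
by rewrite invr_eq0 (negbTE T0).
Qed.
End AtRoot.

(** Let la' = C_a(la) with deg a = k <= D. Then t^(k(q-1)) y' = y U^(q-1), where U = t^k [Ec a] has
    the leading coefficient of a as residue. As y, y' are integral and y, U are units, k = 0, so la'
    is a constant multiple of la. *)
Lemma ptinf_distinct la la' : croot la -> croot la' -> ptinf la = ptinf la' ->
  la ^+ q.-1 = la' ^+ q.-1.
Proof.
move=> cl cl' E; have [la0 ca] := cl; have [la'0 ca'] := cl'.
have pI := ptinf_place cl; have Mt := ptinf_t cl.
have cK : field_closed (Kh la) := Kgen_closed _ _ _.
have [My Oy] := ptinf_y cl; have [My' Oy'] := ptinf_y cl'.
rewrite -E in My' Oy'.
have nMy : ~ place_ideal (ptinf la) (y la).
  move=> M; apply: (ideal_neq1 pI).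
  have -> : 1 = y la + 1 - y la by rewrite addrAC subrr add0r.
  exact: (pidealB cK pI).
have [a sa laE] := carl_roots m_monic m_irr la0 ca ca'.
have a0 : a != 0 by apply: contraNneq la'0 => a0; rewrite laE a0 carl0l.
set k := (size a).-1; have sk : size a = k.+1 by rewrite prednK // size_poly_gt0.
have kD : (k <= D)%N by rewrite -ltnS dD // -sk.
pose w := la ^+ q.-1; set Ew := (map_poly (embA iota) (Ec a)).[w].
pose U := t ^+ k * Ew.
have UE : U = ev2 jL t (y la) (Ginf D k a).
  by rewrite /U -(@Ginf_ev F D L (embA iota) T0 w k a) // ?(leq_trans kD) // sk.
have Ot : ptinf la t := ideal_place Mt.
have Oev b : ptinf la (ev2 jL t (y la) b) by apply: (place_ev2 pI).
have OU : ptinf la U by rewrite UE.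
have nMU : ~ place_ideal (ptinf la) U.
  have [c cE] := Ginf_cong a kD; rewrite UE cE ev2D ev2M !ev2C ev1C ev1X => MU.
  have ak : a`_k != 0 by rewrite -[a`_k]/(lead_coef a) lead_coef_eq0.
  apply: (const_not_ideal pI ak).
  set u := t * _ in MU; have -> : jL a`_k = jL a`_k + u - u by rewrite addrK.
  by apply: (pidealB cK pI) => //; apply: (pidealMr pI).
have [U0 OUi] := place_unit pI OU nMU.
have [y0 Oyi] := place_unit pI Oy nMy.
have key : t ^+ (k * q.-1) * y la' = y la * U ^+ q.-1.
  rewrite /yinf /yw laE carl_Ec -/w -/Ew exprMn /U exprMn -exprM.
  set x1 := T ^+ _; set x2 := t ^+ _; set x3 := Ew ^+ _; rewrite -/w.
  rewrite -/w; set x4 := T^-1; set x5 := w; ring.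
have k0 : k = 0%N.
  apply/eqP; apply: contraT; rewrite -lt0n => kpos.
  have M1 : place_ideal (ptinf la) (y la * U ^+ q.-1).
    rewrite -key; apply: (pidealMr pI) => //; apply: (pidealX pI) => //.
    by rewrite muln_gt0 kpos q1_gt0.
  have [] := ideal_neq1 pI.
  have -> : 1 = (y la * U ^+ q.-1) * ((y la)^-1 * U^-1 ^+ q.-1).
    by rewrite mulrACA mulfV // mul1r -exprMn mulfV // expr1n.
  apply: (pidealMr pI) => //; apply: (placeM pI) => //.
  exact: (placeX pI).
have aC : a = (a`_0)%:P by apply: size1_polyC; rewrite sk k0.
have a00 : a`_0 != 0 by apply: contraNneq a0 => e; rewrite aC e.
by rewrite laE aC carlC exprMn -(rmorphXn jL) fexp1 // rmorph1 mul1r.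
Qed.

Variables (la : L) (cla : croot la).
Let la0 : la != 0 := proj1 cla.
Let ca : carl (embA iota) m la = 0 := proj2 cla.
Let cK : field_closed (Kh la) := Kgen_closed _ _ _.

Lemma infinite_place_at (O : L -> Prop) la' : is_place iota (Kh la) O ->
  place_ideal O t -> croot la' -> place_ideal O (y la' + 1) -> O = ptinf la'.
Proof.
move=> pO Mt cl' My; have [la'0 ca'] := cl'.
have Oy : O (y la').
  rewrite -[y la'](addrK 1); apply: (placeB pO); first exact: ideal_place.
  exact: (place1 pO).
have nMy : ~ place_ideal O (y la').
  move=> M; apply: (ideal_neq1 pO).
  have -> : 1 = y la' + 1 - y la' by rewrite addrAC subrr add0r.
  exact: (pidealB cK pO).
have [y0 Oyi] := place_unit pO Oy nMy.
have Mz : place_ideal O (z la').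
  apply: (pidealXn pO (n := gp)) => //.
    rewrite (Kgen_root_eq m_monic m_irr hq cla cl') -(Kgen_inf iota m hq la'0).
    exact: Kgen_fst.
  have -> : z la' ^+ gp = t * (y la')^-1.
    by rewrite -(yz_t iota m hq la'0) mulrC mulrA mulVf // mul1r.
  exact: (pidealMr pO).
have Oz : O (z la') := ideal_place Mz.
apply: pred_eq.
have [_ _ _ _] := infinity_point L_alg m_monic m_irr thm_root hq h_gt0 cl'.
apply.
- by rewrite (Kgen_inf iota m hq la'0) -(Kgen_root_eq m_monic m_irr hq cla cl').
- by move=> a; apply: (place_ev2 pO).
- move=> a; have [A2 [A1 [c [aE ->]]]] := split_infinity jO a.
  move/eqP; rewrite fmorph_eq0 => /eqP c0; rewrite aE c0 addr0 ev2D ev2M ev2D ev2X ev2_1.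
  apply: (pidealD cK pO); first by apply: (pidealMl pO) => //; apply: (place_ev2 pO).
  by rewrite ev2C ev1M ev1X; apply: (pidealMl pO) => //; apply: (place_ev1 pO).
Qed.

Lemma infinite_place (O : L -> Prop) : is_place iota (Kh la) O -> ~ O T ->
  exists2 la', croot la' & O = ptinf la'.
Proof.
move=> pO nOT; have KT : Kh la T := Kgen_fst _ _ _.
have Mt : place_ideal O t := nplace_ideal pO KT nOT.
have Ky la' : la' != 0 -> carl (embA iota) m la' = 0 -> Kh la (y la').
  move=> la'0 ca'; rewrite (Kgen_root_eq m_monic m_irr hq cla (conj la'0 ca')).
  by rewrite -(Kgen_inf iota m hq la'0); apply: Kgen_snd.
have [la' [la'0 ca' My]] := infinity_root m_monic m_irr cK pO Ky KT Mt.
by exists la'; [split|apply: infinite_place_at].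
Qed.
End PlaceClassification.

(** Each place is counted once by giving weight 1/k to each of the k indices presenting it. This
    avoids choosing representatives of Frobenius orbits and is why the count takes place in
    [rat]. *)
Lemma count_places (F : finFieldType) (L : fieldType) (iota : {fraction {poly F}} -> L)
    (K : L -> Prop) (e B : nat) (I : finType) (D : pred I) (O : I -> L -> Prop) (k : I -> nat) :
  nplaces iota K e B ->
  (forall i, D i -> is_place iota K (O i) /\ place_deg F (O i) e) ->
  (forall O', is_place iota K O' -> place_deg F O' e -> exists2 i, D i & O' = O i) ->
  (forall i, D i -> #|[pred i' | D i' && boolp.asbool (O i' = O i)]| = k i) ->
  B%:R = \sum_(i | D i) (k i)%:R^-1 :> rat.
Proof.
move=> [P [Pp Pinj Psurj]] OP surj kE.
have -> : \sum_(i | D i) (k i)%:R^-1 =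
    \sum_(i | D i) \sum_(b | boolp.asbool (P b = O i)) (k i)%:R^-1 :> rat.
  apply: eq_bigr => i Di; have [pO dO] := OP i Di.
  have [b /pred_eq Ob] := Psurj _ pO dO.
  rewrite (big_pred1 b) // => b' /=; apply/boolp.asboolP/eqP => [E|->]; last by rewrite Ob.
  by apply: Pinj => x; rewrite E Ob.
rewrite (exchange_big_dep predT) //=.
rewrite -[LHS]mulr1 -[in LHS](card_ord B) mulr_natl -sumr_const.
apply: eq_big => // b _; have [pb db] := Pp b.
have [i0 Di0 Pi0] := surj _ pb db.
rewrite (eq_bigr (fun=> (k i0)%:R^-1)) => [|i /andP[Di /boolp.asboolP Pi]]; last first.
  rewrite -(kE i) // -(kE i0) //; congr (_%:R^-1); apply: eq_card => i'.
  by rewrite !inE -Pi -Pi0.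
rewrite sumr_const -[LHS](mulfV (x := (k i0)%:R)); last first.
  rewrite pnatr_eq0 -lt0n -(kE i0) //; apply/card_gt0P; exists i0.
  by rewrite inE Di0; apply/boolp.asboolP.
rewrite -[RHS]mulr_natl; congr (_%:R * _); rewrite -(kE i0) //; apply: eq_card => i.
by rewrite !inE; congr (_ && _); rewrite Pi0; apply/boolp.asboolP/boolp.asboolP => ->.
Qed.

Section MonicPolynomials.
Variable F : finFieldType.

Definition monic_of (g : nat) (c : {ffun 'I_g -> F}) : {poly F} :=
  'X^g + \sum_(k < g) c k *: 'X^k.

Lemma monic_of_low g (c : {ffun 'I_g -> F}) : (size (\sum_(k < g) c k *: 'X^k)%R <= g)%N.
Proof.
apply: (leq_trans (size_sum _ _ _)); apply/bigmax_leqP => i _.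
by apply: (leq_trans (size_scale_leq _ _)); rewrite size_polyXn.
Qed.

Lemma size_monic_of g (c : {ffun 'I_g -> F}) : size (monic_of c) = g.+1.
Proof. by rewrite /monic_of size_polyDl size_polyXn // ltnS monic_of_low. Qed.

Lemma monic_of_monic g (c : {ffun 'I_g -> F}) : monic_of c \is monic.
Proof.
by rewrite monicE lead_coefDl ?lead_coefXn // size_polyXn ltnS monic_of_low.
Qed.

Lemma coef_monic_of g (c : {ffun 'I_g -> F}) (k : 'I_g) : (monic_of c)`_k = c k.
Proof.
rewrite coefD coefXn (ltn_eqF (ltn_ord k)) add0r coef_sum (bigD1 k) //= coefZ coefXn eqxx mulr1.
rewrite big1 ?addr0 // => i ik; rewrite coefZ coefXn.
by rewrite eq_sym (inj_eq val_inj) (negbTE ik) mulr0.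
Qed.

Lemma monic_of_inj g : injective (@monic_of g).
Proof. by move=> c c' E; apply/ffunP => k; rewrite -!coef_monic_of E. Qed.

Lemma monic_of_surj (P : {poly F}) : P \is monic ->
  exists c : {ffun 'I_(size P).-1 -> F}, P = monic_of c.
Proof.
move=> mP; exists [ffun k : 'I__ => P`_k].
have sP : size P = (size P).-1.+1 by rewrite prednK // size_poly_gt0 monic_neq0.
have PE : P = \sum_(i < (size P).-1.+1) P`_i *: 'X^i by rewrite -sP -poly_def coefK.
rewrite /monic_of [LHS]PE big_ord_recr /=.
rewrite -[P`__]/(lead_coef P) (monicP mP) scale1r addrC; congr (_ + _).
by apply: eq_bigr => k _; rewrite ffunE.
Qed.

(** A finite type of monic polynomials of degree at most n, over which sums and products on primes
    become finite iterated operations. *)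
Definition monic_index (n : nat) : finType := {g : 'I_n.+1 & {ffun 'I_g -> F}}.
Definition pol n (x : monic_index n) : {poly F} := monic_of (tagged x).

Lemma pol_inj n : injective (@pol n).
Proof.
move=> [g c] [g' c'] E; have gg : g = g'.
  by apply: val_inj; have := congr1 (fun p : {poly F} => size p) E; rewrite !size_monic_of => -[].
move: gg c c' E => -> c c' E.
by congr Tagged; apply: monic_of_inj.
Qed.

Lemma pol_monic n (x : monic_index n) : pol x \is monic.
Proof. exact: monic_of_monic. Qed.

Lemma pol_surj n (P : {poly F}) : P \is monic -> ((size P).-1 <= n)%N ->
  exists x : monic_index n, P = pol x.
Proof.
move=> mP sP; have [c cE] := monic_of_surj mP.
by exists (Tagged (fun g : 'I_n.+1 => {ffun 'I_g -> F}) (i := Ordinal (sP : (_ < n.+1)%N)) c).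
Qed.
End MonicPolynomials.

Lemma place_deg_inj (F : finFieldType) (L : fieldType) (iota : {fraction {poly F}} -> L)
    (K O : L -> Prop) e e' : is_place iota K O ->
  place_deg F O e -> place_deg F O e' -> e = e'.
Proof.
move=> pO; wlog suff main : e e' / place_deg F O e -> place_deg F O e' -> (e <= e')%N.
  by move=> d1 d2; apply/eqP; rewrite eqn_leq !main.
move=> [r [rO rP]] [r' [r'O r'P]].
have [phi phiP] : exists phi, forall i, place_ideal O (r i - r' (phi i)).
  have ex i : exists k, place_ideal O (r i - r' k) by have [k [Mk _]] := r'P _ (rO i); exists k.
  by exists (fun i => projT1 (boolp.cid (ex i))) => i; case: boolp.cid.
have inj : injective phi.
  move=> i k E; have [l [_ ul]] := rP _ (r'O (phi i)).
  have flip u v : place_ideal O (u - v) -> place_ideal O (v - u).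
    by move=> M; rewrite -opprB; apply: (pidealN pO).
  by rewrite (ul i (flip _ _ (phiP i))); apply/esym/ul/flip; rewrite E.
have := leq_card phi inj; rewrite !card_ord leq_exp2l // finNzRing_gt1 //.
Qed.

Section PlaceCount.
Variables (F : finFieldType) (L : closedFieldType).
Variable (iota : {rmorphism {fraction {poly F}} -> L}).
Hypothesis L_alg : forall x : L, exists P : {poly {fraction {poly F}}},
  P != 0 /\ root (map_poly iota P) x.
Variables (m : {poly F}) (m_monic : m \is monic) (m_irr : irreducible_poly m).
Variables (Om : closedFieldType) (jO : {rmorphism F -> Om}).
Variables (thm : Om) (thm_root : ev1 jO thm m = 0).
Variables (h : nat) (hq : (h %| #|F|.-1)%N) (h_gt0 : (0 < h)%N).
Variables (la : L) (cla : la != 0 /\ carl (embA iota) m la = 0).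
Let la0 : la != 0 := proj1 cla.
Let ca : carl (embA iota) m la = 0 := proj2 cla.
Let q := #|F|.
Notation jL := (cst (embA iota) : {rmorphism F -> L}).
Notation T := (embA iota 'X).
Notation d := (size m).-1.
Notation nu := (la ^+ h).
Notation Kh := (Kgen jL T nu).
Notation N := (Nh F h d).
Notation Ninf := (Nh F q.-1 d).
Notation psi := (Psi h m).
Notation pt th r := (point iota jO T nu th r).
Notation zeta P := (ev1 jO thm P ^+ h).

Lemma card_nth_in (rs orb : seq Om) : size rs = N -> uniq rs -> uniq orb ->
  {subset orb <= rs} -> #|[pred i : 'I_N | nth 0 rs i \in orb]| = size orb.
Proof.
move=> sr ur uo sub; rewrite -sum1_card.
rewrite (eq_bigl (fun i : 'I_N => nth 0 rs i \in orb)) => [|i]; last by rewrite inE.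
rewrite -(big_mkord (fun i => nth 0 rs i \in orb) (fun=> 1%N)) -sr.
rewrite -(big_nth 0 (fun r => r \in orb) (fun=> 1%N)) sum1_count -size_filter.
apply: perm_size; apply: uniq_perm => //; first exact: filter_uniq.
by move=> r; rewrite mem_filter; case: (boolP (r \in orb)) => //= /sub ->.
Qed.

(** A root [th] of P, the roots [rs] of psi at [th] with multiplicity, and the residue degree f over
    P. The last clause is the weight required by [count_places]: a Frobenius orbit has f elements,
    while above m all N roots are 0. *)
Definition prime_datum (P : {poly F}) (D : Om * seq Om * nat) : Prop :=
  let: (th, rs, f) := D in
  [/\ ev1 jO th P = 0, map_poly (ev1 jO th) psi = \prod_(r <- rs) ('X - r%:P),
      size rs = N & (0 < f)%N] /\
  [/\ forall r, r \in rs -> good_point iota jO T nu th r ((size P).-1 * f),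
      P != m -> f.-primitive_root (zeta P), P = m -> f = 1%N &
      forall i : 'I_N, #|[pred i' : 'I_N |
         boolp.asbool (pt th (nth 0 rs i') = pt th (nth 0 rs i))]| = if P == m then N else f].

Lemma zeta_neq0 P : P \is monic -> irreducible_poly P -> P != m -> ev1 jO thm P != 0.
Proof.
move=> mP iP Pm; rewrite (ev1_dvd m_irr thm_root); apply/negP => mP'.
have := iP.2 _ _ mP'; rewrite neq_ltn; case: m_irr => -> _; rewrite orbT => /(_ isT).
by rewrite eqp_monic // eq_sym (negbTE Pm).
Qed.

Lemma zeta_N P : P \is monic -> irreducible_poly P -> P != m -> zeta P ^+ N = 1.
Proof.
move=> mP iP Pm; apply: (mulfI (zeta_neq0 mP iP Pm)).
rewrite -exprM [(h * _)%N]mulnC (Nh_mul _ hq) -exprS mulr1.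
rewrite prednK ?expn_gt0 ?(ltnW (q_gt1 F)) //.
by rewrite ev1_frob (th_frob m_monic m_irr thm_root).
Qed.

Lemma prime_datum_exists P : P \is monic -> irreducible_poly P -> exists D, prime_datum P D.
Proof.
move=> mP iP; have [->|Pm] := eqVneq P m.
  exists (thm, nseq N 0, 1%N); split; split=> //.
  - rewrite (psi_bar m_monic m_irr thm_root hq h_gt0) big_nseq subr0.
    by elim: N => // n IHn; rewrite exprS /= IHn.
  - by rewrite size_nseq.
  - move=> r /nseqP [-> _]; rewrite muln1.
    exact: (ramified_point m_monic m_irr thm_root hq h_gt0 la0 ca).
  - by rewrite eqxx.
  - move=> i; rewrite eqxx -[RHS]card_ord; apply: eq_card => i'.
    by rewrite !inE; apply/boolp.asboolP; rewrite !nth_nseq !ltn_ord.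
have [th Pth] := irr_root_exists jO iP.
have mth := m_th_neq0 m_monic m_irr mP iP Pth Pm.
have [rs [rsE urs srs]] := @Psi_separable F Om (ev1 jO th) m m_monic h hq h_gt0 mth.
have zN := zeta_N mP iP Pm.
have [f fprim fN] := prim_order_exists (N_gt0 m_irr hq) zN.
have f0 := prim_order_gt0 fprim; have zf := prim_expr_order fprim.
have zmin i : (0 < i < f)%N -> zeta P ^+ i != 1.
  by case/andP=> i0 lt; rewrite -(prim_order_dvd fprim) gtnNdvd.
have rr r : r \in rs -> root (map_poly (ev1 jO th) psi) r by rewrite rsE root_prod_XsubC.
have gp r : r \in rs -> good_point iota jO T nu th r ((size P).-1 * f).
  move=> /rr pr.
  exact: (unramified_point m_monic m_irr thm_root hq h_gt0 la0 ca mP iP Pth Pm f0 zf zmin pr).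
set g := (size P).-1 in gp *.
have thg : th ^+ (q ^ g) = th := th_frob mP iP Pth.
have thi : forall i, (0 < i < g)%N -> th ^+ (q ^ i) != th := th_frob_min mP iP Pth.
have rf r i : r \in rs -> (r ^+ ((q ^ g) ^ i) == r) = (zeta P ^+ i == 1).
  by move=> /rr; apply: (frob_r_fixed m_monic m_irr thm_root hq h_gt0 mP iP Pth Pm).
exists (th, rs, f); split; split=> // [e|i]; first by rewrite e eqxx in Pm.
rewrite (negbTE Pm); set r := nth 0 rs i.
have irs : r \in rs by rewrite mem_nth // srs.
have rfE : r ^+ ((q ^ g) ^ f) = r by apply/eqP; rewrite rf // zf.
have riE k : (0 < k < f)%N -> r ^+ ((q ^ g) ^ k) != r by move=> lt; rewrite rf // zmin.
pose orb := [seq r ^+ ((q ^ g) ^ k) | k <- seq.iota 0 f].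
have orb_rs : {subset orb <= rs}.
  move=> _ /mapP [k _ ->]; rewrite -root_prod_XsubC -rsE.
  apply: (frob_root_iter jO) (rr _ irs) => l; rewrite coef_map /= ev1_frob thg //.
have <- : size orb = f by rewrite size_map size_iota.
rewrite -(card_nth_in srs urs (frob_orbit_uniq rfE riE) orb_rs).
apply: eq_card => i'; rewrite !inE; set r' := nth 0 rs i'.
have i'rs : r' \in rs by rewrite mem_nth // srs.
(* Equal places have equal kernels, so r' is a Frobenius conjugate of r; conversely, a polynomial
   vanishes at (th, r) exactly when it vanishes at a conjugate. *)
apply/boolp.asboolP/mapP => [E|[k _ ->]].
  have sub a : ev2 jO th r a = 0 -> ev2 jO th r' a = 0.
    have [_ _ _ H _] := gp r irs; have [_ _ _ H' _] := gp r' i'rs.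
    by move=> /H; rewrite -E => /H'.
  have [k lt ->] := orbit_separation (irr_deg_gt0 iP) f0 thg thi rfE sub.
  by exists k => //; rewrite mem_iota.
have phiE b : ev2 jO th (r ^+ ((q ^ g) ^ k)) b = ev2 jO th r b ^+ (q ^ (g * k)).
  rewrite ev2_frob -expnM; congr (ev2 jO _ _ b); rewrite expnM.
  by elim: (k) => [|l IHl]; rewrite ?expn0 ?expr1 // expnS exprM thg.
have q0 : (0 < q ^ (g * k))%N by rewrite expn_gt0 ltnW ?q_gt1.
apply: pred_eq => u; split=> -[a [b [b0 uE]]]; exists a, b; split=> //.
  have b0' : ev2 jO th (r ^+ ((q ^ g) ^ k)) b != 0 := b0.
  have goal : ev2 jO th r b != 0.
    by apply: contraNneq b0' => e; rewrite phiE e expr0n eqn0Ngt q0.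
  exact: goal.
have b0' : ev2 jO th r b != 0 := b0.
have goal : ev2 jO th (r ^+ ((q ^ g) ^ k)) b != 0 by rewrite phiE expf_neq0.
exact: goal.
Qed.

Notation irr P := (boolp.asbool (irreducible_poly P)).
Notation croot la := (la != 0 /\ carl (embA iota) m la = 0).
Notation ptinf la := (point iota jO (zinf iota m h la) (yinf iota m la) 0 (-1)).

Lemma infinite_roots : exists lam : 'I_Ninf -> L,
  [/\ forall i, croot (lam i), forall i i', lam i ^+ q.-1 = lam i' ^+ q.-1 -> i = i' &
      forall x, croot x -> exists i, x ^+ q.-1 = lam i ^+ q.-1].
Proof.
have h1 : (q.-1 %| #|F|.-1)%N by rewrite dvdnn.
have m0 : embA iota m != 0 by apply: contraNneq (monic_neq0 m_monic) => /embA_inj ->.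
have [ws [wsE uws sws]] :=
  @Psi_separable F L (embA iota) m m_monic q.-1 h1 (q1_gt0 F) m0.
have ex (i : 'I_Ninf) : exists x, croot x /\ x ^+ q.-1 = nth 0 ws i.
  set w := nth 0 ws i; have ww : w \in ws by rewrite mem_nth // sws.
  have /closed_rootP [x] : size ('X^(q.-1) - w%:P) != 1.
    by rewrite size_XnsubC ?q1_gt0 // eqSS -lt0n q1_gt0.
  rewrite rootE hornerD hornerN hornerXn hornerC subr_eq0 => /eqP xw; exists x; split=> //.
  have rw : root (map_poly (embA iota) (Psi q.-1 m)) w by rewrite wsE root_prod_XsubC.
  split; last by rewrite (carl_Psi _ _ _ h1) xw (eqP rw) mulr0.
  apply: contraTneq rw => x0; rewrite rootE -xw x0 expr0n eqn0Ngt q1_gt0 /=.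
  by rewrite horner_coef0 coef_map -horner_coef0 Psi_at0 // q1_gt0.
have [lam lamP] := boolp.choice ex; exists lam; split=> [i|i i' E|x [x0 cx]].
- by case: (lamP i).
- have [_ Ei] := lamP i; have [_ Ei'] := lamP i'; apply: ord_inj; apply/eqP.
  by rewrite -(nth_uniq 0 _ _ uws) ?sws // -Ei -Ei' E.
have : x ^+ q.-1 \in ws.
  rewrite -root_prod_XsubC -wsE rootE; apply/eqP; move/eqP: cx.
  by rewrite (carl_Psi _ _ _ h1) mulf_eq0 (negbTE x0) => /eqP.
move=> xws; have lt : (index (x ^+ q.-1) ws < Ninf)%N by rewrite -sws index_mem.
by exists (Ordinal lt); have [_ ->] := lamP (Ordinal lt); rewrite nth_index.
Qed.

Lemma count_formula : exists f : {poly F} -> nat,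
  [/\ forall P, P \is monic -> irreducible_poly P -> (0 < f P)%N,
      forall P, P \is monic -> irreducible_poly P -> P != m ->
        (f P).-primitive_root (zeta P),
      f m = 1%N &
      forall n e B, (0 < e <= n)%N -> nplaces iota Kh e B ->
        B%:R = \sum_(x : monic_index F n | irr (pol x) && ((size (pol x)).-1 * f (pol x) == e)%N)
                 (if pol x == m then 1 else N%:R / (f (pol x))%:R)
               + ((e == 1%N) * Ninf)%:R :> rat].
Proof.
have [dat datP] : exists dat : {poly F} -> Om * seq Om * nat,
    forall P, P \is monic -> irreducible_poly P -> prime_datum P (dat P).
  have [|dat H] := @boolp.choice {poly F} (Om * seq Om * nat)%type
     (fun P D => P \is monic -> irreducible_poly P -> prime_datum P D).
    move=> P; have [[mP iP]|nP] := boolp.pselect (P \is monic /\ irreducible_poly P).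
      by have [D DP] := prime_datum_exists mP iP; exists D.
    by exists (0, [::], 0%N) => mP iP; case: nP.
  by exists dat.
pose f P := (dat P).2; pose th P := (dat P).1.1; pose rs P := (dat P).1.2.
have dE P : P \is monic -> irreducible_poly P -> prime_datum P (th P, rs P, f P).
  by move=> mP iP; have := datP P mP iP; rewrite /th /rs /f; case: (dat P) => [[]].
exists f; split=> [P mP iP|P mP iP Pm||n e B /andP[e0 en] HB].
- by have [[_ _ _ ->]] := dE P mP iP.
- by have [_ [_ H _ _]] := dE P mP iP; apply: H.
- by have [_ [_ _ H _]] := dE m m_monic m_irr; apply: H.
have [lam [lamC lam_inj lam_surj]] := infinite_roots.
(* An index is a monic polynomial with the position of a root of psi over it, or a root at infinity;
   [D] retains the irreducible polynomials of the right degree. *)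
pose I : finType := ((monic_index F n * 'I_N) + 'I_Ninf)%type.
pose D (i : I) := match i with
  | inl xi => irr (pol xi.1) && ((size (pol xi.1)).-1 * f (pol xi.1) == e)%N
  | inr _ => e == 1%N end.
pose O (i : I) := match i with
  | inl xi => pt (th (pol xi.1)) (nth 0 (rs (pol xi.1)) xi.2)
  | inr i => ptinf (lam i) end.
pose k (i : I) := match i with
  | inl xi => if pol xi.1 == m then N else f (pol xi.1)
  | inr _ => 1%N end.
have gpt (x : monic_index F n) (i : 'I_N) : irr (pol x) ->
    good_point iota jO T nu (th (pol x)) (nth 0 (rs (pol x)) i)
      ((size (pol x)).-1 * f (pol x)).
  move/boolp.asboolP => iP; have [[_ _ srs _] [H _ _ _]] := dE _ (pol_monic x) iP.
  by apply: H; rewrite mem_nth // srs.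
have OT (x : monic_index F n) (i : 'I_N) : irr (pol x) -> O (inl (x, i)) T.
  by move=> ix; have [_ _ H _ _] := gpt x i ix; have := H ('X)%:P; rewrite ev2C ev1X.
have nOT i : ~ O (inr i) T.
  exact: (ptinf_T L_alg m_monic m_irr thm_root hq h_gt0 (lamC i)).
have idP (x : monic_index F n) (i : 'I_N) p : irr (pol x) ->
    place_ideal (O (inl (x, i))) (embA iota p) -> pol x %| p.
  move=> ix; have [_ _ _ H _] := gpt x i ix; have := H p%:P; rewrite ev2C ev1_embA => -[H1 _].
  move=> /H1; rewrite ev2C => /eqP.
  move/boolp.asboolP: ix => iP; have [[Pth _ _ _] _] := dE _ (pol_monic x) iP.
  by rewrite (ev1_dvd iP Pth).
have idPx (x : monic_index F n) (i : 'I_N) : irr (pol x) ->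
    place_ideal (O (inl (x, i))) (embA iota (pol x)).
  move=> ix; have [_ _ _ H _] := gpt x i ix; have := H (pol x)%:P; rewrite ev2C ev1_embA => -[_].
  apply; move/boolp.asboolP: ix => iP; have [[Pth _ _ _] _] := dE _ (pol_monic x) iP.
  by rewrite ev2C.
have xeq x x' i i' : irr (pol x) -> irr (pol x') -> O (inl (x, i)) = O (inl (x', i')) -> x = x'.
  move=> ix ix' E; apply: (@pol_inj F n); have := idPx x i ix; rewrite E => /(idP _ _ _ ix') dv.
  move/boolp.asboolP: ix => iP; move/boolp.asboolP: ix' => iP'.
  have := iP.2 _ _ dv; rewrite neq_ltn; case: iP' => -> _; rewrite orbT => /(_ isT).
  by rewrite eqp_monic ?pol_monic // => /eqP.
have key := @count_places F L iota Kh e B I D O k HB.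
rewrite key.
- rewrite big_sumType /=; congr (_ + _); last first.
    case: (e == 1%N); last by rewrite big_pred0.
    by rewrite mul1n sumr_const card_ord invr1.
  pose C (x : monic_index F n) := irr (pol x) && ((size (pol x)).-1 * f (pol x) == e)%N.
  pose G (x : monic_index F n) : rat := (if pol x == m then N else f (pol x))%:R^-1.
  transitivity (\sum_(p : monic_index F n * 'I_N | C p.1 && predT p.2) G p.1).
    by apply: eq_bigl => p; rewrite andbT.
  rewrite -(pair_big C predT (fun x _ => G x)) /=.
  apply: eq_bigr => x _; rewrite sumr_const card_ord -[LHS]mulr_natl /G.
  case: eqP => // _; rewrite mulfV // pnatr_eq0 -lt0n; exact: N_gt0.
- case=> [[x i]|i] /= [Di].
    case/andP: Di => ix /eqP <-; have [H1 H2 _ _ _] := gpt x i ix.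
    by split.
  have := Di => /eqP ->; split.
    rewrite (Kgen_root_eq m_monic m_irr hq cla (lamC i)).
    exact: (ptinf_place L_alg m_monic m_irr thm_root hq h_gt0 (lamC i)).
  exact: (ptinf_deg L_alg m_monic m_irr thm_root hq h_gt0 (lamC i)).
- move=> O' pO' dO'.
  have [TO|nTO] := boolp.pselect (O' T).
    have [P [mP iP MP]] := place_prime m_monic m_irr thm_root hq h_gt0 la0 ca pO' TO.
    have [[Pth rsE srs f0] [gP _ _ _]] := dE P mP iP.
    have [r rr sub] := ideal_root m_monic hq h_gt0 la0 ca iP Pth pO' TO MP.
    have rrs : r \in rs P by rewrite -root_prod_XsubC -rsE.
    have [pP dP _ _ uP] := gP r rrs.
    have OE : O' = pt (th P) r.
      apply: pred_eq; apply: uP => // a.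
      exact: (place_evL m_monic hq h_gt0 la0 ca pO').
    rewrite OE in dO'; have eE := place_deg_inj pP dP dO'.
    have [|x PE] := @pol_surj F n P mP.
      by rewrite (leq_trans _ en) // -eE leq_pmulr.
    have lt : (index r (rs P) < N)%N by rewrite -srs index_mem.
    exists (inl (x, Ordinal lt)); rewrite /= -PE ?OE ?nth_index // eE eqxx andbT.
    exact/boolp.asboolP.
  have [la' cla' OE] := infinite_place L_alg m_monic m_irr thm_root hq h_gt0 cla pO' nTO.
  have [i iE] := lam_surj la' cla'.
  exists (inr i).
    apply/eqP/esym; rewrite OE in dO'.
    have pI := ptinf_place L_alg m_monic m_irr thm_root hq h_gt0 cla'.
    apply: (place_deg_inj pI) dO'.
    exact: (ptinf_deg L_alg m_monic m_irr thm_root hq h_gt0 cla').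
  apply: (infinite_place_at L_alg m_monic m_irr thm_root hq h_gt0 cla pO') => //.
    by rewrite OE; apply: (ptinf_t L_alg m_monic m_irr thm_root hq h_gt0 cla').
  rewrite /yinf -iE OE.
  by have [] := ptinf_y L_alg m_monic m_irr thm_root hq h_gt0 cla'.
- case=> [[x i]|i] Di.
    have ix : irr (pol x) by case/andP: Di.
    move/boolp.asboolP: (ix) => iP; have [_ [_ _ _ H]] := dE _ (pol_monic x) iP.
    rewrite /= -(H i) -(card_image (f := fun i' : 'I_N => inl (x, i') : I)); last by move=> ? ? [].
    apply: eq_card => i'; rewrite inE; apply/andP/imageP => [[Di' /boolp.asboolP E]|[j]].
      case: i' Di' E => [[x' j]|j] Di' E; last first.
        by case: (@nOT j); rewrite E; apply: OT.
      have ix' : irr (pol x') by case/andP: Di'.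
      have xx := xeq _ _ _ _ ix' ix E; rewrite xx in E *.
      by exists j => //; rewrite inE; apply/boolp.asboolP.
    by rewrite inE => /boolp.asboolP E ->; split=> //; apply/boolp.asboolP.
  rewrite /= -(card1 (inr i : I)); apply: eq_card => i'; rewrite !inE.
  apply/andP/eqP => [[Di' /boolp.asboolP E]|->]; last by split=> //; apply/boolp.asboolP.
  case: i' Di' E => [[x j]|j] Di' E.
    have ix : irr (pol x) by case/andP: Di'.
    by case: (@nOT i); have := OT x j ix; rewrite [O (inl (x, j))]E.
  congr inr; apply: lam_inj.
  exact: (ptinf_distinct L_alg m_monic m_irr thm_root hq h_gt0 (lamC j) (lamC i) E).
Qed.
End PlaceCount.

(** * Power sums and Euler products *)

Section PowerSums.
Variables (F : finFieldType).
Let q := #|F|.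

Lemma card_eq0 (E : comNzRingType) (j : {rmorphism F -> E}) : (q%:R : E) = 0.
Proof.
have [p p_pr pF] := finPcharP F.
have pE : p \in [pchar E] by apply: (rmorph_pchar j).
rewrite /q (card_pprimeChar pF) natrX (pcharf0 pE) expr0n.
by case: eqP => // n0; have := finNzRing_gt1 F; rewrite (card_pprimeChar pF) n0.
Qed.

(** Splits off the last coordinate. Coefficient vectors are extended to [nat], and on the right the
    default a of [insub] is the coordinate of index i. *)
Lemma big_ffun_recr (E : nmodType) i (G : (nat -> F) -> E) :
  (forall u v, (forall k, (k < i.+1)%N -> u k = v k) -> G u = G v) ->
  \sum_(c : {ffun 'I_i.+1 -> F}) G (fun k => if insub k is Some l then c l else 0) =
  \sum_(a : F) \sum_(c : {ffun 'I_i -> F})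
    G (fun k => if insub k is Some l then c l else a).
Proof.
move=> Gext; pose join (x : F * {ffun 'I_i -> F}) : {ffun 'I_i.+1 -> F} :=
  [ffun k : 'I_i.+1 => if insub (val k) is Some l then x.2 l else x.1].
pose split (c : {ffun 'I_i.+1 -> F}) : F * {ffun 'I_i -> F} :=
  (c ord_max, [ffun k : 'I_i => c (widen_ord (leqnSn i) k)]).
have sj : cancel join split.
  move=> [a c]; congr (_, _); first by rewrite ffunE insubN //= ltnn.
  by apply/ffunP => k; rewrite !ffunE /= valK.
have js : cancel split join.
  move=> c; apply/ffunP => k; rewrite ffunE; case: insubP => [l _ lk|nk] /=.
    by rewrite ffunE; congr (c _); apply: val_inj.
  by congr (c _); apply: val_inj; apply/eqP; rewrite /= eqn_leq leqNgt nk -ltnS ltn_ord.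
rewrite pair_bigA /= (reindex join) /=; last by exists split => x _; [apply: sj|apply: js].
apply: eq_bigr => -[a c] _ /=; apply: Gext => k lt.
rewrite (insubT (fun l => (l < i.+1)%N) lt) ffunE /=.
by case: insubP.
Qed.

(** Expand in the last coordinate a. The term of degree 0 in a is repeated q times, hence 0; the
    others involve a power smaller than n of the remaining form, so the induction on the dimension
    applies. *)
Lemma sum_pow_vanish (E : comNzRingType) (j : {rmorphism F -> E}) (x : nat -> E) i n y :
  (n < i)%N -> \sum_(c : {ffun 'I_i -> F}) (y + \sum_(k < i) j (c k) * x k) ^+ n = 0.
Proof.
elim: i n y => // i IHi n y lt.
pose G (u : nat -> F) := (y + \sum_(k < i.+1) j (u k) * x k) ^+ n.
have Gext u v : (forall k, (k < i.+1)%N -> u k = v k) -> G u = G v.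
  by move=> uv; congr ((_ + _) ^+ _); apply: eq_bigr => k _; rewrite uv.
transitivity (\sum_(c : {ffun 'I_i.+1 -> F}) G (fun k => if insub k is Some l then c l else 0)).
  apply: eq_bigr => c _; congr ((_ + _) ^+ _); apply: eq_bigr => k _.
  by rewrite valK.
rewrite big_ffun_recr //.
pose Y (c : {ffun 'I_i -> F}) := y + \sum_(k < i) j (c k) * x k.
transitivity (\sum_(a : F) \sum_(c : {ffun 'I_i -> F})
    \sum_(l < n.+1) (Y c ^+ (n - l) * (j a * x i) ^+ l) *+ 'C(n, l)).
  apply: eq_bigr => a _; apply: eq_bigr => c _; rewrite -exprDn /G big_ord_recr /= addrA.
  congr ((_ + _) ^+ _); last by rewrite insubN // ltnn.
  by congr (_ + _); apply: eq_bigr => k _; rewrite valK.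
under eq_bigr do rewrite exchange_big /=.
rewrite exchange_big /= big1 // => -[l ltl] _ /=; case: l ltl => [|l] ltl.
  rewrite exchange_big /= big1 // => c _; rewrite bin0.
  under eq_bigr do rewrite mulr1n expr0 mulr1.
  by rewrite sumr_const -mulr_natl -/q card_eq0 ?mul0r.
rewrite big1 // => a _; rewrite sumrMnl -mulr_suml.
by rewrite IHi ?mul0r ?mul0rn // subnS; move: lt ltl; clear; lia.
Qed.

Lemma power_sumE i n : power_sum F i n = \sum_(c : {ffun 'I_i -> F}) monic_of c ^+ n.
Proof. by []. Qed.

Lemma power_sum_vanish i n : (n < i)%N -> power_sum F i n = 0.
Proof.
move=> lt; rewrite -[RHS](sum_pow_vanish (polyC : {rmorphism F -> {poly F}}) (fun k => 'X^k) ('X^i) lt).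
apply: eq_bigr => c _; congr ((_ + _) ^+ _); apply: eq_bigr => k _.
by rewrite mul_polyC.
Qed.

Lemma power_sum0 n : power_sum F 0 n = 1.
Proof.
rewrite /power_sum (big_pred1 [ffun=> 0]) => [|c /=].
  by rewrite big_ord0 addr0 expr1n.
by apply/esym/eqP/ffunP => -[].
Qed.

Lemma Cn_coef n i : (Cn F n)`_i = power_sum F i n.
Proof. by rewrite coef_poly ltnS; case: leqP => // /power_sum_vanish ->. Qed.

Section Even.
Variable n : nat.
Hypotheses (n_gt0 : (0 < n)%N) (n_even : (q.-1 %| n)%N).

Let Q i : {poly F} := \sum_(c : {ffun 'I_i -> F}) (\sum_(k < i) c k *: 'X^k) ^+ n.

(** [Q i] sums the n-th powers of all polynomials of degree < i. Those of degree i with leading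
    coefficient a contribute a^n s_i(n) = s_i(n), as q - 1 divides n, and there are q - 1 = -1 such
    a in F. *)
Lemma full_sum_step i : Q i.+1 = Q i - power_sum F i n.
Proof.
pose G (u : nat -> F) : {poly F} := (\sum_(k < i.+1) u k *: 'X^k) ^+ n.
have Gext u v : (forall k, (k < i.+1)%N -> u k = v k) -> G u = G v.
  by move=> uv; congr (_ ^+ _); apply: eq_bigr => k _; rewrite uv.
transitivity (\sum_(c : {ffun 'I_i.+1 -> F}) G (fun k => if insub k is Some l then c l else 0)).
  by apply: eq_bigr => c _; congr (_ ^+ _); apply: eq_bigr => k _; rewrite valK.
rewrite big_ffun_recr // (bigD1 0) //=; congr (_ + _).
  apply: eq_bigr => c _; rewrite /G big_ord_recr /= insubN ?ltnn // scale0r addr0.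
  by congr (_ ^+ _); apply: eq_bigr => k _; rewrite valK.
transitivity (\sum_(a : F | a != 0) power_sum F i n).
  apply: eq_bigr => a a0.
  have bij : bijective (fun c : {ffun 'I_i -> F} => [ffun k => a * c k]).
    exists (fun c : {ffun 'I_i -> F} => [ffun k => a^-1 * c k]) => c;
    by apply/ffunP => k; rewrite !ffunE ?mulKf ?mulVKf.
  rewrite (reindex _ (onW_bij _ bij)) /=; apply: eq_bigr => c _.
  have an : a ^+ n = 1.
    case/dvdnP: n_even => k ->; rewrite mulnC exprM.
    have -> : a ^+ q.-1 = 1 by apply: (mulfI a0); rewrite -exprS (q1K F) mulr1 expf_card.
    by rewrite expr1n.
  rewrite /G big_ord_recr /= insubN ?ltnn //.
  have -> : \sum_(k < i) (if insub (val k) is Some l then [ffun k0 => a * c k0] l else a) *: 'X^k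
     = a *: \sum_(k < i) c k *: 'X^k :> {poly F}.
    rewrite scaler_sumr; apply: eq_bigr => k _; rewrite valK ffunE scalerA //.
  by rewrite -scalerDr exprZn an scale1r addrC.
rewrite sumr_const cardC1; apply/eqP; rewrite -addr_eq0.
by rewrite -mulrSr (q1K F) -mulr_natl (card_eq0 (polyC : {rmorphism F -> {poly F}})) mul0r.
Qed.

Lemma sum_power_sums i : \sum_(k < i) power_sum F k n = Q 0 - Q i.
Proof.
elim: i => [|i IHi]; first by rewrite big_ord0 subrr.
by rewrite big_ord_recr /= IHi full_sum_step opprB addrA [in RHS]addrAC.
Qed.

(** The identity C_n(1) = 0, in the form that justifies truncating [Bn] at degree n. Positivity of n
    gives Q 0 = 0^n = 0. *)
Lemma sum_power_sums0 i : (n < i)%N -> \sum_(k < i) power_sum F k n = 0.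
Proof.
move=> lt; rewrite sum_power_sums; have -> : Q 0 = 0.
  by rewrite /Q big1 // => c _; rewrite big_ord0 expr0n eqn0Ngt n_gt0.
have -> : Q i = 0; last by rewrite subr0.
rewrite -[RHS](sum_pow_vanish (polyC : {rmorphism F -> {poly F}}) (fun k => 'X^k) 0 lt).
apply: eq_bigr => c _; rewrite add0r; congr (_ ^+ _); apply: eq_bigr => k _.
by rewrite mul_polyC.
Qed.

Lemma Bn_coef i : (Bn F n)`_i = \sum_(k < i.+1) power_sum F k n.
Proof.
rewrite /Bn n_even coef_poly ltnS; case: leqP => // lt.
by rewrite sum_power_sums0 // ltnS ltnW.
Qed.

Lemma Bn_even : (1 - 'X) * Bn F n = Cn F n.
Proof.
apply/polyP => i; rewrite Cn_coef mulrBl mul1r coefB coefXM !Bn_coef.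
case: i => [|i] /=; first by rewrite subr0 big_ord1.
by rewrite ?Bn_coef [X in X - _]big_ord_recr /= addrAC subrr add0r.
Qed.
End Even.

Lemma Bn_odd n : ~~ (q.-1 %| n)%N -> Bn F n = Cn F n.
Proof. by rewrite /Bn => /negbTE ->. Qed.

Lemma Bn_coef0 n : (0 < n)%N -> (Bn F n)`_0 = 1.
Proof.
move=> n0; have [e|o] := boolP (q.-1 %| n)%N; last by rewrite Bn_odd // Cn_coef power_sum0.
by rewrite Bn_coef // big_ord1 power_sum0.
Qed.
End PowerSums.

Section Truncation.
Variables (R : comNzRingType) (K : nat).
Implicit Types p r s : {poly R}.

Definition eqt p r : Prop := forall i, (i <= K)%N -> p`_i = r`_i.

Lemma eqt_refl p : eqt p p. Proof. by []. Qed.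
Lemma eqt_sym p r : eqt p r -> eqt r p. Proof. by move=> h i /h ->. Qed.
Lemma eqt_trans r p s : eqt p r -> eqt r s -> eqt p s.
Proof. by move=> h1 h2 i le; rewrite h1 ?h2. Qed.
Lemma eqt_mul p r p' r' : eqt p r -> eqt p' r' -> eqt (p * p') (r * r').
Proof.
move=> h h' i le; rewrite !coefM; apply: eq_bigr => k _; rewrite h ?h' //.
  by rewrite (leq_trans (leq_subr _ _)).
by rewrite (leq_trans _ le) // -ltnS.
Qed.
Lemma eqt_exp p r n : eqt p r -> eqt (p ^+ n) (r ^+ n).
Proof.
by move=> h; elim: n => [|n IHn]; rewrite ?expr0 // !exprS; apply: eqt_mul.
Qed.
Lemma eqt_prod (I : Type) (s : seq I) (P : pred I) (f g : I -> {poly R}) :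
  (forall i, P i -> eqt (f i) (g i)) ->
  eqt (\prod_(i <- s | P i) f i) (\prod_(i <- s | P i) g i).
Proof. by move=> h; elim/big_rec2: _ => // i x y Pi xy; apply: eqt_mul => //; apply: h. Qed.
End Truncation.

Lemma eqt_all (R : comNzRingType) (p r : {poly R}) : (forall K, eqt K p r) -> p = r.
Proof. by move=> h; apply/polyP => i; apply: (h i). Qed.

Lemma irreducible_factor (F : fieldType) (a : {poly F}) : (1 < size a)%N ->
  exists P, [/\ P \is monic, irreducible_poly P & P %| a].
Proof.
have [n] := ubnP (size a); elim: n a => // n IHn a san sa.
have a0 : a != 0 by rewrite -size_poly_gt0 ltnW.
have [ia|nia] := boolp.pselect (irreducible_poly a).
  have lc0 : (lead_coef a)^-1 != 0 by rewrite invr_eq0 lead_coef_eq0.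
  exists ((lead_coef a)^-1 *: a); split.
  - by rewrite monicE lead_coefZ mulVf // lead_coef_eq0.
  - split=> [|b sb]; first by rewrite size_scale.
    rewrite dvdpZr // => /(ia.2 _ sb) ba; apply: (eqp_trans ba).
    by rewrite eqp_sym eqp_scale.
  - by rewrite dvdpZl.
have [b [sb ba nba]] : exists b : {poly F}, [/\ size b != 1, b %| a & ~~ (b %= a)].
  apply: boolp.contrapT => H; apply: nia; split=> // b sb ba.
  by apply: contraT => nba; case: H; exists b.
have b0 : b != 0 by apply: contraNneq a0 => b0; move: ba; rewrite b0 dvd0p.
have sb1 : (1 < size b)%N by rewrite ltn_neqAle eq_sym sb size_poly_gt0.
have lt : (size b < size a)%N by rewrite ltn_neqAle dvdp_leq // andbT dvdp_size_eqp.
have [P [mP iP Pb]] := IHn b (leq_trans lt san) sb1.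
by exists P; split=> //; apply: dvdp_trans ba.
Qed.

(** * Euler products of the power sum series, by a sieve *)

Section EulerProduct.
Variables (F : finFieldType) (Om : fieldType) (jO : {rmorphism F -> Om}) (thm : Om) (n : nat).
Notation irr P := (boolp.asbool (irreducible_poly P)).

Let chi (a : {poly F}) : Om := ev1 jO thm a ^+ n.
Let chiM a b : chi (a * b) = chi a * chi b.
Proof. by rewrite /chi ev1M exprMn. Qed.

Definition coefs_of (g : nat) (P : {poly F}) : {ffun 'I_g -> F} := [ffun k : 'I_g => P`_k].

Lemma coefs_ofK g (P : {poly F}) : P \is monic -> size P = g.+1 -> monic_of (coefs_of g P) = P.
Proof.
move=> mP sP; have [c cE] := monic_of_surj mP.
have gE : (size P).-1 = g by rewrite sP.
move: c cE; rewrite gE => c cE; rewrite [RHS]cE; congr monic_of.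
by apply/ffunP => k; rewrite ffunE cE coef_monic_of.
Qed.

Definition sifted (S : seq {poly F}) (a : {poly F}) := all (fun P => ~~ (P %| a)) S.
Definition sifted_sum (S : seq {poly F}) (i : nat) : Om :=
  \sum_(c : {ffun 'I_i -> F} | sifted S (monic_of c)) chi (monic_of c).

(** The polynomials discarded by P are the products P b. As P is prime to the members of S, b passes
    the sieve S exactly when P b does, and the character is multiplicative. *)
Lemma sifted_step S P i : P \is monic -> irreducible_poly P ->
  (forall Q, Q \in S -> [/\ Q \is monic, irreducible_poly Q & Q != P]) ->
  sifted_sum S i = sifted_sum (P :: S) i +
    (if (i < (size P).-1)%N then 0 else chi P * sifted_sum S (i - (size P).-1)).
Proof.
move=> mP iP SP; set g := (size P).-1.
have sP : size P = g.+1 by rewrite prednK // size_poly_gt0 monic_neq0.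
rewrite {1}/sifted_sum (bigID (fun c : {ffun 'I_i -> F} => P %| monic_of c)) /= addrC.
congr (_ + _); first by apply: eq_bigl => c; rewrite /= andbC.
case: ltnP => [lt|le].
  rewrite big_pred0 // => c; apply/negbTE; rewrite negb_and orbC gtNdvdp //.
    by rewrite monic_neq0 // monic_of_monic.
  by rewrite size_monic_of sP ltnS.
rewrite mulr_sumr.
pose up (c : {ffun 'I_(i - g) -> F}) : {ffun 'I_i -> F} := coefs_of i (P * monic_of c).
pose down (c : {ffun 'I_i -> F}) := coefs_of (i - g) (monic_of c %/ P).
have upE c : monic_of (up c) = P * monic_of c.
  apply: coefs_ofK; first by rewrite monicMl // monic_of_monic.
  rewrite size_monicM // ?monic_neq0 ?monic_of_monic // sP size_monic_of addSn /=.
  by rewrite addnS subnKC.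
have downE c : P %| monic_of c -> monic_of (down c) * P = monic_of c.
  move=> dv; have mD : monic_of c %/ P \is monic.
    by rewrite -(monicMr _ mP) divpK // monic_of_monic.
  rewrite coefs_ofK ?divpK //.
  by rewrite size_divp ?monic_neq0 // size_monic_of -/g subSn.
rewrite (reindex_onto up down) /=; last first.
  by move=> c /andP[_ dv]; apply: monic_of_inj; rewrite upE mulrC downE.
apply: eq_big => [c|c _]; last by rewrite upE chiM.
rewrite upE dvdp_mulr // andbT.
have -> : (down (up c) == c) = true.
  apply/eqP/monic_of_inj; apply: (mulIf (monic_neq0 mP)).
  by rewrite downE upE ?dvdp_mulr // mulrC.
rewrite andbT; apply/allP/allP => H Q QS; have := H Q QS; apply: contra.
  by move=> Qc; rewrite dvdp_mull.
have [mQ iQ QP] := SP Q QS; rewrite Gauss_dvdpr //.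
rewrite (irreducible_poly_coprime _ iQ); apply/negP => QdP.
have := iP.2 _ _ QdP; rewrite neq_ltn; case: iQ => -> _; rewrite orbT => /(_ isT).
by rewrite eqp_monic // (negbTE QP).
Qed.

Lemma sifted_product K (S : seq {poly F}) :
  (forall Q, Q \in S -> Q \is monic /\ irreducible_poly Q) -> uniq S ->
  eqt K (\poly_(i < K.+1) sifted_sum [::] i * \prod_(P <- S) (1 - chi P *: 'X^((size P).-1)))
        (\poly_(i < K.+1) sifted_sum S i).
Proof.
elim: S => [|P S IHS] SP; first by rewrite big_nil mulr1.
case/andP=> PS uS; rewrite big_cons mulrCA mulrC.
have SP' Q : Q \in S -> Q \is monic /\ irreducible_poly Q.
  by move=> QS; apply: SP; rewrite inE QS orbT.
apply: (eqt_trans (eqt_mul (IHS SP' uS) (@eqt_refl _ K _))) => i le.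
have [mP iP] := SP P (mem_head _ _).
rewrite mulrBr mulr1 coefB -scalerAr coefZ coefMXn !coef_poly !ltnS le.
rewrite (@sifted_step S P i mP iP); last first.
  move=> Q QS; have [mQ iQ] := SP' Q QS; split=> //.
  by apply: contraNneq PS => <-.
case: ltnP => lt; first by rewrite addr0 mulr0 subr0.
by rewrite (leq_trans (leq_subr _ _) le) addrK.
Qed.

(** Each factor removes the multiples of one prime. With all primes of degree at most K removed, 1
    is the only monic polynomial of degree at most K that remains. *)
Lemma euler_product K :
  eqt K (\poly_(i < K.+1) ev1 jO thm (power_sum F i n) *
         \prod_(x : monic_index F K | irr (pol x))
            (1 - ev1 jO thm (pol x) ^+ n *: 'X^((size (pol x)).-1))) 1.
Proof.
pose S := [seq pol x | x <- enum (fun x : monic_index F K => irr (pol x))].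
have SP Q : Q \in S -> Q \is monic /\ irreducible_poly Q.
  case/mapP => x; rewrite mem_enum => /boolp.asboolP ix ->; split=> //.
  exact: pol_monic.
have uS : uniq S by rewrite map_inj_uniq ?enum_uniq //; apply: pol_inj.
have := sifted_product (K := K) SP uS.
have -> : \poly_(i < K.+1) sifted_sum [::] i = \poly_(i < K.+1) ev1 jO thm (power_sum F i n).
  apply/polyP => i; rewrite !coef_poly; case: ifP => // _.
  by rewrite power_sumE rmorph_sum; apply: eq_bigr => c _; rewrite rmorphXn.
rewrite big_map big_enum_cond /= (eq_bigl (fun x : monic_index F K => irr (pol x))); last first.
  by move=> x; rewrite andbT.
move=> H; apply: (eqt_trans H) => i le; rewrite coef_poly ltnS le coef1.
case: i le => [_|i le] /=.
  rewrite /sifted_sum (big_pred1 [ffun=> 0]) => [|c].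
    by rewrite /chi /monic_of big_ord0 addr0 expr0 ev1_1 expr1n.
  rewrite /= /monic_of big_ord0 addr0 expr0.
  have -> : sifted S 1.
    apply/allP => Q /SP [_ iQ]; apply/negP => /dvdp_leq; rewrite oner_neq0 size_poly1.
    by move=> /(_ isT); rewrite leqNgt; case: iQ => ->.
  by apply/esym/eqP/ffunP => -[].
apply: big_pred0 => c; apply/negbTE/negP => /allP sif.
have [|P [mP iP dv]] := @irreducible_factor F (monic_of c); first by rewrite size_monic_of.
have [|x PE] := @pol_surj F K P mP.
  have := dvdp_leq (monic_neq0 (monic_of_monic c)) dv; rewrite size_monic_of => sP.
  by rewrite (leq_trans _ le) // -ltnS (leq_trans _ sP) // prednK // size_poly_gt0 monic_neq0.
have PS : P \in S by apply/mapP; exists x => //; rewrite mem_enum; apply/boolp.asboolP; rewrite -PE.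
by have := sif P PS; rewrite dv.
Qed.
End EulerProduct.

(** * The zeta polynomial modulo p *)

Section CyclotomicFactor.
Variables (Om : fieldType).

Lemma prim_root_prod f (w : Om) : f.-primitive_root w ->
  \prod_(k < f) (1 - w ^+ k *: 'X) = 1 - 'X^f.
Proof.
move=> wf; have f0 := prim_order_gt0 wf.
(* z is the inverse of w, so 1 - w^k X = - w^k (X - z^k). The constant that this produces is found
   by evaluating at 0. *)
pose z := w ^+ f.-1.
have zf : f.-primitive_root z.
  by have := exp_prim_root wf f.-1; rewrite (eqP (coprimePn f0)) divn1.
have zw k : w ^+ k * z ^+ k = 1.
  by rewrite -exprMn /z -exprS prednK // (prim_expr_order wf) expr1n.
have E : \prod_(k < f) (1 - w ^+ k *: 'X) = (\prod_(k < f) (- w ^+ k)) *: ('X^f - 1).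
  rewrite -(factor_Xn_sub_1 zf) big_mkord -scaler_prod; apply: eq_bigr => k _.
  by rewrite scaleNr scalerBr opprB -[_ *: _%:P]mul_polyC -polyCM zw.
have := congr1 (horner^~ 0) E; rewrite horner_prod big1 => [|k _].
  rewrite hornerZ hornerD hornerN hornerXn hornerC expr0n eqn0Ngt f0 sub0r mulrN1 => c1.
  by rewrite E -[\prod_(i < f) _]opprK -c1 scaleN1r opprB.
by rewrite hornerD hornerN hornerZ hornerX hornerC mulr0 subr0.
Qed.

Lemma prod_periodic (A : comNzRingType) (G : nat -> A) f c :
  (forall k, G (f + k)%N = G k) -> \prod_(k < c * f) G k = (\prod_(k < f) G k) ^+ c.
Proof.
move=> per; elim: c => [|c IHc]; first by rewrite mul0n big_ord0.
rewrite mulSn -(big_mkord predT) (@big_cat_nat _ _ _ f) ?leq_addr //= exprS big_mkord.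
congr (_ * _); rewrite -{1}[f]addn0 addnC big_addn addKn big_mkord -IHc.
by apply: eq_bigr => k _; rewrite addnC per.
Qed.

Lemma prim_root_prod_pow f (w : Om) c g : f.-primitive_root w ->
  \prod_(k < c * f) (1 - w ^+ k *: 'X^g) = (1 - 'X^(g * f)) ^+ c.
Proof.
move=> wf; rewrite (@prod_periodic _ (fun k => 1 - w ^+ k *: 'X^g)) => [|k]; last first.
  by rewrite exprD (prim_expr_order wf) mul1r.
congr (_ ^+ _); have := congr1 (fun p => p \Po 'X^g) (prim_root_prod wf).
rewrite rmorph_prod /= rmorphB rmorph1 /= comp_Xn_poly -exprM => <-.
by apply: eq_bigr => k _; rewrite rmorphB rmorph1 /= comp_polyZ comp_polyX.
Qed.
End CyclotomicFactor.

Section ZetaReduction.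
Variables (F : finFieldType) (L : closedFieldType).
Variable (iota : {rmorphism {fraction {poly F}} -> L}).
Hypothesis L_alg : forall x : L, exists P : {poly {fraction {poly F}}},
  P != 0 /\ root (map_poly iota P) x.
Variables (m : {poly F}) (m_monic : m \is monic) (m_irr : irreducible_poly m).
Variables (Om : closedFieldType) (jO : {rmorphism F -> Om}).
Variables (thm : Om) (thm_root : ev1 jO thm m = 0).
Variables (h : nat) (hq : (h %| #|F|.-1)%N) (h_gt0 : (0 < h)%N).
Variables (la : L) (cla : la != 0 /\ carl (embA iota) m la = 0).
Let q := #|F|.
Notation jL := (cst (embA iota) : {rmorphism F -> L}).
Notation T := (embA iota 'X).
Notation d := (size m).-1.
Notation Kh := (Kgen jL T (la ^+ h)).
Notation N := (Nh F h d).
Notation Ninf := (Nh F q.-1 d).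
Notation zeta P := (ev1 jO thm P ^+ h).
Notation irr P := (boolp.asbool (irreducible_poly P)).
Notation deg P := (size P).-1.
Let red : {rmorphism {poly int} -> {poly Om}} := map_poly (intr : {rmorphism int -> Om}).

Definition euler_factor n K : {poly Om} :=
  \prod_(x : monic_index F K | irr (pol x)) (1 - ev1 jO thm (pol x) ^+ n *: 'X^(deg (pol x))).

Definition Cbar n : {poly Om} := map_poly (ev1 jO thm) (Cn F n).
Definition Bbar n : {poly Om} := map_poly (ev1 jO thm) (Bn F n).

Lemma euler_Cbar n K : eqt K (Cbar n * euler_factor n K) 1.
Proof.
move=> k lek; rewrite -(euler_product jO thm n lek); move: k lek.
apply: eqt_mul => //.
by move=> i le; rewrite [RHS]coef_poly ltnS le coef_map Cn_coef.
Qed.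

Lemma Cbar0 : Cbar 0 = 1.
Proof.
apply/polyP => i; rewrite coef_map Cn_coef coef1 /=; case: i => [|i].
  by rewrite power_sum0 ev1_1.
by rewrite power_sum_vanish // ev1_0.
Qed.

Lemma places_product (B : nat -> nat) K : (0 < K)%N ->
  (forall e, (0 < e)%N -> nplaces iota Kh e (B e)) ->
  eqt K (red (\prod_(1 <= e < K.+1) (1 - 'X^e) ^+ B e))
        ((1 - 'X) ^+ Ninf * \prod_(k < N) euler_factor (h * k) K).
Proof.
move=> K0 HB.
have [f [f_gt0 f_prim fm count]] :=
  count_formula L_alg m_monic m_irr thm_root hq h_gt0 cla.
pose c (x : monic_index F K) := if pol x == m then 1%N else (N %/ f (pol x))%N.
pose C (x : monic_index F K) e := irr (pol x) && (deg (pol x) * f (pol x) == e)%N.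
have fN (x : monic_index F K) : irr (pol x) -> pol x != m -> (f (pol x) %| N)%N.
  move=> /boolp.asboolP ix xm; rewrite (prim_order_dvd (f_prim _ (pol_monic x) ix xm)).
  by rewrite (zeta_N m_monic m_irr thm_root hq (pol_monic x) ix xm).
have BE e : (0 < e <= K)%N -> B e = (\sum_(x | C x e) c x + (e == 1%N) * Ninf)%N.
  move=> eK; apply/eqP; rewrite -(eqr_nat rat); apply/eqP.
  have e0 : (0 < e)%N by case/andP: eK.
  rewrite (count K e (B e) eK (HB e e0)) natrD natr_sum; congr (_ + _).
  apply: eq_bigr => x /andP[ix _]; rewrite /c; case: (boolP (pol x == m)) => [//|xm].
  by rewrite natf_div // fN.
have factor (x : monic_index F K) : irr (pol x) ->
   (1 - 'X^(deg (pol x) * f (pol x))) ^+ c x =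
   \prod_(k < N) (1 - ev1 jO thm (pol x) ^+ (h * k) *: 'X^(deg (pol x))) :> {poly Om}.
  move=> ix; rewrite /c; case: (eqVneq (pol x) m) => [xm|xm].
    (* Above m the character value is 0, and only the factor k = 0 differs from 1, because 0^0 =
       1. *)
    rewrite xm fm muln1 expr1 thm_root -(prednK (N_gt0 m_irr hq)) big_ord_recl /=.
    rewrite muln0 expr0 scale1r big1 ?mulr1 // => i _.
    by rewrite expr0n muln_eq0 (gtn_eqF h_gt0) /= scale0r subr0.
  have /boolp.asboolP ix' := ix.
  rewrite -(prim_root_prod_pow _ _ (f_prim _ (pol_monic x) ix' xm)) divnK ?fN //.
  by apply: eq_bigr => k _; rewrite exprM.
have -> : red (\prod_(1 <= e < K.+1) (1 - 'X^e) ^+ B e) =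
   (\prod_(e < K) \prod_(x | C x e.+1) (1 - 'X^(e.+1)) ^+ c x) * (1 - 'X) ^+ Ninf.
  rewrite big_add1 big_mkord rmorph_prod /=.
  have -> : (1 - 'X) ^+ Ninf = \prod_(e < K) (1 - 'X^(e.+1)) ^+ ((e.+1 == 1%N) * Ninf) :> {poly Om}.
    rewrite -(prednK K0) big_ord_recl /= mul1n big1 ?mulr1 //.
  rewrite -big_split /=; apply: eq_bigr => e _.
  rewrite rmorphXn rmorphB rmorph1 /= map_polyXn BE ?ltn_ord // exprD expr_sum.
  by [].
rewrite mulrC; apply: eqt_mul; first exact: eqt_refl.
rewrite (exchange_big_dep (fun x : monic_index F K => irr (pol x))) /=; last by move=> e x _ /andP[].
rewrite [X in eqt _ _ X]exchange_big /=; apply: eqt_prod => x ix.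
rewrite -factor //.
set gf := (deg (pol x) * f (pol x))%N.
have gf0 : (0 < gf)%N.
  move/boolp.asboolP: ix => ix'; rewrite muln_gt0 f_gt0 ?pol_monic // andbT.
  exact: irr_deg_gt0.
(* A prime whose places have degree greater than K is absent from the left side, and its factor on
   the right is 1 modulo u^(K+1). *)
have [le|lt] := leqP gf K.
  have lt : (gf.-1 < K)%N by rewrite prednK.
  rewrite (big_pred1 (Ordinal lt)) /= ?prednK //.
  move=> e; rewrite /C ix /= -/gf -(inj_eq val_inj) /= -(prednK gf0) eqSS eq_sym.
  by rewrite (prednK gf0).
rewrite big_pred0 => [|e]; last first.
  by rewrite /C ix /= -/gf; apply/negbTE; rewrite neq_ltn [X in _ || X](leq_ltn_trans _ lt) ?orbT.
rewrite -[X in eqt _ X](expr1n _ (c x)); apply: eqt_exp => i le.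
by rewrite coefB coefXn (ltn_eqF (leq_ltn_trans le lt)) subr0.
Qed.

(** As q = 0 in [Om], the right side of the zeta identity reduces to 1 - u. Multiplying by all the
    [Cbar] cancels the Euler factors of the finite places and leaves those of the places at
    infinity. *)
Lemma zeta_times_pole Z : is_zeta_poly iota Kh Z ->
  red Z * (1 - 'X) ^+ Ninf = (1 - 'X) * \prod_(k < N) Cbar (h * k).
Proof.
move=> [B [HB HZ]].
suff main K : eqt K.+1 (red Z * (1 - 'X) ^+ Ninf) ((1 - 'X) * \prod_(k < N) Cbar (h * k)).
  by apply: eqt_all => K i le; apply: (main K); apply: leqW.
have H1 : eqt K.+1 (red Z * red (\prod_(1 <= e < K.+2) (1 - 'X^e) ^+ B e)) (1 - 'X).
  move=> i le; rewrite -rmorphM coef_map (HZ K.+1 i le).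
  rewrite -(coef_map (intr : {rmorphism int -> Om})) -/(red _); congr (_`_i).
  rewrite rmorphM !rmorphB !rmorph1 /= map_polyX map_polyZ /= map_polyX.
  by rewrite rmorph_nat (card_eq0 jO) scale0r subr0 mulr1.
have H2 := places_product (ltn0Sn K) HB.
have H3 := eqt_trans (eqt_sym (eqt_mul (@eqt_refl _ _ (red Z)) H2)) H1.
have H4 : eqt K.+1 (\prod_(k < N) Cbar (h * k) * \prod_(k < N) euler_factor (h * k) K.+1) 1.
  rewrite -big_split /=; have P1 : \prod_(k < N) (1 : {poly Om}) = 1 by rewrite big1.
  rewrite -[X in eqt _ _ X]P1.
  by apply: eqt_prod => k _; apply: euler_Cbar.
have H5 := eqt_mul H3 (@eqt_refl _ _ (\prod_(k < N) Cbar (h * k))).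
apply: eqt_trans H5; apply: eqt_sym.
set A := \prod_(k < N) Cbar _ in H4 *; set E := \prod_(k < N) euler_factor _ _ in H4 *.
have -> : red Z * ((1 - 'X) ^+ Ninf * E) * A = red Z * (1 - 'X) ^+ Ninf * (A * E).
  by rewrite !mulrA mulrAC.
rewrite -[X in eqt _ _ X]mulr1; apply: eqt_mul => //.
Qed.

Lemma Cbar_Bbar n : (0 < n)%N -> Cbar n = (1 - 'X) ^+ (q.-1 %| n)%N * Bbar n.
Proof.
move=> n0; rewrite /Cbar /Bbar; case: (boolP (q.-1 %| n)%N) => [e|o].
  by rewrite -Bn_even // rmorphM rmorphB rmorph1 /= map_polyX expr1.
by rewrite Bn_odd // mul1r.
Qed.

(** q - 1 divides h k exactly when gp divides k, and N = Ninf gp. The deficit of one against the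
    exponent at infinity is made up by the factor 1 - u of [zeta_times_pole]. *)
Lemma even_count : (\sum_(1 <= k < N) (q.-1 %| h * k)%N)%N = Ninf.-1.
Proof.
set gp := (q.-1 %/ h)%N.
have gp0 : (0 < gp)%N by rewrite divn_gt0 // dvdn_leq // q1_gt0.
have NE : N = (Ninf * gp)%N by rewrite /Nh divnn q1_gt0 muln1.
have N0 : (0 < N)%N := N_gt0 m_irr hq.
have Ni0 : (0 < Ninf)%N by move: N0; rewrite NE muln_gt0 => /andP[].
have := divn_count_dvd gp N.-1; rewrite prednK // => E.
transitivity (N.-1 %/ gp)%N.
  rewrite E; apply: eq_bigr => k _; congr (nat_of_bool _).
  by rewrite -[X in (X %| _)%N](divnK hq) -/gp [(h * k)%N]mulnC dvdn_pmul2r.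
rewrite NE -(prednK Ni0) /= mulSn -[in (gp + _).-1](prednK gp0) addSn /= addnC.
by rewrite (prednK gp0) divnMDl // divn_small ?addn0 // prednK.
Qed.

Theorem zeta_mod Z : is_zeta_poly iota Kh Z ->
  red Z = \prod_(1 <= k < N) Bbar (h * k).
Proof.
move=> /zeta_times_pole; have N0 : (0 < N)%N := N_gt0 m_irr hq.
have -> : \prod_(k < N) Cbar (h * k) = \prod_(1 <= k < N) Cbar (h * k).
  rewrite -(big_mkord predT (fun k => Cbar (h * k))) [LHS]big_ltn // [X in Cbar X]muln0.
  by rewrite Cbar0 mul1r.
have -> : \prod_(1 <= k < N) Cbar (h * k) =
   (1 - 'X) ^+ (\sum_(1 <= k < N) (q.-1 %| h * k)%N) * \prod_(1 <= k < N) Bbar (h * k).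
  rewrite expr_sum -big_split /= big_nat [RHS]big_nat; apply: eq_bigr => k /andP[k0 _].
  by rewrite Cbar_Bbar // muln_gt0 h_gt0.
rewrite even_count mulrA -exprS prednK; last first.
  by rewrite /Nh muln_gt0; move: N0; rewrite /Nh muln_gt0 => /andP[-> _]; rewrite divnn q1_gt0.
rewrite mulrC; apply: mulfI; rewrite expf_neq0 //.
by rewrite -[_ - _]opprK opprB oppr_eq0 -polyC1 polyXsubC_eq0.
Qed.
End ZetaReduction.

(** * Descent to the prime field and norms *)

Section PrimeField.
Variables (p : nat) (p_prime : prime p) (Om : closedFieldType) (pOm : p \in [pchar Om]).

Lemma natr_mod n : (n %% (Zp_trunc (pdiv p)).+2)%:R = n%:R :> Om.
Proof.
rewrite Fp_cast //.
by rewrite [in RHS](divn_eq n p) natrD natrM (pcharf0 pOm) mulr0 add0r.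
Qed.

Definition Fp_inj (pO : p \in [pchar Om]) (c : 'F_p) : Om := (val c)%:R.

Fact Fp_inj_zmod : zmod_morphism (Fp_inj pOm).
Proof.
have add x y : Fp_inj pOm (x + y) = Fp_inj pOm x + Fp_inj pOm y.
  by rewrite /Fp_inj /= natr_mod natrD.
by move=> x y; apply: (addIr (Fp_inj pOm y)); rewrite -add !subrK.
Qed.

Fact Fp_inj_monoid : monoid_morphism (Fp_inj pOm).
Proof.
split=> [|x y]; last by rewrite /Fp_inj /= natr_mod natrM.
by rewrite /Fp_inj /= natr_mod.
Qed.

HB.instance Definition _ := GRing.isZmodMorphism.Build 'F_p Om (Fp_inj pOm) Fp_inj_zmod.
HB.instance Definition _ := GRing.isMonoidMorphism.Build 'F_p Om (Fp_inj pOm) Fp_inj_monoid.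

(** An instance of [ev1_dvd] with the prime field as base and alpha as root of the irreducible f. *)
Lemma dvd_mod_p (f : {poly 'F_p}) (alpha : Om) (Z : {poly int}) :
  irreducible_poly f ->
  root (map_poly (fun c : 'F_p => (val c)%:R) f) alpha ->
  (f %| map_poly (fun z : int => z%:~R : 'F_p) Z) =
  root (map_poly (intr : {rmorphism int -> Om}) Z) alpha.
Proof.
move=> irf /rootP f0.
rewrite -(ev1_dvd (jO := Fp_inj pOm) irf f0) rootE /ev1; congr (_.[_] == 0).
apply/polyP => i; rewrite coef_map /= coef_map_id0 // coef_map_id0 //.
exact: rmorph_int.
Qed.
End PrimeField.

Section Norm.
Variables (F : finFieldType) (Om : closedFieldType) (j : {rmorphism F -> Om}).
Let q := #|F|.
Notation fr := (frobq j 1).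

Lemma frobq1 x : fr x = x ^+ q. Proof. by rewrite /frobq expn1. Qed.

Lemma Bn_eval_frob n b : map_poly fr (Bn_eval j n b) = Bn_eval j n (b ^+ q).
Proof.
rewrite /Bn_eval rmorph_sum /=; apply: eq_bigr => i _; rewrite rmorphM /= map_polyC /=.
rewrite frobq1 exprAC; congr (_ * _); apply/polyP => k.
by rewrite !coef_map /= /frobq frob_const.
Qed.

(** Frobenius on coefficients permutes the factors cyclically, so the coefficients of the product
    are fixed by x |-> x^q and come from F. *)
Lemma Bn_norm_descent n alpha s : (0 < s)%N -> alpha ^+ (q ^ s) = alpha ->
  exists G : {poly F}, Bn_norm j n alpha s = map_poly j G.
Proof.
move=> s0 per; set B := Bn_norm j n alpha s.
have fB : map_poly fr B = B.
  rewrite /B /Bn_norm rmorph_prod /= -(prednK s0) big_ord_recr [RHS]big_ord_recl /= mulrC.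
  congr (_ * _); first by rewrite Bn_eval_frob -exprM -expnSr prednK // per expr1.
  by apply: eq_bigr => i _; rewrite Bn_eval_frob -exprM -expnSr.
exists (\poly_(i < size B) odflt 0 [pick c | j c == B`_i]).
apply/polyP => i; rewrite coef_map coef_poly; case: ltnP => [_|le]; last first.
  by rewrite nth_default // [RHS]raddf0.
have [|c Bc] := @frob_fixed_const F Om j B`_i.
  by rewrite -[in RHS]fB coef_map /= frobq1.
by case: pickP => [c' /eqP <- //|/(_ c)]; rewrite Bc eqxx.
Qed.

Variables (m : {poly F}) (m_monic : m \is monic) (m_irr : irreducible_poly m).
Variables (thm : Om) (thm_root : ev1 j thm m = 0).

Lemma Bn_eval_thm n b : (Bn_eval j n b).[thm] = (Bbar j thm n).[b].
Proof.
rewrite /Bn_eval horner_sum -[RHS]/(ev2 j thm b (Bn F n)) ev2E; apply: eq_bigr => i _.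
by rewrite hornerM hornerC.
Qed.

(** With the norm written as the image of G in A, m divides G exactly when G vanishes at theta, and
    this value is the product of the values of [Bbar] at the conjugates of alpha. *)
Lemma divA_norm n alpha s : deg_over_Fq F alpha s ->
  divA j m (Bn_norm j n alpha s) <->
  exists i : 'I_s, root (Bbar j thm n) (alpha ^+ (q ^ i)).
Proof.
move=> [s0 per _]; have [G BG] := Bn_norm_descent n s0 per.
have prodE : (Bn_norm j n alpha s).[thm] = \prod_(i < s) (Bbar j thm n).[alpha ^+ (q ^ i)].
  by rewrite /Bn_norm horner_prod; apply: eq_bigr => i _; rewrite Bn_eval_thm.
split=> [[g Bg]|[i ri]].
  have /eqP/prodf_eq0 [i _ /eqP ri] : \prod_(i < s) (Bbar j thm n).[alpha ^+ (q ^ i)] = 0.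
    by rewrite -prodE Bg -[LHS]/(ev1 j thm (m * g)) ev1M thm_root mul0r.
  by exists i; apply/rootP.
have /dvdpP [g Gg] : m %| G.
  rewrite -(ev1_dvd m_irr thm_root) /ev1 -BG prodE (bigD1 i) //=.
  by rewrite (rootP ri) mul0r.
by exists g; rewrite BG Gg mulrC.
Qed.

(** The coefficients lie in the prime field, so Z(x^(q^i)) = Z(x)^(q^i). *)
Lemma int_poly_root_frob (Z : {poly int}) x i :
  root (map_poly (intr : {rmorphism int -> Om}) Z) (x ^+ (q ^ i)) ->
  root (map_poly (intr : {rmorphism int -> Om}) Z) x.
Proof.
have E y : (map_poly (intr : {rmorphism int -> Om}) Z).[y] =
    ev1 j y (map_poly (intr : {rmorphism int -> F}) Z).
  rewrite /ev1 -map_poly_comp; congr (_.[_]); apply: eq_map_poly => z /=.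
  by rewrite rmorph_int.
by rewrite !rootE !E -ev1_frob expf_eq0 expn_gt0 (ltnW (q_gt1 F)) /=.
Qed.

Lemma root_prod_has (ns : seq nat) (G : nat -> {poly Om}) x :
  root (\prod_(n <- ns) G n) x = has (fun n => root (G n) x) ns.
Proof. by rewrite rootE horner_prod prodf_seq_eq0. Qed.

Lemma root_Bbar_prod (Z : {poly int}) (ns : seq nat) alpha s :
  map_poly (intr : {rmorphism int -> Om}) Z = \prod_(n <- ns) Bbar j thm n ->
  deg_over_Fq F alpha s ->
  root (map_poly (intr : {rmorphism int -> Om}) Z) alpha <->
  exists2 n, n \in ns & divA j m (Bn_norm j n alpha s).
Proof.
move=> ZE Hs; split=> [|[n nin /(divA_norm n Hs) [i ri]]].
  rewrite ZE root_prod_has => /hasP [n nin rn]; exists n => //.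
  apply/(divA_norm n Hs); have [s0 _ _] := Hs; exists (Ordinal s0).
  by rewrite expn0 expr1.
apply: (@int_poly_root_frob Z alpha i); rewrite ZE root_prod_has.
by apply/hasP; exists n.
Qed.

(** The constant coefficient is s_0(n) = 1. *)
Lemma Bbar_neq0 n : (0 < n)%N -> Bbar j thm n != 0.
Proof.
move=> n0; apply: contraTneq (oner_neq0 Om) => E.
by rewrite -(ev1_1 j thm) -(Bn_coef0 F n0) -coef_map -/(Bbar j thm n) E coef0 eqxx.
Qed.
End Norm.

Theorem theorem4p1
  (F : finFieldType) (p : nat) (p_prime : prime p) (charF : p \in [pchar F])
  (L : closedFieldType) (iota : {rmorphism {fraction {poly F}} -> L})
  (L_alg : forall x : L, exists P : {poly {fraction {poly F}}},
             P != 0 /\ root (map_poly iota P) x)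
  (m : {poly F}) (m_monic : m \is monic) (m_irr : irreducible_poly m)
  (Zm Zplus Zminus : {poly int})
  (HZm : is_zeta_poly iota (cyclo_field iota m) Zm)
  (HZplus : is_zeta_poly iota (cyclo_field_plus iota m) Zplus)
  (HZminus : Zm = Zminus * Zplus)
  (Omega : closedFieldType) (j : {rmorphism F -> Omega})
  (f : {poly 'F_p}) (f_monic : f \is monic) (f_irr : irreducible_poly f)
  (alpha : Omega) (f_alpha : root (map_poly (fun c : 'F_p => (val c)%:R) f) alpha)
  (s : nat) (Hs : deg_over_Fq F alpha s) :
  let q := #|F| in
  let d := (size m).-1 in
  ((f %| map_poly (fun z : int => z%:~R : 'F_p) Zminus) <->
     exists n : nat, [/\ (1 <= n <= q ^ d - 2)%N, ~~ (q.-1 %| n)%N &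
                        divA j m (Bn_norm j n alpha s)]) /\
  ((f %| map_poly (fun z : int => z%:~R : 'F_p) Zplus) <->
     exists n : nat, [/\ (1 <= n <= q ^ d - 2)%N, (q.-1 %| n)%N &
                        divA j m (Bn_norm j n alpha s)]).
Proof.
move=> q d.
have pOm : p \in [pchar Omega] := rmorph_pchar j charF.
have [thm thm_root] := irr_root_exists j m_irr.
have [la cla] := croot_exists iota m_monic m_irr.
have q1 : (0 < q.-1)%N := q1_gt0 F.
have qd1 : (0 < q ^ d)%N by rewrite expn_gt0 (ltnW (q_gt1 F)).
pose red := map_poly (intr : {rmorphism int -> Omega}).
pose all_n := index_iota 1 (q ^ d).-1.
have all_nP n : (n \in all_n) = (1 <= n <= q ^ d - 2)%N by rewrite mem_index_iota; lia.
(* Case h = 1, with N = q^d - 1: the index k is n itself. *)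
have redm : red Zm = \prod_(n <- all_n) Bbar j thm n.
  rewrite (cyclo_fieldE m_monic m_irr cla) -[la]expr1 in HZm.
  rewrite /red (zeta_mod L_alg m_monic m_irr thm_root (dvd1n _) isT cla HZm).
  rewrite -[Nh _ _ _]muln1 Nh_mul ?dvd1n //; apply: eq_bigr => n _; by rewrite mul1n.
(* Case h = q - 1: n = (q - 1) k, and the bound k < N is the same as n < q^d - 1. *)
have redp : red Zplus = \prod_(n <- all_n | (q.-1 %| n)%N) Bbar j thm n.
  rewrite (cyclo_field_plusE L_alg m_monic m_irr thm_root cla) in HZplus.
  rewrite /red (zeta_mod L_alg m_monic m_irr thm_root (dvdnn _) q1 cla HZplus).
  rewrite -(big_map (muln q.-1) predT (Bbar j thm)) -[RHS]big_filter.
  apply: perm_big; apply: uniq_perm.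
  - by rewrite map_inj_uniq ?iota_uniq // => x y /eqP; rewrite eqn_pmul2l // => /eqP.
  - by rewrite filter_uniq // iota_uniq.
  move=> n; rewrite mem_filter mem_index_iota -(Nh_mul d (dvdnn q.-1)).
  apply/mapP/andP => [[k]|[/dvdnP [k ->] /andP [k0 kN]]].
    rewrite mem_index_iota => /andP [k0 kN] ->; rewrite dvdn_mulr // muln_gt0 q1 k0.
    by rewrite mulnC ltn_pmul2r.
  exists k; last by rewrite mulnC.
  by rewrite mem_index_iota -[(k < _)%N](ltn_pmul2r q1) kN andbT; case: (k) k0.
(* Being a product of nonzero [Bbar], Zplus stays nonzero modulo p and can be cancelled from Zm =
   Zminus Zplus, which leaves the n not divisible by q - 1. *)
have redneg : red Zminus = \prod_(n <- all_n | ~~ (q.-1 %| n)%N) Bbar j thm n.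
  have redp0 : red Zplus != 0.
    rewrite redp big_seq_cond; elim/big_ind: _ => [|x y|n /andP [nin _]].
    - exact: oner_neq0.
    - exact: mulf_neq0.
    by apply: Bbar_neq0; move: nin; rewrite mem_index_iota => /andP [].
  have redM : red Zm = red Zminus * red Zplus by rewrite /red HZminus rmorphM.
  apply: (mulIf redp0); rewrite -redM redm redp.
  by rewrite (bigID (fun n => q.-1 %| n)%N) mulrC.
have key (Z : {poly int}) (P : pred nat) : red Z = \prod_(n <- all_n | P n) Bbar j thm n ->
    (f %| map_poly (fun z : int => z%:~R : 'F_p) Z) <->
    exists n, [/\ (1 <= n <= q ^ d - 2)%N, P n & divA j m (Bn_norm j n alpha s)].
  rewrite -big_filter (dvd_mod_p p_prime pOm _ f_irr f_alpha) => redE.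
  apply: iff_trans (root_Bbar_prod m_irr thm_root redE Hs) _.
  split=> [[n]|[n [nn Pn Dn]]].
    by rewrite mem_filter all_nP => /andP [Pn nn] Dn; exists n.
  by exists n; rewrite // mem_filter all_nP Pn.
by split; [exact: key _ _ redneg | exact: key _ _ redp].
Qed.
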